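(* There exists an absolute constant $C>0$ such that for every integer $n\ge 2$ and every projection body $D$ in $\mathbb{R}^n$ which is in isotropic position up to a dilation, $$S(D)\le C\,\log^2 n\,\max_{\xi\in S^{n-1}} S(D\vert\xi^\perp)\;|D|^{\frac1n}.$$
   Context: A convex body in $\mathbb{R}^n$ is a compact convex set with nonempty interior; it is origin-symmetric if $K=-K$. $|\cdot|$ denotes volume of the proper dimension. For $\xi\in S^{n-1}$, $D\vert\xi^\perp$ is the orthogonal projection of $D$ onto the hyperplane $\xi^\perp$ through the origin perpendicular to $\xi$. $S(\cdot)$ denotes surface area: $S(D)=\lim_{\varepsilon\to+0}\frac{|D+\varepsilon B_2^n|-|D|}{\varepsilon}$, where $B_2^n$ is the unit Euclidean ball in $\mathbb{R}^n$; the surface area $S(D\vert\xi^\perp)$ is computed in the $(n-1)$-dimensional space $\xi^\perp$, i.e. $S(D\vert\xi^\perp)=\lim_{\varepsilon\to+0}\frac{|(D\vert\xi^\perp)+\varepsilon B_2^{n-1}|-|D\vert\xi^\perp|}{\varepsilon}$, with $B_2^{n-1}$ the unit Euclidean ball of $\xi^\perp$ and $|\cdot|$ the $(n-1)$-dimensional volume. The support function of an origin-symmetric convex body $K$ is $h_K(x)=\max_{\xi\in K}(x,\xi)$, $x\in\mathbb{R}^n$. The projection body $\Pi K$ of an origin-symmetric convex body $K$ is the origin-symmetric convex body defined by $h_{\Pi K}(\theta)=|K\vert\theta^\perp|$ for all $\theta\in S^{n-1}$. A body $L$ is called a projection body if it is the projection body of some convex body. A body $K$ is in isotropic position if $|K|=1$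 and there is a constant $L_K>0$ such that $\int_K (x,\xi)^2\,dx=L_K^2$ for all $\xi\in S^{n-1}$. A body $D$ is in isotropic position up to a dilation if $tD$ is in isotropic position for some $t>0$. ''Absolute constant'' means independent of $n$ and of the body. $\log^2 n=(\log n)^2$. *)

(* Defs.v *)
From HB Require Import structures.
From mathcomp Require Import all_boot all_order all_algebra.
From mathcomp Require Import all_classical all_reals all_analysis.
From mathcomp Require Import ring.
Import Order.TTheory GRing.Theory Num.Theory.
Import numFieldNormedType.Exports.

Set Implicit Arguments.
Unset Strict Implicit.
Unset Printing Implicit Defensive.

Local Open Scope classical_set_scope.
Local Open Scope ring_scope.

Definition rV_display : measure_display. Proof. exact. Qed.

Section rV_measurable.
Context (R : realType) (n : nat).

Let coord (i : 'I_n) (x : 'rV[R]_n) : measurableTypeR R := x ord0 i.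

(* Since R is second countable, the product sigma-algebra of the Borel sets
   of R is the Borel sigma-algebra of 'rV[R]_n. *)
Definition rV_measurable : set (set 'rV[R]_n) := g_sigma_preimage coord.

Let rV_set0 : rV_measurable set0.
Proof. exact: sigma_algebra0. Qed.

Let rV_setC A : rV_measurable A -> rV_measurable (~` A).
Proof. exact: sigma_algebraC. Qed.

Let rV_bigcup (F : (set 'rV[R]_n)^nat) : (forall i, rV_measurable (F i)) ->
  rV_measurable (\bigcup_i F i).
Proof. exact: sigma_algebra_bigcup. Qed.

HB.instance Definition _ := @isMeasurable.Build rV_display 'rV[R]_n
  rV_measurable rV_set0 rV_setC rV_bigcup.

Lemma measurable_coord (i : 'I_n) :
  measurable_fun [set: 'rV[R]_n] (fun x => x ord0 i : measurableTypeR R).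
Proof.
move=> _ Y mY; rewrite setTI; apply: sub_sigma_algebra => /=.
rewrite -bigcup_seq/=; exists i => /=; first by rewrite mem_index_enum.
by exists Y => //; rewrite setTI.
Qed.

Lemma measurable_fun_rVP d (T : measurableType d) (f : T -> 'rV[R]_n) :
  (forall i, measurable_fun [set: T] (fun t => f t ord0 i : measurableTypeR R)) ->
  measurable_fun [set: T] f.
Proof.
move=> mf _ A mA; rewrite setTI.
suff : rV_measurable `<=` [set B | measurable (f @^-1` B)] by apply.
apply: smallest_sub; first split => /=.
- by rewrite preimage_set0.
- by move=> B; rewrite setTD preimage_setC; exact: measurableC.
- by move=> F mF; rewrite preimage_bigcup; exact: bigcup_measurable.
- move=> B /=; rewrite -bigcup_seq => -[i _ [C mC <-]] /=.
  by rewrite setTI -[X in measurable X]setTI; exact: mf.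
Qed.

End rV_measurable.

Section lebesgue_rV.
Context (R : realType).

Definition rV_cons n (p : measurableTypeR R * 'rV[R]_n) : 'rV[R]_n.+1 :=
  row_mx (const_mx p.1 : 'rV_1) p.2.

Lemma rV_cons0 n p : @rV_cons n p ord0 ord0 = p.1.
Proof.
have -> : rV_cons p ord0 ord0 = rV_cons p ord0 (lshift n (ord0 : 'I_1)).
  by congr (rV_cons _ _ _); exact/val_inj.
by rewrite [LHS]row_mxEl mxE.
Qed.

Lemma rV_consS n p (i : 'I_n) : @rV_cons n p ord0 (lift ord0 i) = p.2 ord0 i.
Proof.
have -> : rV_cons p ord0 (lift ord0 i) = rV_cons p ord0 (rshift 1 i).
  by congr (rV_cons _ _ _); exact/val_inj.
exact: row_mxEr.
Qed.

Lemma measurable_rV_cons n : measurable_fun setT (@rV_cons n).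
Proof.
apply: measurable_fun_rVP => i.
case: (unliftP ord0 i) => [j ->|->].
  under eq_fun do rewrite rV_consS.
  exact: (measurableT_comp (measurable_coord j) measurable_snd).
  by rewrite (_ : (fun _ => _) = (@fst _ _))//; apply/funext => p; rewrite rV_cons0.
Qed.

Definition rV_uncons n (x : 'rV[R]_n.+1) : measurableTypeR R * 'rV[R]_n :=
  (x ord0 ord0, \row_i x ord0 (lift ord0 i)).

Lemma rV_consK n : cancel (@rV_cons n) (@rV_uncons n).
Proof.
move=> [t x]; congr pair; first exact: rV_cons0.
by apply/rowP => i; rewrite mxE rV_consS.
Qed.

Lemma rV_unconsK n : cancel (@rV_uncons n) (@rV_cons n).
Proof.
move=> x; apply/rowP => i.
case: (unliftP ord0 i) => [j ->|->]; first by rewrite rV_consS mxE.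
by rewrite rV_cons0.
Qed.

Lemma measurable_rV_uncons n : measurable_fun setT (@rV_uncons n).
Proof.
apply/measurable_fun_pair; first exact: measurable_coord.
apply: measurable_fun_rVP => i.
by under eq_fun do rewrite mxE; exact: measurable_coord.
Qed.

(* rV_cons_measure m A is the integral over t, for the Lebesgue measure of R,
   of the m-measures of the slices [set x | A (rV_cons (t, x))]. *)
Definition rV_cons_measure n (m : set 'rV[R]_n -> \bar R) :
    set 'rV[R]_n.+1 -> \bar R :=
  pushforward (product_measure1 (@lebesgue_measure R) m) (@rV_cons n).

Section rV_cons_measure.
Context (n : nat) (m : {sigma_finite_measure set 'rV[R]_n -> \bar R}).

Let pf : {measure set 'rV[R]_n.+1 -> \bar R} :=
  measure_function_pushforward__canonical__measure_function_Measure
   (product_measure1 (@lebesgue_measure R) m) (@measurable_rV_cons n).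

HB.instance Definition _ := isMeasure.Build _ _ _ (rV_cons_measure m)
  (measure0 pf) (@measure_ge0 _ _ _ pf) (@measure_semi_sigma_additive _ _ _ pf).

Let sigma_finite_rV_cons : sigma_finite setT (rV_cons_measure m).
Proof.
have /sigma_finiteP[F [TF ndF Foo]] := sigma_finiteT (@lebesgue_measure R).
have /sigma_finiteP[G [TG ndG Goo]] := sigma_finiteT m.
exists (fun k => @rV_uncons n @^-1` (F k `*` G k)).
  rewrite -preimage_bigcup (_ : \bigcup_k _ = setT) ?preimage_setT//.
  rewrite -setXTT TF TG predeqE => -[x y]; split.
    by move=> [k _ []/= ? ?]; split; exists k.
  move=> [/= [k _ Fkx] [l _ Gly]]; exists (maxn k l) => //; split.
  - by move: x Fkx; exact/subsetPset/ndF/leq_maxl.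
  - by move: y Gly; exact/subsetPset/ndG/leq_maxr.
move=> k; have [mF Fk] := Foo k; have [mG Gk] := Goo k; split.
  rewrite -[X in measurable X]setTI.
  by apply: measurable_rV_uncons => //; exact: measurableX.
rewrite /rV_cons_measure /pushforward -comp_preimage.
rewrite (_ : _ \o _ = id); last by apply/funext => x /=; rewrite rV_consK.
by rewrite [X in (X < _)%E]product_measure1E// lte_mul_pinfty// ge0_fin_numE.
Qed.

HB.instance Definition _ := Measure_isSigmaFinite.Build _ _ _
  (rV_cons_measure m) sigma_finite_rV_cons.

End rV_cons_measure.

Fixpoint lebesgue_rV n : set 'rV[R]_n -> \bar R :=
  match n with
  | 0 => dirac (0 : 'rV[R]_0)
  | k.+1 => rV_cons_measure (@lebesgue_rV k)
  end.

Lemma lebesgue_rV_measure n :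
  exists mu : {sigma_finite_measure set 'rV[R]_n -> \bar R},
    lebesgue_rV (n := n) = mu.
Proof.
elim: n => [|n [mu muE]]; first by exists (dirac (0 : 'rV[R]_0)).
by exists (rV_cons_measure mu); rewrite /= muE.
Qed.

Context (n : nat).
Let mu := @lebesgue_rV n.

Let mu0 : mu set0 = 0%E.
Proof.
by rewrite /mu; have [nu ->] := lebesgue_rV_measure n; exact: measure0.
Qed.

Let mu_ge0 A : (0 <= mu A)%E.
Proof.
by rewrite /mu; have [nu ->] := lebesgue_rV_measure n; exact: measure_ge0.
Qed.

Let mu_sigma_additive : semi_sigma_additive mu.
Proof.
rewrite /mu; have [nu ->] := lebesgue_rV_measure n.
exact: measure_semi_sigma_additive.
Qed.

HB.instance Definition _ := isMeasure.Build _ _ _ (@lebesgue_rV n)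
  mu0 mu_ge0 mu_sigma_additive.

Let mu_sigma_finite : sigma_finite setT mu.
Proof.
by rewrite /mu; have [nu ->] := lebesgue_rV_measure n; exact: sigma_finiteT.
Qed.

HB.instance Definition _ := Measure_isSigmaFinite.Build _ _ _ (@lebesgue_rV n)
  mu_sigma_finite.

End lebesgue_rV.

Section euclidean.
Context (R : realType) (n : nat).
Implicit Types (x y xi theta : 'rV[R]_n) (A B D K L : set 'rV[R]_n).

Definition dot x y : R := (x *m y^T) ord0 ord0.

Definition enorm x : R := Num.sqrt (dot x x).

Definition sphere : set 'rV[R]_n := [set x | enorm x = 1].

Definition unit_ball : set 'rV[R]_n := [set x | enorm x <= 1].

Definition minkowski_sum A B : set 'rV[R]_n := [set x + y | x in A & y in B].

Definition dilate (t : R) A : set 'rV[R]_n := [set t *: x | x in A].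

(* The topology of 'rV[R]_n comes from the max norm; it is the Euclidean one. *)
Definition convex_body K :=
  [/\ compact K, convex_set (K : set (convex_lmodType 'rV[R]_n)) &
      interior K !=set0].

Definition origin_symmetric K := K = [set - x | x in K].

Definition volume A : R := fine (lebesgue_rV A).

(* lim is total: for a convex body the limit exists (Minkowski content). *)
Definition surface_area D : R :=
  lim ((volume (minkowski_sum D (dilate e unit_ball)) - volume D) / e
       @[e --> 0^'+]).

(* The supremum is attained when K is compact and nonempty. *)
Definition support_function K x : R := sup [set dot x y | y in K].

Definition isotropic_position K :=
  volume K = 1 /\
  exists2 LK : R, 0 < LK & forall xi, sphere xi ->
    (\int[@lebesgue_rV R n]_(x in K) ((dot x xi ^+ 2)%:E) = (LK ^+ 2)%:E)%E.

Definition isotropic_up_to_dilation D :=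
  exists2 t : R, 0 < t & isotropic_position (dilate t D).

End euclidean.

Section hyperplane.
Context (R : realType) (n : nat).
Implicit Types (x xi theta : 'rV[R]_n) (A D K L : set 'rV[R]_n).

Definition hyperplane xi : set 'rV[R]_n := [set x | dot x xi = 0].

Definition proj_hyperplane xi D : set 'rV[R]_n :=
  [set x - dot x xi *: xi | x in D].

(* The rows of U form an orthonormal basis of the hyperplane. *)
Definition is_frame xi (U : 'M[R]_(n.-1, n)) :=
  U *m U^T = 1%:M /\ U *m xi^T = 0.

(* A frame exists for every unit xi, see frameP below; the volume of a set does
   not depend on the chosen one, two frames differing by an orthogonal map. *)
Definition frame xi : 'M[R]_(n.-1, n) := xget 0 [set U | is_frame xi U].

(* (n-1)-dimensional volume, for A included in hyperplane xi: the isometry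
   y |-> y *m frame xi identifies R^(n-1) with hyperplane xi. *)
Definition hvolume xi A : R :=
  volume [set y : 'rV[R]_n.-1 | A (y *m frame xi)].

Definition hunit_ball xi : set 'rV[R]_n := hyperplane xi `&` @unit_ball R n.

Definition hsurface_area xi A : R :=
  lim ((hvolume xi (minkowski_sum A (dilate e (hunit_ball xi)))
        - hvolume xi A) / e @[e --> 0^'+]).

Definition projection_body_of K L :=
  [/\ convex_body L, origin_symmetric L &
      forall theta, sphere theta ->
        support_function L theta = hvolume theta (proj_hyperplane theta K)].

(* K need not be origin-symmetric here; symmetric K give the same class of
   bodies, by Minkowski's existence theorem. *)
Definition is_projection_body L :=
  exists2 K, convex_body K & projection_body_of K L.

End hyperplane.

Lemma frameP (R : realType) n (xi : 'rV[R]_n.+1) :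
  sphere xi -> is_frame xi (frame xi).
Proof.
move=> xi1; apply: (@xgetPex _ 0).
have xixi : xi *m xi^T = 1%:M.
  apply/matrixP => i j; rewrite !ord1 [RHS]mxE eqxx mulr1n -/(dot xi xi).
  have := congr1 (fun t => t ^+ 2) xi1; rewrite /enorm expr1n sqr_sqrtr//.
  by rewrite /dot mxE; apply: sumr_ge0 => k _; rewrite mxE -expr2 sqr_ge0.
suff [H [HH H0]] : exists H : 'M[R]_n.+1, H *m H^T = 1%:M /\ row ord0 H = xi.
  exists (row' ord0 H); split.
    apply/matrixP => i j; transitivity ((H *m H^T) (lift ord0 i) (lift ord0 j)).
      by rewrite !mxE; apply: eq_bigr => k _; rewrite !mxE.
    by rewrite HH !mxE (inj_eq lift_inj).
  apply/matrixP => i j; transitivity ((H *m H^T) (lift ord0 i) ord0).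
    by rewrite !mxE; apply: eq_bigr => k _; rewrite -H0 !mxE.
  by rewrite HH !mxE [lift ord0 i == _]eq_sym (negbTE (neq_lift _ _)).
pose e : 'rV[R]_n.+1 := delta_mx ord0 ord0.
have [xie|xie] := eqVneq xi e.
  by exists 1%:M; split; rewrite ?trmx1 ?mulmx1// rowE mulmx1.
have [v vE] : exists v, v = xi - e by exists (xi - e).
have ee : e *m e^T = 1%:M.
  by rewrite trmx_delta mul_delta_mx; apply/matrixP => i j; rewrite !ord1 !mxE.
pose a : R := dot xi e.
have xe : xi *m e^T = a%:M by rewrite [LHS]mx11_scalar.
have ex : e *m xi^T = a%:M by rewrite -[LHS]trmxK trmx_mul trmxK xe tr_scalar_mx.
have vv : v *m v^T = (2 - 2 * a)%:M.
  rewrite vE linearB/= mulmxBl !mulmxBr xixi ee xe ex.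
  by apply/matrixP => i j; rewrite !ord1 !mxE !mulr1n; ring.
have a1 : 2 - 2 * a != 0.
  apply: contra xie => /eqP a0; rewrite -subr_eq0 -vE.
  have : dot v v = 0 by rewrite /dot vv a0 mxE mul0rn.
  rewrite /dot mxE => /eqP; rewrite psumr_eq0; last first.
    by move=> k _; rewrite [v^T _ _]mxE -expr2 sqr_ge0.
  move=> /allP v0; apply/eqP/rowP => k; rewrite [RHS]mxE.
  have := v0 k (mem_index_enum k).
  by rewrite [v^T _ _]mxE mulf_eq0 orbb => /eqP.
pose c := 2 / (2 - 2 * a).
pose H : 'M[R]_n.+1 := 1%:M - c *: (v^T *m v).
have HT : H^T = H by rewrite /H linearB/= trmx1 linearZ/= trmx_mul trmxK.
exists H; split.
  rewrite HT /H mulmxBl mul1mx mulmxBr mulmx1 -scalemxAl -scalemxAr.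
  rewrite mulmxA -(mulmxA v^T) vv mul_mx_scalar -scalemxAl !scalerA.
  rewrite (_ : c * (c * (2 - 2 * a)) = c + c) ?scalerDl; last first.
    by rewrite /c; field.
  by rewrite -[X in _ - X = _]opprB addrK opprK subrK.
rewrite rowE mulmxBr mulmx1 -scalemxAr mulmxA.
rewrite (_ : delta_mx 0 ord0 = e)//.
rewrite (_ : e *m v^T = (a - 1)%:M); last first.
  rewrite vE linearB/= mulmxBr ex ee.
  by apply/matrixP => i j; rewrite !ord1 !mxE !mulr1n.
rewrite mul_scalar_mx scalerA (_ : c * (a - 1) = -1); last by rewrite /c; field.
by rewrite scaleN1r opprK vE addrC subrK.
Qed.

(* Main.v *)
(* The body D is a limit of zonotopes Z, the sums of the segments
   [-a_j v_j, a_j v_j] with |v_j| = 1, and adding [-a v, a v] to a convex body C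
   increases its volume by exactly 2 a |C|v^perp|. Put l = sum_j a_j.

   Adding (1/n) Z to (1 - 1/n) Z + e B and to (1 - 1/n) Z segment by segment
   gives S(D) <= (4 l / n) max S(D|xi^perp). It remains to see that l <= C n when
   |D| = 1 and D is isotropic with constant L. Adding (1/2n) Z to (1 - 1/2n) Z
   bounds sum_j a_j |Z|v_j^perp| by a multiple of n |Z|; by Chebyshev's inequality
   on a slab, |D|xi^perp| >= 3 / (16 L), hence l <= C n L. To bound L, put
   A = sum_j a_j v_j^T v_j. On Z one has <x, A^-1 x> <= l, which integrates to
   L^2 tr(A^-1) <= 4 l; since |Z| >= 2^n det A, also det A <= 1 and
   tr(A^-1) >= n. So n L^2 <= 4 l <= C n L. The logarithm is not needed: only
   log n >= log 2 is used.

   That D is a limit of zonotopes: |K|theta^perp| is, up to a small error,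
   half the integral of |<grad g, theta>| for a C^{1,1} function g of the distance
   to K, equal to 1 on K and to 0 outside of a neighbourhood of K. In the same way
   the ball B, homothetic to its own projection body, is a limit of zonotopes, so
   the difference quotients of t |-> |A + t B| are monotone in t and in A; this
   replaces the Brunn-Minkowski inequality. *)

Require Import Defs.
From mathcomp Require Import all_boot all_order all_algebra.
From mathcomp Require Import all_classical all_reals all_analysis.
From mathcomp Require Import measurable_realfun ring lra.
Import Order.TTheory GRing.Theory Num.Theory.
Import numFieldNormedType.Exports.

Local Open Scope classical_set_scope.
Local Open Scope ring_scope.
Set Implicit Arguments.
Unset Strict Implicit.
Unset Printing Implicit Defensive.

(** * Euclidean structure *)

(** The segment identity needs a zonotope, and [D] is only sandwiched: $(1-\eta)D\subseteq
    Z\subseteq(1+\eta)D$. So $|Z|$ and $|D|$ agree up to a factor $1+O(\eta)$, an error that would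
    swamp an increment $|Z+eB|-|Z|$ of order $e$. The increments themselves, however, are monotone
    in the body, and their quotients by the radius are monotone in the radius, so they can be
    compared directly. The ball gets radius $\eta$, the precision of the approximation: after
    division by $\eta$ all errors are factors such as $(1\pm\eta)^k$ or $(1+\eta/r)^k$, where
    $rB\subseteq D$, and a single limit of polynomials removes them.

    The factor 4: with $u=1-1/n$, passing from $uZ$ to $Z$ uses segments of total weight $l/n$, each
    raising the increment by at most $2\eta$ times its weight times a projected surface area, while
    the increment at $uZ$ is about $u^{n-1}\le1/2$ of that at $Z$. So $S(D)/2\le(2l/n)\max
    S(D|\xi^\perp)$.

    The bound on $l$: $l\le(128/3)nL$ and $nL^2\le4l$ force $L\le512/3$, hence $l\le(256/3)^2n$. *)

Section dot.
Context (R : realType) (n : nat).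
Implicit Types x y z : 'rV[R]_n.

Lemma dotE x y : dot x y = \sum_i x ord0 i * y ord0 i.
Proof. by rewrite /dot mxE; apply: eq_bigr => i _; rewrite mxE. Qed.

Lemma dotC x y : dot x y = dot y x.
Proof. by rewrite !dotE; apply: eq_bigr => i _; rewrite mulrC. Qed.

Lemma dotDl x y z : dot (x + y) z = dot x z + dot y z.
Proof. by rewrite /dot mulmxDl mxE. Qed.

Lemma dotDr x y z : dot x (y + z) = dot x y + dot x z.
Proof. by rewrite dotC dotDl ![dot _ x]dotC. Qed.

Lemma dotZl a x y : dot (a *: x) y = a * dot x y.
Proof. by rewrite /dot -scalemxAl mxE. Qed.

Lemma dotZr a x y : dot x (a *: y) = a * dot x y.
Proof. by rewrite dotC dotZl dotC. Qed.

Lemma dotNl x y : dot (- x) y = - dot x y.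
Proof. by rewrite -scaleN1r dotZl mulN1r. Qed.

Lemma dotNr x y : dot x (- y) = - dot x y.
Proof. by rewrite dotC dotNl dotC. Qed.

Lemma dotBl x y z : dot (x - y) z = dot x z - dot y z.
Proof. by rewrite dotDl dotNl. Qed.

Lemma dotBr x y z : dot x (y - z) = dot x y - dot x z.
Proof. by rewrite dotDr dotNr. Qed.

Lemma dot0l x : dot 0 x = 0. Proof. by rewrite /dot mul0mx mxE. Qed.

Lemma dot0r x : dot x 0 = 0. Proof. by rewrite dotC dot0l. Qed.

Lemma dot_suml (I : Type) (r : seq I) (P : pred I) (F : I -> 'rV[R]_n) y :
  dot (\sum_(i <- r | P i) F i) y = \sum_(i <- r | P i) dot (F i) y.
Proof. by elim/big_rec2 : _ => [|i a b _ <-]; rewrite ?dot0l ?dotDl. Qed.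

Lemma dot_ge0 x : 0 <= dot x x.
Proof. by rewrite dotE; apply: sumr_ge0 => i _; rewrite -expr2 sqr_ge0. Qed.

Lemma dot_eq0 x : dot x x = 0 -> x = 0.
Proof.
rewrite dotE => /eqP; rewrite psumr_eq0 => [/allP x0|i _]; last first.
  by rewrite -expr2 sqr_ge0.
apply/rowP => i; rewrite mxE; apply/eqP.
by have := x0 i (mem_index_enum i); rewrite mulf_eq0 orbb.
Qed.

Lemma enorm_ge0 x : 0 <= enorm x. Proof. exact: sqrtr_ge0. Qed.

Lemma sqr_enorm x : enorm x ^+ 2 = dot x x.
Proof. by rewrite sqr_sqrtr// dot_ge0. Qed.

Lemma enorm0 : enorm (0 : 'rV[R]_n) = 0.
Proof. by rewrite /enorm dot0l sqrtr0. Qed.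

Lemma enorm_eq0 x : enorm x = 0 -> x = 0.
Proof. by move=> x0; apply: dot_eq0; rewrite -sqr_enorm x0 expr0n. Qed.

Lemma enorm_gt0 x : x != 0 -> 0 < enorm x.
Proof.
move=> x0; rewrite lt_neqAle enorm_ge0 andbT eq_sym.
by apply: contra_neq x0 => /enorm_eq0.
Qed.

Lemma enormZ a x : enorm (a *: x) = `|a| * enorm x.
Proof.
by rewrite /enorm dotZl dotZr mulrA -expr2 sqrtrM ?sqr_ge0// sqrtr_sqr.
Qed.

Lemma enormN x : enorm (- x) = enorm x.
Proof. by rewrite -scaleN1r enormZ normrN1 mul1r. Qed.

Lemma dot_sphere x : sphere x -> dot x x = 1.
Proof. by rewrite -sqr_enorm => ->; rewrite expr1n. Qed.

Lemma sphere_normalize x : x != 0 -> sphere ((enorm x)^-1 *: x).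
Proof.
move=> x0; rewrite /sphere/= enormZ ger0_norm ?invr_ge0 ?enorm_ge0//.
by rewrite mulVf// gt_eqF// enorm_gt0.
Qed.

(** Cauchy-Schwarz: the square of [enorm y *: x - enorm x *: y] expands to
    [2 * a * b * (a * b - c)], and [a * b] is positive. *)
Lemma dot_le_enorm x y : dot x y <= enorm x * enorm y.
Proof.
have [->|x0] := eqVneq x 0; first by rewrite dot0l enorm0 mul0r.
have [->|y0] := eqVneq y 0; first by rewrite dot0r enorm0 mulr0.
have := dot_ge0 (enorm y *: x - enorm x *: y).
rewrite dotBl !dotBr !dotZl !dotZr (dotC y x) -!sqr_enorm.
have := enorm_gt0 x0; have := enorm_gt0 y0.
set a := enorm x; set b := enorm y; set c := dot x y => b0 a0 H.
have ab0 : 0 < a * b by rewrite mulr_gt0.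
by rewrite -(ler_pM2l ab0); nra.
Qed.

Lemma normr_dot_le x y : `|dot x y| <= enorm x * enorm y.
Proof.
by rewrite ler_norml dot_le_enorm andbT lerNl -dotNl -[enorm x]enormN dot_le_enorm.
Qed.

Lemma enormD x y : enorm (x + y) <= enorm x + enorm y.
Proof.
rewrite -[leRHS]ger0_norm ?addr_ge0 ?enorm_ge0// -[leRHS]sqrtr_sqr.
apply: ler_wsqrtr; rewrite dotDl !dotDr (dotC y x) sqrrD !sqr_enorm.
by have := dot_le_enorm x y; lra.
Qed.

Lemma norm_coord x i : `|x ord0 i| <= `|x|.
Proof.
rewrite [leRHS]mx_normrE.
by apply/bigmax_geP; right => /=; exists (ord0, i).
Qed.

Lemma norm_le_enorm x : `|x| <= enorm x.
Proof.
rewrite [leLHS]mx_normrE; apply/bigmax_leP; split; first exact: enorm_ge0.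
move=> [i j] _ /=; rewrite ord1 -sqrtr_sqr; apply: ler_wsqrtr.
rewrite dotE (bigD1 j)//= -expr2 lerDl; apply: sumr_ge0 => k _.
by rewrite -expr2 sqr_ge0.
Qed.

Lemma enorm_le_norm x : enorm x <= n%:R * `|x|.
Proof.
rewrite -[leRHS]ger0_norm ?mulr_ge0 ?ler0n// -[leRHS]sqrtr_sqr.
apply: ler_wsqrtr; rewrite dotE exprMn.
apply: (@le_trans _ _ (\sum_(i < n) `|x| ^+ 2)).
  apply: ler_sum => i _; rewrite -expr2 -[leLHS]ger0_norm ?sqr_ge0// normrX.
  by rewrite lerXn2r// ?nnegrE ?normr_ge0// norm_coord.
rewrite sumr_const card_ord -[leLHS]mulr_natl ler_wpM2r ?sqr_ge0//.
by rewrite -natrX ler_nat; case: (n) => // k; rewrite expnS expn1 leq_pmulr.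
Qed.

Lemma dot_continuous y : continuous (fun x => dot x y).
Proof.
under eq_fun do rewrite dotE.
apply: (@continuous_big R^o) => [|i _]; first exact: add_continuous.
by move=> x; apply: (@cvgMl _ _ (nbhs x)); exact: coord_continuous.
Qed.

Lemma enorm_continuous : continuous (@enorm R n).
Proof.
move=> x; apply/(@cvgrPdist_le _ _ _ (nbhs x)) => e e0.
have e0' : 0 < e / n.+1%:R by rewrite divr_gt0.
near=> y.
have xy : enorm (x - y) <= e.
  apply: (le_trans (enorm_le_norm _)).
  apply: (@le_trans _ _ (n.+1%:R * (e / n.+1%:R))); last first.
    by rewrite mulrC divfK.
  by rewrite ler_pM ?ler0n// ?ler_nat//; near: y; apply: cvgr_dist_le.
rewrite ler_norml; apply/andP; split.
  have := enormD x (y - x); rewrite addrC subrK => h.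
  by rewrite -(opprB x y) enormN in h; lra.
by have := enormD y (x - y); rewrite addrC subrK => h; lra.
Unshelve. all: by end_near. Qed.

End dot.

Section topology.
Context (R : realType).

Lemma continuous_mxP (T : topologicalType) m n (f : T -> 'M[R]_(m, n)) :
  (forall i j, continuous (fun t => f t i j)) -> continuous f.
Proof.
move=> cf t B [P Pt PB].
have : \forall s \near t, forall i, forall j, P i j (f s i j).
  apply: filter_forall => i; apply: filter_forall => j.
  exact: (cf i j t _ (Pt i j)).
by apply: filterS => s Ps; apply: PB.
Qed.

Lemma mulmx_continuous m n (M : 'M[R]_(m, n)) :
  continuous (fun x : 'rV[R]_m => x *m M).
Proof.
apply: continuous_mxP => i j; under eq_fun do rewrite mxE.
apply: (@continuous_big R^o) => [|k _]; first exact: add_continuous.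
by move=> x; apply: (@cvgMl _ _ (nbhs x)); exact: coord_continuous.
Qed.

Lemma enorm_mulmx m n (M : 'M[R]_(m, n)) (x : 'rV[R]_m) :
  M *m M^T = 1%:M -> enorm (x *m M) = enorm x.
Proof.
by move=> MM; rewrite /enorm /dot trmx_mul mulmxA -(mulmxA x) MM mulmx1.
Qed.

Lemma dot_mulmxl m n (M : 'M[R]_(m, n)) (x : 'rV[R]_m) (y : 'rV[R]_n) :
  dot (x *m M) y = dot x (y *m M^T).
Proof. by rewrite /dot trmx_mul trmxK mulmxA. Qed.

Lemma rV_hausdorff n : hausdorff_space 'rV[R]_n.
Proof. exact: norm_hausdorff. Qed.

Lemma compact_closed_rV n (A : set 'rV[R]_n) : compact A -> closed A.
Proof. by apply: compact_closed; exact: rV_hausdorff. Qed.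

Lemma compact_image (U V : topologicalType) (f : U -> V) (A : set U) :
  continuous f -> compact A -> compact (f @` A).
Proof. by move=> cf; apply: continuous_compact; exact: continuous_subspaceT. Qed.

Lemma closed_preimage (U V : topologicalType) (f : U -> V) (A : set V) :
  continuous f -> closed A -> closed (f @^-1` A).
Proof. by move=> cf cA; apply: preimage_closed. Qed.

Lemma enorm_bounded_compact n (A : set 'rV[R]_n) (r : R) :
  closed A -> A `<=` [set x | enorm x <= r] -> compact A.
Proof.
move=> cA Ar; apply: bounded_closed_compact => //.
exists r; split; first exact: num_real.
move=> s rs x Ax /=; apply: (le_trans (norm_le_enorm _)).
by apply: le_trans (ltW rs); exact: Ar.
Qed.

Lemma compact_enorm_bounded n (A : set 'rV[R]_n) :
  compact A -> exists2 r : R, 0 < r & A `<=` [set x | enorm x <= r].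
Proof.
move=> /compact_bounded [M [_ H]].
exists (n%:R * (`|M| + 1) + 1); first by rewrite ltr_wpDl// mulr_ge0// addr_ge0.
move=> x Ax; apply: (le_trans (enorm_le_norm _)).
rewrite -[leLHS]addr0 lerD// ler_wpM2l//.
by apply: H => //; apply: (le_lt_trans (ler_norm M)); rewrite ltrDl.
Qed.

End topology.

(** * Lebesgue measure on row vectors *)

Section measurability.
Context (R : realType).

Lemma measurable_cube n (c : 'rV[R]_n) (r : R) :
  measurable [set x : 'rV[R]_n | forall i, `|x ord0 i - c ord0 i| < r].
Proof.
rewrite (_ : mkset _ = \bigcap_(i in [set: 'I_n])
  ((fun x : 'rV[R]_n => x ord0 i : measurableTypeR R) @^-1`
     `](c ord0 i - r), (c ord0 i + r)[%classic)); last first.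
  apply/seteqP; split => x /= H i.
    by move=> _; have := H i; rewrite /= in_itv/= ltr_distl.
  by have := H i I; rewrite /= in_itv/= ltr_distl.
apply: fin_bigcap_measurable => // i _.
rewrite -[X in measurable X]setTI; exact: measurable_coord.
Qed.

(** The sigma-algebra is generated by the coordinates, so openness must become countably many
    conditions on them: [U] is the union of the cubes with rational centre and half-side $1/(k+1)$
    that lie in [U]. *)
Lemma open_measurable_rV n (U : set 'rV[R]_n) : open U -> measurable U.
Proof.
move=> oU.
pose box (p : 'rV[rat]_n * nat) := [set x : 'rV[R]_n |
  forall i, `|x ord0 i - (map_mx ratr p.1 : 'rV[R]_n) ord0 i| < p.2.+1%:R^-1].
pose F p := [set x | box p `<=` U /\ box p x].
have mF p : measurable (F p).
  have [bU|bU] := pselect (box p `<=` U).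
    rewrite (_ : F p = box p); first exact: measurable_cube.
    by apply/seteqP; split => x; [case|].
  rewrite (_ : F p = set0)//.
  by apply/seteqP; split => x // [].
rewrite (_ : U = \bigcup_p F p).
  apply: countable_bigcupT_measurable; first exact: countableP.
  exact: mF.
apply/seteqP; split => x; last first.
  by move=> [p _] [+ Bx]; exact.
move=> Ux; have /nbhs_ballP[e /= e0 xeU] := oU _ Ux.
(* Two points of a cube of half-side $1/(k+1)$ are less than $2/(k+1)$ apart in the max norm, so a
   cube that contains [x] stays in its ball of radius [e]. *)
have [k ke] : exists k, (2 : R) / k.+1%:R < e.
  have [k] := ltr_add_invr (divr_gt0 e0 (ltr0Sn R 1)).
  by rewrite add0r ltr_pdivlMr// mulrC => ke; exists k.
have [a aE] : exists a : R, a = k.+1%:R^-1 by eexists.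
have a0 : 0 < a by rewrite aE invr_gt0.
have /choice[q Hq] : forall i, exists q : rat, `|x ord0 i - ratr q| < a.
  move=> i; have : x ord0 i - a < x ord0 i + a by lra.
  move=> /rat_in_itvoo[q]; rewrite in_itv/= => /andP[h1 h2].
  by exists q; rewrite ltr_norml; apply/andP; split; lra.
have bU : box (\row_i q i, k) `<=` U.
  move=> y /= By; apply: xeU; rewrite mx_norm_ball /ball_/=.
  rewrite [ltLHS]mx_normrE; apply/bigmax_ltP; split => // -[j0 i] _ /=.
  rewrite ord1 !mxE; have := By i; have := Hq i; rewrite !mxE -aE => h1 h2.
  have := ler_normD (x ord0 i - ratr (q i)) (ratr (q i) - y ord0 i).
  rewrite subrKA (distrC (ratr _)) => h3.
  by move: ke; rewrite -aE; lra.
exists (\row_i q i, k) => //; split => // i.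
by rewrite !mxE -aE; exact: Hq.
Qed.

Lemma closed_measurable_rV n (A : set 'rV[R]_n) : closed A -> measurable A.
Proof.
by move=> cA; rewrite -[A]setCK; apply: measurableC; apply: open_measurable_rV;
   rewrite openC.
Qed.

Lemma compact_measurable_rV n (A : set 'rV[R]_n) : compact A -> measurable A.
Proof. by move=> /compact_closed_rV/closed_measurable_rV. Qed.

Lemma continuous_measurable_rV n (f : 'rV[R]_n -> R) :
  continuous f -> measurable_fun [set: 'rV[R]_n] (f : _ -> measurableTypeR R).
Proof.
move=> cf; apply: (measurability _ (RGenOInfty.measurableE R)) => _ [_ [a ->] <-].
rewrite setTI; apply: open_measurable_rV; apply: open_comp => [x _|]; first exact: cf.
exact: interval_open.
Qed.

Lemma continuous_measurable_rV_rV m n (f : 'rV[R]_m -> 'rV[R]_n) :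
  continuous f -> measurable_fun [set: 'rV[R]_m] f.
Proof.
move=> cf; apply: measurable_fun_rVP => i; apply: continuous_measurable_rV.
by move=> x; apply: (@continuous_comp _ _ _ f (fun y : 'rV[R]_n => y ord0 i));
  [exact: cf|exact: coord_continuous].
Qed.

Lemma addr_continuous n (a : 'rV[R]_n) : continuous (fun x : 'rV[R]_n => x + a).
Proof.
apply: continuous_mxP => i j; under eq_fun do rewrite mxE.
move=> x; apply: (@cvgD R R^o _ (nbhs x)); last exact: cvg_cst.
exact: coord_continuous.
Qed.

End measurability.

(** * Translation invariance of volume *)

Section translation.
Context (R : realType).

(** The push-forward by a translation agrees with Lebesgue measure on half-open intervals, which
    determine it. *)
Lemma lebesgue_measure_translate (c : R) (A : set (measurableTypeR R)) :
  measurable A ->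
  lebesgue_measure ((fun x : R => x + c) @^-1` A) = lebesgue_measure A.
Proof.
move=> mA.
have mf : measurable_fun [set: measurableTypeR R]
    ((fun x : R => x + c) : measurableTypeR R -> measurableTypeR R).
  by apply: measurable_funD => //; exact: measurable_id.
pose nu : {measure set (measurableTypeR R) -> \bar R} :=
  measure_function_pushforward__canonical__measure_function_Measure
    (@lebesgue_measure R) mf.
rewrite -[LHS]/(nu A); apply/esym/(lebesgue_measure_unique (mu := nu)) => //.
move=> _ [[a b] _ <-]; rewrite -[RHS]/(lebesgue_measure ((fun x : R => x + c) @^-1` `]a, b]%classic)).
have -> : (fun x : R => x + c) @^-1` `]a, b]%classic = `](a - c), (b - c)]%classic.
  by apply/seteqP; split => x /=; rewrite !in_itv/= => /andP[h1 h2]; apply/andP; split; lra.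
rewrite /= !lebesgue_measure_itv/= !lte_fin ltrD2r.
by case: ifP => // _; rewrite -!EFinB; congr EFin; ring.
Qed.

(** Induction on the dimension: the translation acts separately on the two factors of the product
    measure, which is determined by its values on rectangles. *)
Lemma lebesgue_rV_translate n (a : 'rV[R]_n) (A : set 'rV[R]_n) :
  measurable A -> lebesgue_rV ((fun x : 'rV[R]_n => x + a) @^-1` A) = lebesgue_rV A.
Proof.
elim: n a A => [|n IH] a A mA.
  by congr lebesgue_rV; apply/seteqP; split => x /=; rewrite (_ : x + a = x)//;
    apply/rowP => -[].
have mf : measurable_fun setT (fun p : measurableTypeR R * 'rV[R]_n =>
   (p.1 + a ord0 ord0, p.2 + (rV_uncons a).2) : measurableTypeR R * 'rV[R]_n).
  apply/measurable_fun_pair.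
    by apply: measurable_funD => //; exact: measurable_fst.
  apply: (@measurableT_comp _ _ _ _ _ _ (fun x : 'rV[R]_n => x + (rV_uncons a).2)) => //.
  by apply: continuous_measurable_rV_rV; exact: addr_continuous.
pose nu : {measure set (measurableTypeR R * 'rV[R]_n) -> \bar R} :=
  measure_function_pushforward__canonical__measure_function_Measure
    (product_measure1 (@lebesgue_measure R) (@lebesgue_rV R n)) mf.
rewrite /= /rV_cons_measure/= /pushforward.
have mA' : measurable (@rV_cons R n @^-1` A).
  by rewrite -[X in measurable X]setTI; exact: measurable_rV_cons.
transitivity (nu (@rV_cons R n @^-1` A)).
  congr (product_measure1 _ _ _); apply/seteqP.
  suff E p : rV_cons p + a = rV_cons (p.1 + a ord0 ord0, p.2 + (rV_uncons a).2).
    by split => p /=; rewrite E.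
  apply/rowP => i; rewrite mxE; case: (unliftP ord0 i) => [j ->|->].
    by rewrite !rV_consS !mxE.
  by rewrite !rV_cons0.
apply/esym/product_measure_unique => // X Y mX mY.
rewrite /nu/= /pushforward (_ : _ @^-1` _ = ((fun x : R => x + a ord0 ord0) @^-1` X) `*`
   ((fun x : 'rV[R]_n => x + (rV_uncons a).2) @^-1` Y)); last by apply/seteqP; split => -[].
rewrite product_measure1E.
- by congr (_ * _)%E; [exact: lebesgue_measure_translate|exact: IH].
- rewrite -[X in measurable X]setTI.
  have mg : measurable_fun [set: measurableTypeR R]
    ((fun x : R => x + a ord0 ord0) : measurableTypeR R -> measurableTypeR R).
    by apply: measurable_funD => //; exact: measurable_id.
  exact: mg.
- rewrite -[X in measurable X]setTI.
  by apply: (continuous_measurable_rV_rV (@addr_continuous R n _)).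
Qed.

Lemma lebesgue_rV_cube n (r : R) : 0 <= r ->
  lebesgue_rV [set x : 'rV[R]_n | forall i, `|x ord0 i| <= r] = ((2 * r) ^+ n)%:E.
Proof.
move=> r0; elim: n => [|n IH].
  by rewrite /= diracE mem_set// => -[].
rewrite /= /rV_cons_measure/= /pushforward.
rewrite (_ : _ @^-1` _ = `[(- r), r]%classic `*` [set x : 'rV[R]_n | forall i, `|x ord0 i| <= r]).
  rewrite [LHS]product_measure1E//=; last first.
    rewrite (_ : mkset _ = \bigcap_(i in [set: 'I_n])
      ((fun x : 'rV[R]_n => x ord0 i : measurableTypeR R) @^-1` `[(- r), r]%classic)).
      apply: fin_bigcap_measurable => // i _.
      by rewrite -[X in measurable X]setTI; apply: measurable_coord.
    apply/seteqP; split => x /= H i; first by move=> _ /=; rewrite in_itv/= -ler_norml.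
    by have := H i I; rewrite /= in_itv/= -ler_norml.
  rewrite lebesgue_measure_itv/= IH exprS EFinM lte_fin; congr (_ * _)%E.
  case: ifPn => h; first by rewrite opprK; congr EFin; ring.
  by rewrite -leNgt in h; congr EFin; lra.
apply/seteqP; split => -[t x] /=.
  move=> H; split; first by have := H ord0; rewrite rV_cons0/= in_itv/= -ler_norml.
  by move=> i; have := H (lift ord0 i); rewrite rV_consS.
move=> [h1 h2] i; case: (unliftP ord0 i) => [j ->|->].
  by rewrite rV_consS.
by rewrite rV_cons0/=; rewrite in_itv/= -ler_norml in h1.
Qed.

Lemma closed_cube n (r : R) : closed [set x : 'rV[R]_n | forall i, `|x ord0 i| <= r].
Proof.
rewrite (_ : mkset _ = \bigcap_(i in [set: 'I_n])
   ((fun x : 'rV[R]_n => `|x ord0 i|) @^-1` [set y | y <= r])).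
  apply: closed_bigI => i _; apply: closed_preimage; last exact: closed_le.
  move=> x; apply: (@continuous_comp _ _ _ (fun x : 'rV[R]_n => x ord0 i)).
    exact: coord_continuous.
  exact: norm_continuous.
apply/seteqP; split => x /= H i; first by move=> _ /=.
by have := H i I.
Qed.

End translation.

(** * Volume under linear maps *)

Section linear_change.
Context (R : realType).

Lemma mule_cancelr (x a b : \bar R) : x \is a fin_num -> (0 < x)%E ->
  (a * x = b * x)%E -> a = b.
Proof.
move=> xf x0 ab; apply/eqP; rewrite eq_le -(lee_pmul2r xf x0) ab lexx/=.
by rewrite -(lee_pmul2r xf x0) ab.
Qed.

(* Integrate 1_E(xM) 1_F(xM + y) over (x, y), in one order directly and in the
   other one after the translation x |-> x - y M^-1. *)
Lemma lebesgue_rV_mulmx_swap n (M : 'M[R]_n) (E F : set 'rV[R]_n) :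
  M \in unitmx -> measurable E -> measurable F ->
  (lebesgue_rV ((fun x : 'rV[R]_n => x *m M) @^-1` E) * lebesgue_rV F =
   lebesgue_rV (-%R @^-1` E) *
   lebesgue_rV ((fun x : 'rV[R]_n => x *m M) @^-1` F))%E.
Proof.
move=> uM mE mF.
have mM (A : set 'rV[R]_n) : measurable A ->
    measurable ((fun x : 'rV[R]_n => x *m M) @^-1` A).
  move=> mA; rewrite -[X in measurable X]setTI.
  by apply: (continuous_measurable_rV_rV (@mulmx_continuous R n n M)).
have mN (A : set 'rV[R]_n) : measurable A -> measurable (-%R @^-1` A).
  move=> mA; rewrite -[X in measurable X]setTI.
  rewrite (_ : -%R = (fun x : 'rV[R]_n => x *m (-1)%:M)); last first.
    by apply/funext => x; rewrite mul_mx_scalar scaleN1r.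
  by apply: (continuous_measurable_rV_rV (@mulmx_continuous R n n _)).
have m1 : measurable_fun setT (fun p : 'rV[R]_n * 'rV[R]_n => p.1 *m M).
  apply: (@measurableT_comp _ _ _ _ _ _ (fun x : 'rV[R]_n => x *m M)) => //.
  exact: (continuous_measurable_rV_rV (@mulmx_continuous R n n M)).
have m2 (b : R) : measurable_fun setT
    (fun p : 'rV[R]_n * 'rV[R]_n => p.1 *m M + b *: p.2).
  apply: measurable_fun_rVP => i; under eq_fun do rewrite mxE.
  apply: measurable_funD.
    exact: (measurableT_comp (measurable_coord i) m1).
  under eq_fun do rewrite mxE; apply: measurable_funM => //.
  exact: (measurableT_comp (measurable_coord i) measurable_snd).
pose S : set ('rV[R]_n * 'rV[R]_n) :=
  [set p | E (p.1 *m M) /\ F (p.1 *m M + 1 *: p.2)].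
pose S' : set ('rV[R]_n * 'rV[R]_n) :=
  [set p | E (p.1 *m M + (-1) *: p.2) /\ F (p.1 *m M)].
have mS : measurable S.
  apply: measurableI.
    by rewrite -[X in measurable X]setTI; apply: m1.
  by rewrite -[X in measurable X]setTI; apply: (m2 1).
have mS' : measurable S'.
  apply: measurableI.
    by rewrite -[X in measurable X]setTI; apply: (m2 (-1)).
  by rewrite -[X in measurable X]setTI; apply: m1.
have fub (T : set ('rV[R]_n * 'rV[R]_n)) : measurable T ->
    (\int[@lebesgue_rV R n]_x lebesgue_rV (xsection T x) =
     \int[@lebesgue_rV R n]_y lebesgue_rV (ysection T y))%E.
  move=> mT; have := indic_fubini_tonelli (@lebesgue_rV R n) (@lebesgue_rV R n) mT.
  by rewrite indic_fubini_tonelli_FE// indic_fubini_tonelli_GE.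
have LHSE : (\int[@lebesgue_rV R n]_x lebesgue_rV (xsection S x) =
    lebesgue_rV ((fun x : 'rV[R]_n => x *m M) @^-1` E) * lebesgue_rV F)%E.
  transitivity (\int[@lebesgue_rV R n]_x (lebesgue_rV F *
      (\1_((fun x : 'rV[R]_n => x *m M) @^-1` E) x)%:E))%E.
    apply: eq_integral => x _; rewrite indicE.
    have [xE|xE] := boolP (x \in _).
      rewrite mule1 -(lebesgue_rV_translate (x *m M) mF).
      congr lebesgue_rV; apply/seteqP; split => y.
        by rewrite /xsection/= inE => -[_] /=; rewrite scale1r addrC.
      rewrite /xsection/= inE => Fy; split => /=; last by rewrite scale1r addrC.
      by rewrite inE in xE.
    rewrite mule0 (_ : xsection _ _ = set0) ?measure0//.
    apply/seteqP; split => // y; rewrite /xsection/= inE => -[/= Ex _].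
    by move: xE; rewrite notin_setE/=.
  rewrite ge0_integralZl//; first by rewrite integral_indic ?setIT 1?muleC//; exact: mM.
  by apply/measurable_EFinP; apply: measurable_indic; exact: mM.
have RHSE : (\int[@lebesgue_rV R n]_x lebesgue_rV (xsection S' x) =
    lebesgue_rV (-%R @^-1` E) * lebesgue_rV ((fun x : 'rV[R]_n => x *m M) @^-1` F))%E.
  transitivity (\int[@lebesgue_rV R n]_x (lebesgue_rV (-%R @^-1` E) *
      (\1_((fun x : 'rV[R]_n => x *m M) @^-1` F) x)%:E))%E.
    apply: eq_integral => x _; rewrite indicE.
    have [xF|xF] := boolP (x \in _).
      rewrite mule1 -(lebesgue_rV_translate (- (x *m M)) (mN _ mE)).
      congr lebesgue_rV; apply/seteqP; split => y.
        by rewrite /xsection/= inE => -[+ _] /=; rewrite scaleN1r opprB.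
      rewrite /xsection/= inE => Fy; split => /=; first by rewrite scaleN1r -opprB.
      by rewrite inE in xF.
    rewrite mule0 (_ : xsection _ _ = set0) ?measure0//.
    apply/seteqP; split => // y; rewrite /xsection/= inE => -[/= _ Fx].
    by move: xF; rewrite notin_setE/=.
  rewrite ge0_integralZl//; first by rewrite integral_indic ?setIT 1?muleC//; exact: mM.
  by apply/measurable_EFinP; apply: measurable_indic; exact: mM.
rewrite -LHSE -RHSE !fub//; apply: eq_integral => y _.
rewrite -(@lebesgue_rV_translate R n (- (y *m invmx M)) (ysection S y)).
  congr lebesgue_rV; apply/seteqP; split => x; rewrite /ysection/= !inE /S /S'/=;
  by rewrite mulmxBl -mulmxA mulVmx// mulmx1 scaleN1r scale1r subrK.
exact: measurable_ysection.
Qed.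

Lemma mulmx_preimage_measurable m n (M : 'M[R]_(m, n)) (A : set 'rV[R]_n) :
  measurable A -> measurable ((fun x : 'rV[R]_m => x *m M) @^-1` A).
Proof.
move=> mA; rewrite -[X in measurable X]setTI.
by apply: (continuous_measurable_rV_rV (@mulmx_continuous R m n M)).
Qed.

(** The swap with the identity matrix, tested on a cube, whose volume is finite and positive and can
    be cancelled. *)
Lemma lebesgue_rV_opp n (E : set 'rV[R]_n) : measurable E ->
  lebesgue_rV (-%R @^-1` E) = lebesgue_rV E.
Proof.
move=> mE; have mQ : measurable [set x : 'rV[R]_n | forall i, `|x ord0 i| <= 1].
  by apply: closed_measurable_rV; exact: closed_cube.
have := lebesgue_rV_mulmx_swap (unitmx1 _ _) mE mQ.
have E1 (A : set 'rV[R]_n) : (fun x : 'rV[R]_n => x *m 1%:M) @^-1` A = A.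
  by apply/seteqP; split => x /=; rewrite mulmx1.
rewrite !E1 lebesgue_rV_cube// => /esym; apply: mule_cancelr => //.
Qed.

(** The factor by which [M] changes volume is the same for all sets, so one test set determines it:
    the ball for an orthogonal map, the cube for a homothety. *)
Lemma lebesgue_rV_mulmx n (M : 'M[R]_n) (E F : set 'rV[R]_n) :
  M \in unitmx -> measurable E -> measurable F ->
  (lebesgue_rV ((fun x : 'rV[R]_n => x *m M) @^-1` E) * lebesgue_rV F =
   lebesgue_rV E * lebesgue_rV ((fun x : 'rV[R]_n => x *m M) @^-1` F))%E.
Proof.
by move=> uM mE mF; rewrite lebesgue_rV_mulmx_swap// lebesgue_rV_opp.
Qed.

Lemma closed_ball_enorm n (r : R) : closed [set x : 'rV[R]_n | enorm x <= r].
Proof.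
rewrite (_ : mkset _ = @enorm R n @^-1` [set y | y <= r])//.
by apply: closed_preimage; [exact: enorm_continuous|exact: closed_le].
Qed.

Lemma compact_ball_enorm n (r : R) : compact [set x : 'rV[R]_n | enorm x <= r].
Proof. by apply: (@enorm_bounded_compact _ _ _ r) => //; exact: closed_ball_enorm. Qed.

Lemma compact_lebesgue_rV_fin n (A : set 'rV[R]_n) :
  compact A -> lebesgue_rV A \is a fin_num.
Proof.
move=> cA; have [r r0 Ar] := compact_enorm_bounded cA.
rewrite ge0_fin_numE//.
apply: (@le_lt_trans _ _ (lebesgue_rV [set x : 'rV[R]_n | forall i, (`|x ord0 i| <= r)%R])).
  apply: le_measure; rewrite ?inE.
  - exact: compact_measurable_rV.
  - by apply: closed_measurable_rV; exact: closed_cube.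
  - move=> x Ax i; apply: (le_trans (norm_coord _ _)).
    by apply: (le_trans (norm_le_enorm _)); exact: Ar.
by rewrite lebesgue_rV_cube ?ltry// ltW.
Qed.

Lemma lebesgue_rV_ball_gt0 n (r : R) : 0 < r ->
  (0 < lebesgue_rV [set x : 'rV[R]_n | (enorm x <= r)%R])%E.
Proof.
move=> r0; pose d := r / n.+1%:R.
have d0 : 0 < d by rewrite divr_gt0.
apply: (@lt_le_trans _ _ (lebesgue_rV [set x : 'rV[R]_n | forall i, (`|x ord0 i| <= d)%R])).
  by rewrite lebesgue_rV_cube ?ltW// lte_fin exprn_gt0// mulr_gt0.
apply: le_measure; rewrite ?inE.
- by apply: closed_measurable_rV; exact: closed_cube.
- by apply: closed_measurable_rV; exact: closed_ball_enorm.
move=> x /= xd; apply: (le_trans (enorm_le_norm _)).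
apply: (@le_trans _ _ (n.+1%:R * d)); last by rewrite mulrC divfK.
rewrite ler_pM ?ler0n ?ler_nat//.
rewrite [leLHS]mx_normrE; apply/bigmax_leP; split; first exact: ltW.
by move=> [j0 i] _ /=; rewrite ord1.
Qed.

Lemma lebesgue_rV_orthogonal n (M : 'M[R]_n) (E : set 'rV[R]_n) :
  M *m M^T = 1%:M -> measurable E ->
  lebesgue_rV ((fun x : 'rV[R]_n => x *m M) @^-1` E) = lebesgue_rV E.
Proof.
move=> MM mE; have uM : M \in unitmx by case/mulmx1_unit: MM.
have mB : measurable [set x : 'rV[R]_n | enorm x <= 1].
  by apply: closed_measurable_rV; exact: closed_ball_enorm.
have := lebesgue_rV_mulmx uM mE mB.
rewrite (_ : (fun x : 'rV[R]_n => x *m M) @^-1` [set x | enorm x <= 1] = [set x | enorm x <= 1]).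
  apply: mule_cancelr; last exact: lebesgue_rV_ball_gt0.
  exact: compact_lebesgue_rV_fin (@compact_ball_enorm _ _).
by apply/seteqP; split => x /=; rewrite enorm_mulmx.
Qed.

Lemma lebesgue_rV_scale n (t : R) (E : set 'rV[R]_n) : 0 < t -> measurable E ->
  lebesgue_rV (dilate t E) = ((t ^+ n)%:E * lebesgue_rV E)%E.
Proof.
move=> t0 mE; have t0' : t != 0 by rewrite gt_eqF.
have uM : (t^-1)%:M \in @unitmx R n.
  by rewrite unitmxE det_scalar unitrX// unitfE invr_eq0.
have dE (A : set 'rV[R]_n) : dilate t A = (fun x : 'rV[R]_n => x *m (t^-1)%:M) @^-1` A.
  apply/seteqP; split => x /=.
    by move=> [y Ay <-]; rewrite mul_mx_scalar scalerA mulVf// scale1r.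
  by rewrite mul_mx_scalar => Ax; exists (t^-1 *: x) => //; rewrite scalerA mulfV// scale1r.
have mQ : measurable [set x : 'rV[R]_n | forall i, `|x ord0 i| <= 1].
  by apply: closed_measurable_rV; exact: closed_cube.
have := lebesgue_rV_mulmx uM mE mQ.
rewrite -!dE (_ : dilate t [set x : 'rV[R]_n | forall i, `|x ord0 i| <= 1] = [set x : 'rV[R]_n | forall i, `|x ord0 i| <= t]).
  rewrite !lebesgue_rV_cube ?ltW// => h.
  apply: (@mule_cancelr ((2 * 1) ^+ n)%:E) => //.
  by rewrite h muleAC -EFinM -exprMn muleC mulr1 mulrC.
rewrite dE; apply/seteqP; split => x /= H i; have := H i; rewrite mul_mx_scalar mxE normrM.
  by rewrite normfV (gtr0_norm t0) [X in X <= 1]mulrC ler_pdivrMr// mul1r.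
  by rewrite normfV (gtr0_norm t0) [X in X <= 1]mulrC ler_pdivrMr// mul1r.
Qed.

End linear_change.

(** * Projections and slices *)

Section frame.
Context (R : realType) (m : nat).
Implicit Types (xi x : 'rV[R]_m.+1) (y : 'rV[R]_m) (C : set 'rV[R]_m.+1).

(* [frame xi], with the dimension [m.+1.-1] reduced. *)
Definition frm xi : 'M[R]_(m, m.+1) := frame xi.

Lemma frm_mul xi : sphere xi -> frm xi *m (frm xi)^T = 1%:M.
Proof. by move=> /frameP[]. Qed.

Lemma frm_xi xi : sphere xi -> xi *m (frm xi)^T = 0.
Proof. by move=> /frameP[_ h]; rewrite -[LHS]trmxK trmx_mul trmxK h trmx0. Qed.

Definition frame_mx xi : 'M[R]_(1 + m, m.+1) := col_mx xi (frm xi).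

Lemma frame_mx_orthogonal xi : sphere xi -> frame_mx xi *m (frame_mx xi)^T = 1%:M.
Proof.
move=> xi1; rewrite /frame_mx tr_col_mx mul_col_row frm_mul// frm_xi//.
have [_] := frameP xi1; rewrite -/(frm xi) => ->.
rewrite [xi *m _]mx11_scalar -/(dot xi xi) dot_sphere//.
by rewrite -scalar_mx_block.
Qed.

Lemma frame_decomp xi x : sphere xi ->
  x = dot x xi *: xi + x *m (frm xi)^T *m frm xi.
Proof.
move=> xi1; have /mulmx1C := frame_mx_orthogonal xi1.
rewrite /frame_mx tr_col_mx mul_row_col => h.
by rewrite -[LHS]mulmx1 -[1%:M]h mulmxDr !mulmxA [x *m xi^T]mx11_scalar mul_scalar_mx.
Qed.

(** The orthogonal projection on the hyperplane, in the coordinates of the frame: it lives in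
    dimension [m], where [volume] and [surface_area] apply directly. *)
Definition hproj xi C : set 'rV[R]_m := [set x *m (frm xi)^T | x in C].

Definition slice xi C y : set R := [set s | C (s *: xi + y *m frm xi)].

Lemma hproj_slice xi C y : sphere xi -> hproj xi C y <-> slice xi C y !=set0.
Proof.
move=> xi1; split=> [[x Cx <-]|[s Cs]].
  by exists (dot x xi); rewrite /slice/= -frame_decomp.
exists (s *: xi + y *m frm xi) => //.
by rewrite mulmxDl -scalemxAl frm_xi// scaler0 add0r -mulmxA frm_mul// mulmx1.
Qed.

Lemma dot_slice xi s y : sphere xi -> dot (s *: xi + y *m frm xi) xi = s.
Proof.
move=> xi1; rewrite dotDl dotZl dot_sphere// mulr1 dot_mulmxl frm_xi// dot0r.
by rewrite addr0.
Qed.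

Lemma enorm_slice xi s y : sphere xi ->
  enorm (s *: xi + y *m frm xi) ^+ 2 = s ^+ 2 + enorm y ^+ 2.
Proof.
move=> xi1; rewrite sqr_enorm dotDl !dotDr !dotZl !dotZr dot_sphere// mulr1.
rewrite dot_mulmxl frm_xi// dot0r dotC dot_mulmxl frm_xi// dot0r mulr0 addr0 add0r.
by rewrite dot_mulmxl -mulmxA frm_mul// mulmx1 -sqr_enorm -expr2.
Qed.

Lemma rV_cons_frame xi (s : R) y :
  rV_cons (s, y) *m frame_mx xi = s *: xi + y *m frm xi.
Proof.
rewrite /rV_cons /frame_mx /=.
apply: etrans (mul_row_col (const_mx s) y xi (frm xi)) _; congr (_ + _).
rewrite (_ : const_mx s = s%:M) ?mul_scalar_mx//.
by apply/matrixP => i j; rewrite !ord1 !mxE.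
Qed.

(** Cavalieri's principle: the orthogonal matrix [frame_mx xi] turns [xi] into the first coordinate,
    and Tonelli's theorem measures [C] by its chords in that direction. *)
Lemma lebesgue_rV_slice xi C : sphere xi -> measurable C ->
  measurable_fun [set: 'rV[R]_m] (fun y => lebesgue_measure (slice xi C y)) /\
  lebesgue_rV C = (\int[@lebesgue_rV R m]_y lebesgue_measure (slice xi C y))%E.
Proof.
move=> xi1 mC.
pose H : 'M[R]_m.+1 := frame_mx xi.
pose T : set (measurableTypeR R * 'rV[R]_m) :=
  @rV_cons R m @^-1` ((fun x : 'rV[R]_m.+1 => x *m H) @^-1` C).
have mT : measurable T.
  rewrite -[X in measurable X]setTI; apply: measurable_rV_cons => //.
  exact: mulmx_preimage_measurable.
have sliceE y : slice xi C y = ysection T y.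
  apply/seteqP; split => s; by rewrite /slice /ysection/= inE /T/= rV_cons_frame.
have {}sliceE : slice xi C = ysection T by apply/funext.
rewrite sliceE.
split; first exact: (measurable_fun_ysection (@lebesgue_measure R) mT).
rewrite -(@lebesgue_rV_orthogonal R m.+1 H)//; last exact: frame_mx_orthogonal.
have := indic_fubini_tonelli (@lebesgue_measure R) (@lebesgue_rV R m) mT.
by rewrite indic_fubini_tonelli_FE// indic_fubini_tonelli_GE.
Qed.

End frame.

(** Convexity with a real parameter; together with compactness, and without an interior point, it
    covers segments and zonotopes as well as bodies. [convex_body_ccvx] provides it for convex
    bodies. *)
Definition cvx (R : realType) n (A : set 'rV[R]_n) :=
  forall x y (t : R), A x -> A y -> 0 <= t -> t <= 1 -> A (t *: x + (1 - t) *: y).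

Definition ccvx (R : realType) n (A : set 'rV[R]_n) := compact A /\ cvx A.

Lemma compact_convex_itv (R : realType) (A : set R) : compact A -> A !=set0 ->
  (forall x y t, A x -> A y -> 0 <= t -> t <= 1 -> A (t * x + (1 - t) * y)) ->
  exists p q, p <= q /\ A = `[p, q]%classic.
Proof.
move=> cA A0 cvA.
have cid : {within A, continuous (@idfun R)} by apply: continuous_subspaceT => x; exact: cvg_id.
have [q] := compact_EVT_max A0 cA cid; rewrite inE => Aq qmax.
have [p] := compact_EVT_min A0 cA cid; rewrite inE => Ap pmin.
have pq : p <= q by apply: qmax; rewrite inE.
exists p, q; split => //; apply/seteqP; split => x.
  move=> Ax; rewrite /= in_itv/=; apply/andP; split.
    by apply: pmin; rewrite inE.
  by apply: qmax; rewrite inE.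
rewrite /= in_itv/= => /andP[px xq].
have [pq'|pq'] := eqVneq p q.
  by rewrite (_ : x = p)//; apply/eqP; rewrite eq_le px pq' xq.
have qp0 : 0 < q - p by rewrite subr_gt0 lt_neqAle pq' pq.
rewrite (_ : x = ((x - p) / (q - p)) * q + (1 - (x - p) / (q - p)) * p).
  apply: cvA => //; first by rewrite divr_ge0 ?subr_ge0// ltW.
  by rewrite ler_pdivrMr// mul1r lerD2r.
by field; rewrite gt_eqF.
Qed.

Section sets.
Context (R : realType) (n : nat).
Implicit Types (A B C : set 'rV[R]_n) (x y : 'rV[R]_n).

Definition seg (a b : R) x : set 'rV[R]_n := [set r *: x | r in `[a, b]%classic].

Lemma cvx_minkowski A B : cvx A -> cvx B -> cvx (minkowski_sum A B).
Proof.
move=> cA cB _ _ t [a Aa [b Bb <-]] [a' Aa' [b' Bb' <-]] t0 t1.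
exists (t *: a + (1 - t) *: a'); first exact: cA.
exists (t *: b + (1 - t) *: b'); first exact: cB.
by rewrite !scalerDr addrACA.
Qed.

Lemma compact_minkowski A B : compact A -> compact B -> compact (minkowski_sum A B).
Proof.
move=> cA cB.
have -> : minkowski_sum A B = (fun p => p.1 + p.2) @` (A `*` B).
  apply/seteqP; split => [_ [a Aa [b Bb <-]]|_ [[a b] [/= Aa Bb] <-]].
    by exists (a, b).
  by exists a => //; exists b.
apply: compact_image; last exact: compact_setX.
exact: add_continuous.
Qed.

Lemma ccvx_minkowski A B : ccvx A -> ccvx B -> ccvx (minkowski_sum A B).
Proof.
by move=> [cA vA] [cB vB]; split; [exact: compact_minkowski|exact: cvx_minkowski].
Qed.

Lemma scaler_continuous_l x : continuous (fun r : R => r *: x).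
Proof.
apply: continuous_mxP => i j; under eq_fun do rewrite mxE.
by move=> r; apply: (@cvgMl _ _ (nbhs r)); exact: cvg_id.
Qed.

Lemma ccvx_seg a b x : ccvx (seg a b x).
Proof.
split.
  apply: (@compact_image _ _ (fun r : R => r *: x)); last exact: segment_compact.
  exact: scaler_continuous_l.
move=> _ _ t [r hr <-] [s hs <-] t0 t1; move: hr hs.
rewrite /= !in_itv/= => /andP[ar rb] /andP[as' sb].
exists (t * r + (1 - t) * s); last by rewrite [LHS]scalerDl !scalerA.
by rewrite /= in_itv/=; apply/andP; split; nra.
Qed.

End sets.

Section hproj_sets.
Context (R : realType) (m : nat).
Implicit Types (xi : 'rV[R]_m.+1) (A B C : set 'rV[R]_m.+1).

Lemma ccvx_hproj xi C : ccvx C -> ccvx (hproj xi C).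
Proof.
move=> [cC vC]; split.
  by apply: compact_image cC; exact: mulmx_continuous.
move=> _ _ t [x Cx <-] [y Cy <-] t0 t1.
exists (t *: x + (1 - t) *: y); first exact: vC.
by rewrite mulmxDl -!scalemxAl.
Qed.

Lemma slice_itv xi C y : sphere xi -> ccvx C -> hproj xi C y ->
  exists p q, p <= q /\ slice xi C y = `[p, q]%classic.
Proof.
move=> xi1 [cC vC] Py; apply: compact_convex_itv; last 2 first.
- exact/hproj_slice.
- move=> s s' t; rewrite /slice/= => Cs Cs' t0 t1.
  have := vC _ _ t Cs Cs' t0 t1; set z := y *m _; congr C.
  by apply/rowP => i; rewrite !mxE; ring.
- have -> : slice xi C y = (fun x => dot x xi) @`
      (C `&` (fun x : 'rV[R]_m.+1 => x *m (frm xi)^T) @^-1` [set y]).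
    apply/seteqP; split => [s Cs|_ [x [Cx <-] <-]].
      exists (s *: xi + y *m frm xi); last by rewrite dot_slice.
      split => //=; rewrite mulmxDl -scalemxAl frm_xi// scaler0 add0r.
      by rewrite -mulmxA frm_mul// mulmx1.
    by rewrite /slice/= -frame_decomp.
  apply: compact_image; first exact: dot_continuous.
  apply: compact_closedI => //; apply: closed_preimage; first exact: mulmx_continuous.
  by apply: compact_closed_rV; exact: compact_set1.
Qed.

Lemma volume_hproj xi C : sphere xi ->
  hvolume xi (proj_hyperplane xi C) = volume (hproj xi C).
Proof.
move=> xi1; rewrite /hvolume; congr volume; apply/seteqP; split => y.
  move=> [x Cx xy]; exists x => //.
  have : x *m (frm xi)^T *m frm xi = y *m frm xi.
    by rewrite -[RHS]xy {2}(frame_decomp x xi1) addrAC subrr add0r.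
  move=> /(congr1 (fun z => z *m (frm xi)^T)).
  by rewrite -!mulmxA frm_mul// !mulmx1.
move=> [x Cx <-]; exists x => //.
by rewrite {1}(frame_decomp x xi1) addrAC subrr add0r.
Qed.

(** Over each point of the projection the chord $[p,q]$ becomes $[p+a,q+b]$, longer by $b-a$;
    elsewhere the chords stay empty. Then integrate over the projection. *)
Lemma volume_segment xi C (a b : R) : sphere xi -> ccvx C -> a <= b ->
  volume (minkowski_sum C (seg a b xi)) =
  volume C + (b - a) * volume (hproj xi C).
Proof.
move=> xi1 cC ab.
have cS : compact (minkowski_sum C (seg a b xi)).
  by case: (ccvx_minkowski cC (ccvx_seg a b xi)).
have cP : compact (hproj xi C) by case: (ccvx_hproj xi cC).
have mP := compact_measurable_rV cP.
have [mC CE] := lebesgue_rV_slice xi1 (compact_measurable_rV cC.1).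
have [mS SE] := lebesgue_rV_slice xi1 (compact_measurable_rV cS).
rewrite /volume -[b - a]/(fine (b - a)%:E) -fineM//; last exact: compact_lebesgue_rV_fin.
rewrite -fineD//; last 2 first.
  by apply: compact_lebesgue_rV_fin; exact: cC.1.
  by apply: fin_numM => //; exact: compact_lebesgue_rV_fin.
congr fine; rewrite SE.
transitivity (\int[@lebesgue_rV R m]_y (lebesgue_measure (slice xi C y) +
    (b - a)%:E * (\1_(hproj xi C) y)%:E))%E.
  apply: eq_integral => y _; rewrite indicE.
  have [yP|yP] := boolP (y \in _).
    rewrite inE in yP; have [p [q [pq E]]] := slice_itv xi1 cC yP.
    rewrite mule1 E (_ : slice _ _ _ = `[(p + a), (q + b)]%classic).
      rewrite !lebesgue_measure_itv/= !lte_fin.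
      case: ltrP => h1; case: ltrP => h2; rewrite -?EFinB -?EFinD; congr EFin; lra.
    apply/seteqP; split => s; rewrite /slice/=.
      move=> [x Cx [_ [r /= + <-] xE]]; rewrite in_itv/= => /andP[ar rb].
      have : slice xi C y (s - r).
        by rewrite /slice/= scalerBl addrAC -xE addrK.
      by rewrite E/= !in_itv/= => /andP[h1 h2]; apply/andP; split; lra.
    rewrite in_itv/= => /andP[h1 h2].
    (* The point [s] is split as [(s - r) + r]: [r = a] when this keeps [s - r] below [q], and
       otherwise [s - r] is the top [q] of the chord. *)
    have [r [hr1 hr2]] : exists r, a <= r <= b /\ p <= s - r <= q.
      have [h|h] := leP (s - a) q.
        by exists a; split; apply/andP; split; lra.
      by exists (s - q); split; apply/andP; split; lra.
    have : slice xi C y (s - r) by rewrite E/= in_itv/=.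
    rewrite /slice/= => Cx; exists ((s - r) *: xi + y *m frm xi) => //.
    exists (r *: xi); first by exists r => //=; rewrite in_itv/=.
    by rewrite addrAC -scalerDl subrK.
  have yP' : ~ hproj xi C y by move: yP; rewrite notin_setE.
  rewrite mule0 adde0 (_ : slice _ _ _ = set0); last first.
    apply/seteqP; split => // s [x Cx [_ [r _ <-] xE]]; apply: yP'.
    apply/(hproj_slice _ _ xi1); exists (s - r).
    by rewrite /slice/= scalerBl addrAC -xE addrK.
  rewrite (_ : slice _ _ _ = set0)//.
  apply/seteqP; split => // s Cs; apply: yP'.
  by apply/(hproj_slice _ _ xi1); exists s.
rewrite ge0_integralD//; last 2 first.
  by move=> y _; apply: mule_ge0 => //; rewrite lee_fin subr_ge0.
  by apply: measurable_funeM; apply/measurable_EFinP; exact: measurable_indic.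
rewrite -CE ge0_integralZl//; last 2 first.
  by apply/measurable_EFinP; exact: measurable_indic.
  by rewrite lee_fin subr_ge0.
by rewrite integral_indic// setIT.
Qed.

(** Chords in direction [xi] have length at most [2 * a] inside the slab and are empty off the
    projection of [C]. *)
Lemma volume_slab xi C (a : R) : sphere xi -> ccvx C -> 0 <= a ->
  volume (C `&` [set x | `|dot x xi| <= a]) <= 2 * a * volume (hproj xi C).
Proof.
move=> xi1 cC a0.
have cS : compact (C `&` [set x | `|dot x xi| <= a]).
  apply: compact_closedI; first exact: cC.1.
  apply: (@closed_preimage _ _ (fun x => `|dot x xi|) [set y | y <= a]).
    move=> x; apply: (@continuous_comp _ _ _ (fun x => dot x xi)).
      exact: dot_continuous.
    exact: norm_continuous.
  exact: closed_le.
have cP : compact (hproj xi C) by case: (ccvx_hproj xi cC).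
have mP := compact_measurable_rV cP.
have [mS SE] := lebesgue_rV_slice xi1 (compact_measurable_rV cS).
rewrite /volume -[2 * a]/(fine (2 * a)%:E) -fineM//; last exact: compact_lebesgue_rV_fin.
apply: fine_le; first exact: compact_lebesgue_rV_fin.
  by apply: fin_numM => //; exact: compact_lebesgue_rV_fin.
rewrite SE.
apply: (@le_trans _ _ (\int[@lebesgue_rV R m]_y ((2 * a)%:E * (\1_(hproj xi C) y)%:E))%E).
  apply: ge0_le_integral => //.
    by apply: measurable_funeM; apply/measurable_EFinP; exact: measurable_indic.
  move=> y _; rewrite indicE.
  have [yP|yP] := boolP (y \in _).
    rewrite mule1; apply: (@le_trans _ _ (lebesgue_measure `[(- a), a]%classic)).
      apply: le_outer_measure => s [_] /=; rewrite dot_slice// in_itv/= ler_norml//.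
    rewrite lebesgue_measure_itv/=; case: ifPn => h; first by rewrite -EFinB lee_fin; lra.
    by rewrite lee_fin mulr_ge0.
  have yP' : ~ hproj xi C y by move: yP; rewrite notin_setE.
  rewrite mule0 (_ : slice _ _ _ = set0) ?measure0//.
  apply/seteqP; split => // s [Cs _]; apply: yP'.
  by apply/(hproj_slice _ _ xi1); exists s.
rewrite ge0_integralZl//; last 2 first.
  by apply/measurable_EFinP; exact: measurable_indic.
  by rewrite lee_fin mulr_ge0.
by rewrite integral_indic// setIT.
Qed.

End hproj_sets.

Section volume.
Context (R : realType) (n : nat).
Implicit Types (A B C D : set 'rV[R]_n) (x y : 'rV[R]_n).

Definition cball (r : R) : set 'rV[R]_n := [set x | enorm x <= r].

Lemma volume_ge0 A : 0 <= volume A.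
Proof. by rewrite /volume fine_ge0. Qed.

Lemma volume_le A B : compact A -> compact B -> A `<=` B -> volume A <= volume B.
Proof.
move=> cA cB AB; apply: fine_le; [exact: compact_lebesgue_rV_fin..|].
by apply: le_measure => //; rewrite inE; exact: compact_measurable_rV.
Qed.

Lemma volume_dilate (t : R) A : 0 < t -> compact A ->
  volume (dilate t A) = t ^+ n * volume A.
Proof.
move=> t0 cA; rewrite /volume lebesgue_rV_scale//; last exact: compact_measurable_rV.
by rewrite fineM//; exact: compact_lebesgue_rV_fin.
Qed.

Lemma volume_translate x A : compact A -> volume [set y + x | y in A] = volume A.
Proof.
move=> cA; rewrite /volume -[in RHS](@lebesgue_rV_translate _ _ (- x)).
  congr (fine (lebesgue_rV _)); apply/seteqP; split => y /=.
    by move=> [z Az <-]; rewrite addrK.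
  by move=> Ay; exists (y - x) => //; rewrite subrK.
exact: compact_measurable_rV.
Qed.

Lemma volume_cball_gt0 r : 0 < r -> 0 < volume (cball r).
Proof.
move=> r0; rewrite /volume fine_gt0// lebesgue_rV_ball_gt0//=.
rewrite -ge0_fin_numE//; apply: compact_lebesgue_rV_fin.
exact: compact_ball_enorm.
Qed.

Lemma ccvx_cball r : ccvx (cball r).
Proof.
split; first exact: compact_ball_enorm.
move=> x y t; rewrite /cball/= => xr yr t0 t1.
apply: (le_trans (enormD _ _)); rewrite !enormZ !ger0_norm ?subr_ge0//.
have t1' : 0 <= 1 - t by lra.
by have := ler_wpM2l t0 xr; have := ler_wpM2l t1' yr; lra.
Qed.

Lemma cball0 r : 0 <= r -> cball r 0.
Proof. by rewrite /cball/= enorm0. Qed.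

Lemma cballS r r' : r <= r' -> cball r `<=` cball r'.
Proof. by move=> rr x /= xr; exact: le_trans rr. Qed.

Lemma compact_dilate t A : compact A -> compact (dilate t A).
Proof.
apply: compact_image; apply: continuous_mxP => i j.
under eq_fun do rewrite mxE.
by move=> x; apply: (@cvgMr _ _ (nbhs x)); exact: coord_continuous.
Qed.

Lemma cvx_dilate t A : cvx A -> cvx (dilate t A).
Proof.
move=> vA _ _ u [x Ax <-] [y Ay <-] u0 u1.
exists (u *: x + (1 - u) *: y); first exact: vA.
by apply/rowP => i; rewrite !mxE; ring.
Qed.

Lemma ccvx_dilate t A : ccvx A -> ccvx (dilate t A).
Proof. by move=> [cA vA]; split; [exact: compact_dilate|exact: cvx_dilate]. Qed.

Lemma dilate_cball t r : 0 < t -> dilate t (cball r) = cball (t * r).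
Proof.
move=> t0; apply/seteqP; split => [_ [x xr <-]|x xr]; rewrite /cball/=.
  by rewrite enormZ gtr0_norm// ler_pM2l.
exists (t^-1 *: x); last by rewrite scalerA mulfV ?gt_eqF// scale1r.
by rewrite /cball/= enormZ gtr0_norm ?invr_gt0// mulrC ler_pdivrMr// mulrC.
Qed.

Lemma dilateS t A B : A `<=` B -> dilate t A `<=` dilate t B.
Proof. by move=> AB _ [x Ax <-]; exists x => //; exact: AB. Qed.

Lemma dilate_dilate s t A : dilate s (dilate t A) = dilate (s * t) A.
Proof.
apply/seteqP; split => [_ [_ [x Ax <-] <-]|_ [x Ax <-]].
  by exists x => //; rewrite scalerA.
by exists (t *: x); [exists x|rewrite scalerA].
Qed.

Lemma dilate1 A : dilate 1 A = A.
Proof.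
apply/seteqP; split => [_ [x Ax <-]|x Ax]; first by rewrite scale1r.
by exists x; rewrite ?scale1r.
Qed.

Lemma dilate_le s t A : cvx A -> A 0 -> 0 <= s -> s <= t -> 0 < t ->
  dilate s A `<=` dilate t A.
Proof.
move=> vA A0 s0 st t0 _ [x Ax <-]; exists ((s / t) *: x).
  have -> : (s / t) *: x = (s / t) *: x + (1 - s / t) *: 0 by rewrite scaler0 addr0.
  apply: vA => //; first by rewrite divr_ge0// ltW.
  by rewrite ler_pdivrMr// mul1r.
by rewrite scalerA mulrC divfK// gt_eqF.
Qed.

Lemma minkowskiS A A' B B' : A `<=` A' -> B `<=` B' ->
  minkowski_sum A B `<=` minkowski_sum A' B'.
Proof.
move=> AA BB _ [a Aa [b Bb <-]]; exists a; first exact: AA.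
by exists b => //; exact: BB.
Qed.

Lemma minkowskiC A B : minkowski_sum A B = minkowski_sum B A.
Proof.
by apply/seteqP; split => [_ [a Aa [b Bb <-]]|_ [a Aa [b Bb <-]]];
  exists b => //; exists a => //; rewrite addrC.
Qed.

Lemma minkowskiA A B C :
  minkowski_sum A (minkowski_sum B C) = minkowski_sum (minkowski_sum A B) C.
Proof.
apply/seteqP; split => [_ [a Aa [_ [b Bb [c Cc <-]] <-]]|_ [_ [a Aa [b Bb <-]] [c Cc <-]]].
  by exists (a + b); [exists a => //; exists b|exists c => //; rewrite addrA].
by exists a => //; exists (b + c); [exists b => //; exists c|rewrite addrA].
Qed.

Lemma minkowski0 A : minkowski_sum A [set 0] = A.
Proof.
apply/seteqP; split => [_ [a Aa [_ -> <-]]|a Aa]; first by rewrite addr0.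
by exists a => //; exists 0 => //; rewrite addr0.
Qed.

Lemma sub_minkowski A B : B 0 -> A `<=` minkowski_sum A B.
Proof. by move=> B0 a Aa; exists a => //; exists 0 => //; rewrite addr0. Qed.

Lemma dilate_minkowski t A B :
  dilate t (minkowski_sum A B) = minkowski_sum (dilate t A) (dilate t B).
Proof.
apply/seteqP; split => [_ [_ [a Aa [b Bb <-]] <-]|_ [_ [a Aa <-] [_ [b Bb <-] <-]]].
  by rewrite scalerDr; exists (t *: a); [exists a|exists (t *: b); [exists b|]].
by exists (a + b); [exists a => //; exists b|rewrite scalerDr].
Qed.

Lemma minkowski_dilate s t A : cvx A -> 0 < s -> 0 < t ->
  minkowski_sum (dilate s A) (dilate t A) = dilate (s + t) A.
Proof.
move=> vA s0 t0; have st0 : 0 < s + t by rewrite addr_gt0.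
apply/seteqP; split => [_ [_ [a Aa <-] [_ [b Ab <-] <-]]|_ [a Aa <-]].
  exists ((s / (s + t)) *: a + (1 - s / (s + t)) *: b).
    apply: vA => //; first by rewrite divr_ge0// ltW.
    by rewrite ler_pdivrMr// mul1r lerDl ltW.
  by apply/rowP => i; rewrite !mxE; field; rewrite gt_eqF.
by exists (s *: a); [exists a|exists (t *: a); [exists a|rewrite scalerDl]].
Qed.

Lemma minkowski_cball r s : 0 < r -> 0 < s ->
  minkowski_sum (cball r) (cball s) = cball (r + s).
Proof.
move=> r0 s0; rewrite -[r]mulr1 -[s]mulr1 -!dilate_cball//.
rewrite minkowski_dilate ?dilate_cball//; last by case: (ccvx_cball 1).
  by rewrite mulr1 mulr1 mulr1.
by rewrite addr_gt0.
Qed.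

End volume.

Section projection.
Context (R : realType) (m : nat).
Implicit Types (xi : 'rV[R]_m.+1) (A B C : set 'rV[R]_m.+1).

Lemma hprojS xi A B : A `<=` B -> hproj xi A `<=` hproj xi B.
Proof. by move=> AB _ [x Ax <-]; exists x => //; exact: AB. Qed.

Lemma hproj_minkowski xi A B :
  hproj xi (minkowski_sum A B) = minkowski_sum (hproj xi A) (hproj xi B).
Proof.
apply/seteqP; split => [_ [_ [a Aa [b Bb <-]] <-]|_ [_ [a Aa <-] [_ [b Bb <-] <-]]].
  rewrite mulmxDl; exists (a *m (frm xi)^T); first by exists a.
  by exists (b *m (frm xi)^T) => //; exists b.
by exists (a + b); [exists a => //; exists b|rewrite mulmxDl].
Qed.

Lemma hproj_dilate xi t A : hproj xi (dilate t A) = dilate t (hproj xi A).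
Proof.
apply/seteqP; split => [_ [_ [x Ax <-] <-]|_ [_ [x Ax <-] <-]].
  by exists (x *m (frm xi)^T); [exists x|rewrite scalemxAl].
by exists (t *: x); [exists x|rewrite scalemxAl].
Qed.

Lemma hproj_translate xi x A :
  hproj xi [set y + x | y in A] = [set y + x *m (frm xi)^T | y in hproj xi A].
Proof.
apply/seteqP; split => [_ [_ [y Ay <-] <-]|_ [_ [y Ay <-] <-]].
  by rewrite mulmxDl; exists (y *m (frm xi)^T) => //; exists y.
by exists (y + x); [exists y|rewrite mulmxDl].
Qed.

Lemma enorm_hproj xi x : sphere xi -> enorm (x *m (frm xi)^T) <= enorm x.
Proof.
move=> xi1; rewrite -[leLHS]ger0_norm ?enorm_ge0// -[leRHS]ger0_norm ?enorm_ge0//.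
rewrite -ler_sqr ?nnegrE ?normr_ge0// !ger0_norm ?enorm_ge0//.
rewrite [in leRHS](frame_decomp x xi1) enorm_slice//.
by rewrite lerDr sqr_ge0.
Qed.

Lemma hproj_cball xi r : sphere xi -> hproj xi (cball r) = cball r.
Proof.
move=> xi1; apply/seteqP; split => [_ [x xr <-]|y yr].
  by apply: le_trans xr; exact: enorm_hproj.
exists (y *m frm xi); last by rewrite -mulmxA frm_mul// mulmx1.
by rewrite /cball/= enorm_mulmx// frm_mul.
Qed.

Lemma det_block_corner (c : R) (a : 'M[R]_1) (b : 'rV[R]_m) (d : 'cV[R]_m)
    (E : 'M[R]_m) :
  \det (block_mx (a + c%:M) b d E) = \det (block_mx a b d E) + c * \det E.
Proof.
have dE : \det (block_mx (1%:M : 'M[R]_1) 0 d E) = \det E.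
  by rewrite det_lblock det1 mul1r.
rewrite -dE (@determinant_multilinear R (1 + m) (block_mx (a + c%:M) b d E)
  (block_mx a b d E) (block_mx 1%:M 0 d E) (lshift m ord0) 1 c) ?mul1r//.
- apply/rowP => j; rewrite !mxE; case: splitP => // i; rewrite ord1 => _.
  rewrite !mxE; case: splitP => k _; last by rewrite !mxE mul1r mulr0 addr0.
  by rewrite !mxE !ord1 eqxx !mulr1n mul1r mulr1.
- apply/matrixP => i j; rewrite !mxE; case: splitP => // k h; exfalso.
  by have := ltn_ord k; rewrite -h /= /bump leq0n.
- apply/matrixP => i j; rewrite !mxE; case: splitP => // k h; exfalso.
  by have := ltn_ord k; rewrite -h /= /bump leq0n.
Qed.

(** In the orthonormal basis [frame_mx xi] the update only adds [c] to the upper left corner, whose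
    cofactor is the determinant of the compression to the hyperplane. This is the determinant
    analogue of [volume_segment]. *)
Lemma det_rank1_update (xi : 'rV[R]_m.+1) (c : R) (A : 'M[R]_m.+1) : sphere xi ->
  \det (A + c *: (xi^T *m xi)) = \det A + c * \det (frm xi *m A *m (frm xi)^T).
Proof.
move=> xi1; pose H : 'M[R]_(1 + m, m.+1) := frame_mx xi.
have HH : H *m H^T = 1%:M by exact: frame_mx_orthogonal.
have conj (B : 'M[R]_m.+1) : \det B = \det (H *m B *m H^T).
  have dH : \det (H : 'M[R]_m.+1) * \det (H : 'M[R]_m.+1) = 1.
    by rewrite -{2}det_tr -det_mulmx HH det1.
  by rewrite [RHS](@det_mulmx _ m.+1) (@det_mulmx _ m.+1) det_tr mulrAC dH mul1r.
have E (B : 'M[R]_m.+1) : H *m B *m H^T =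
    block_mx (xi *m B *m xi^T) (xi *m B *m (frm xi)^T)
             (frm xi *m B *m xi^T) (frm xi *m B *m (frm xi)^T).
  by rewrite /H /frame_mx mul_col_mx tr_col_mx mul_col_row.
rewrite conj E [\det A]conj E -det_block_corner.
have [_ Uxi] := frameP xi1; rewrite -/(frm xi) in Uxi.
have xixi : xi *m xi^T = 1%:M by rewrite [LHS]mx11_scalar -/(dot xi xi) dot_sphere.
have X p q (P : 'M[R]_(p, m.+1)) (Q : 'M[R]_(m.+1, q)) :
    P *m (A + c *: (xi^T *m xi)) *m Q = P *m A *m Q + c *: ((P *m xi^T) *m (xi *m Q)).
  by rewrite mulmxDr mulmxDl -scalemxAr -scalemxAl !mulmxA.
rewrite !X Uxi frm_xi// xixi mulmx0 !mul0mx mul1mx !scaler0 !addr0.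
by rewrite scale_scalar_mx mulr1.
Qed.

End projection.

(** * Zonotopes *)

Section zonotope.
Context (R : realType) (n : nat).
Implicit Types (s : seq (R * 'rV[R]_n)) (A B C : set 'rV[R]_n).

(** A list of pairs $(a,v)$ stands for the sum of the segments $[-av,av]$. The recursion isolates
    one segment, ready for [volume_segment]. *)
Fixpoint zono s : set 'rV[R]_n :=
  if s is p :: s' then minkowski_sum (zono s') (seg (- p.1) p.1 p.2) else [set 0].

Definition zono_wf s := forall p, p \in s -> 0 <= p.1 /\ sphere p.2.

Definition zscale (t : R) s := [seq (t * p.1, p.2) | p <- s].

(** For unit directions, half the sum of the lengths of the segments: the $l$ of the overview. *)
Definition zlen s := \sum_(p <- s) p.1.

(** The support function of the zonotope in closed form, as [zono_le_supp] and [zono_supp_attained]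
    show. *)
Definition zsupp s (theta : 'rV[R]_n) := \sum_(p <- s) p.1 * `|dot p.2 theta|.

Lemma zono_wf_cons p s : zono_wf (p :: s) -> [/\ 0 <= p.1, sphere p.2 & zono_wf s].
Proof.
move=> wf; have [p0 ps] := wf p (mem_head _ _); split => // q qs.
by apply: wf; rewrite in_cons qs orbT.
Qed.

Lemma ccvx_zono s : ccvx (zono s).
Proof.
elim: s => [|p s IH] /=; last by apply: ccvx_minkowski => //; exact: ccvx_seg.
split; first exact: compact_set1.
by move=> x y t -> -> _ _; rewrite !scaler0 addr0.
Qed.

Lemma seg_sym0 (a : R) (x : 'rV[R]_n) : 0 <= a -> seg (- a) a x 0.
Proof. by move=> a0; exists 0; rewrite /= ?in_itv/= ?oppr_le0 ?a0// scale0r. Qed.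

Lemma zono0 s : (forall p, p \in s -> 0 <= p.1) -> zono s 0.
Proof.
elim: s => //= p s IH wf; exists 0.
  by apply: IH => q qs; apply: wf; rewrite in_cons qs orbT.
by exists 0; rewrite ?addr0//; apply: seg_sym0; apply: wf; exact: mem_head.
Qed.

Lemma zono_wf0 s : zono_wf s -> zono s 0.
Proof. by move=> wf; apply: zono0 => p /wf[]. Qed.

Lemma zscale_wf t s : 0 <= t -> zono_wf s -> zono_wf (zscale t s).
Proof.
by move=> t0 wf _ /mapP[p /wf[p0 ps] ->]; split => //=; rewrite mulr_ge0.
Qed.

Lemma dilate_zono t s : 0 < t -> dilate t (zono s) = zono (zscale t s).
Proof.
move=> t0; elim: s => [|p s IH] /=.
  by apply/seteqP; split => [_ [_ -> <-]|_ ->]; [rewrite scaler0|exists 0; rewrite ?scaler0].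
rewrite dilate_minkowski IH; congr minkowski_sum.
apply/seteqP; split => [_ [_ [r hr <-] <-]|_ [r hr <-]].
  exists (t * r); last by rewrite scalerA.
  by move: hr; rewrite /= !in_itv/= -mulrN !ler_pM2l.
exists ((t^-1 * r) *: p.2); last by rewrite scalerA mulrA mulfV ?mul1r// gt_eqF.
exists (t^-1 * r) => //; move: hr; rewrite /= !in_itv/= => /andP[h1 h2].
rewrite -(ler_pM2l t0) mulrA mulfV ?gt_eqF// mul1r mulrN h1/=.
by rewrite -(ler_pM2l t0) mulrA mulfV ?gt_eqF// mul1r.
Qed.

Lemma zlen_scale t s : zlen (zscale t s) = t * zlen s.
Proof. by rewrite /zlen big_map mulr_sumr. Qed.

Lemma zono_le_supp s theta x : (forall p, p \in s -> 0 <= p.1) ->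
  zono s x -> dot x theta <= zsupp s theta.
Proof.
elim: s x => [|p s IH] x wf /=; first by move=> ->; rewrite dot0l /zsupp big_nil.
move=> [y sy [_ [r + <-] <-]]; rewrite /= in_itv/= => /andP[h1 h2].
rewrite /zsupp big_cons dotDl addrC lerD//.
  rewrite dotZl; apply: (le_trans (ler_norm _)); rewrite normrM ler_wpM2r//.
  by rewrite ler_norml h1.
by apply: IH => // q qs; apply: wf; rewrite in_cons qs orbT.
Qed.

Lemma zono_supp_attained s theta : (forall p, p \in s -> 0 <= p.1) ->
  exists2 x, zono s x & dot x theta = zsupp s theta.
Proof.
elim: s => [|p s IH] wf; first by exists 0 => //; rewrite dot0l /zsupp big_nil.
have [|x sx xE] := IH; first by move=> q qs; apply: wf; rewrite in_cons qs orbT.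
have p0 := wf p (mem_head _ _).
have [h|h] := leP 0 (dot p.2 theta).
  exists (x + p.1 *: p.2).
    exists x => //; exists (p.1 *: p.2) => //; exists p.1 => //=.
    by rewrite in_itv/= lexx andbT; lra.
  by rewrite dotDl dotZl xE /zsupp big_cons ger0_norm// addrC.
exists (x + (- p.1) *: p.2).
  exists x => //; exists ((- p.1) *: p.2) => //; exists (- p.1) => //=.
  by rewrite in_itv/= lexx/=; lra.
by rewrite dotDl dotZl xE /zsupp big_cons ltr0_norm// addrC mulNr mulrN.
Qed.

End zonotope.

(** * Growth of volume when a zonotope is added *)

Section zonotope_volume.
Context (R : realType) (m : nat).
Implicit Types (s : seq (R * 'rV[R]_m.+1)) (A B C : set 'rV[R]_m.+1).

Lemma volume_zono_cons A p s : ccvx A -> zono_wf (p :: s) ->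
  volume (minkowski_sum A (zono (p :: s))) =
  volume (minkowski_sum A (zono s)) +
  2 * p.1 * volume (hproj p.2 (minkowski_sum A (zono s))).
Proof.
move=> cA /zono_wf_cons[p0 ps wf] /=; rewrite minkowskiA volume_segment//.
- by congr (_ + _ * _); rewrite opprK mulr_natl mulr2n.
- by apply: ccvx_minkowski => //; exact: ccvx_zono.
- by lra.
Qed.

Lemma volume_hproj_le xi A B : ccvx A -> ccvx B -> A `<=` B ->
  volume (hproj xi A) <= volume (hproj xi B).
Proof.
move=> cA cB AB; apply: volume_le; last exact: hprojS.
  by case: (ccvx_hproj xi cA).
by case: (ccvx_hproj xi cB).
Qed.

Lemma minkowski_zonoS A A' s : A `<=` A' ->
  minkowski_sum A (zono s) `<=` minkowski_sum A' (zono s).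
Proof. by move=> AA; apply: minkowskiS. Qed.

(** Induction on the segments: each one adds a multiple of the volume of a projection, and that
    volume is monotone in the body. *)
Lemma volume_zono_mono A A' s : ccvx A -> ccvx A' -> A `<=` A' -> zono_wf s ->
  volume (minkowski_sum A (zono s)) - volume A <=
  volume (minkowski_sum A' (zono s)) - volume A'.
Proof.
move=> cA cA' AA; elim: s => [_|p s IH wf].
  by rewrite /= !minkowski0 !subrr.
have [p0 ps wfs] := zono_wf_cons wf.
rewrite !volume_zono_cons// -!addrA [_ * _ + _]addrC [_ * _ * _ + _]addrC !addrA lerD//; first exact: IH.
rewrite ler_wpM2l ?mulr_ge0//; apply: volume_hproj_le.
- by apply: ccvx_minkowski => //; exact: ccvx_zono.
- by apply: ccvx_minkowski => //; exact: ccvx_zono.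
- exact: minkowski_zonoS.
Qed.

(** Monotonicity in $t$ of $(|A+tZ|-|A|)/t$, with denominators cleared. A segment contributes $2ta$
    times a projection of $A+tZ'$, with $Z'$ the sum of the remaining segments, and this projection
    grows with $t$ since $Z'$ contains the origin. *)
Lemma volume_zono_quot A s (t u : R) : ccvx A -> zono_wf s -> 0 < t -> t <= u ->
  u * (volume (minkowski_sum A (zono (zscale t s))) - volume A) <=
  t * (volume (minkowski_sum A (zono (zscale u s))) - volume A).
Proof.
move=> cA + t0 tu; have u0 : 0 < u by lra.
elim: s => [_|p s IH wf].
  by rewrite /= !minkowski0 !subrr !mulr0.
have [p0 ps wfs] := zono_wf_cons wf.
have wt : zono_wf (zscale t (p :: s)) by apply: zscale_wf => //; exact: ltW.
have wu : zono_wf (zscale u (p :: s)) by apply: zscale_wf => //; exact: ltW.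
rewrite !volume_zono_cons//= -/(zscale t s) -/(zscale u s).
have H : volume (hproj p.2 (minkowski_sum A (zono (zscale t s)))) <=
    volume (hproj p.2 (minkowski_sum A (zono (zscale u s)))).
  apply: volume_hproj_le.
  - by apply: ccvx_minkowski => //; exact: ccvx_zono.
  - by apply: ccvx_minkowski => //; exact: ccvx_zono.
  apply: minkowskiS => //; rewrite -!dilate_zono//.
  by apply: dilate_le (ltW t0) tu u0; [case: (ccvx_zono s)|exact: zono_wf0].
have := IH wfs.
set a := volume _ in H *; set b := volume _ in H *.
move=> IH'; have : 2 * p.1 * u * t * a <= 2 * p.1 * u * t * b.
  by rewrite ler_wpM2l// !mulr_ge0// ltW.
by move: IH'; lra.
Qed.

(** Every partial sum contains [A], so each segment adds at least what it would add to [A] alone. *)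
Lemma volume_zono_lower A s : ccvx A -> zono_wf s ->
  \sum_(p <- s) 2 * p.1 * volume (hproj p.2 A) <=
  volume (minkowski_sum A (zono s)) - volume A.
Proof.
move=> cA; elim: s => [_|p s IH wf].
  by rewrite big_nil /= minkowski0 subrr.
have [p0 ps wfs] := zono_wf_cons wf.
rewrite big_cons volume_zono_cons//.
have := IH wfs.
have : 2 * p.1 * volume (hproj p.2 A) <= 2 * p.1 * volume (hproj p.2 (minkowski_sum A (zono s))).
  rewrite ler_wpM2l ?mulr_ge0//; apply: volume_hproj_le => //.
    by apply: ccvx_minkowski => //; exact: ccvx_zono.
  by apply: sub_minkowski; exact: zono_wf0.
by lra.
Qed.

(** A segment $[-av,av]$ is added to $C+B$ and to $C$, where $C$ is the partial sum reached so far;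
    the two gains differ by $2a$ times the effect of $B$ on the projection of $C$ along $v$. As $C$
    stays inside [W], this effect is at most [g]. In the application [B] is a small ball and [g] is
    about its radius times the largest surface area of a projection. *)
Lemma volume_zono_diff A B W s (g : R) : ccvx A -> ccvx B -> ccvx W ->
  zono_wf s -> minkowski_sum A (zono s) `<=` W ->
  (forall p (C : set 'rV[R]_m), p \in s -> ccvx C -> C 0 -> C `<=` hproj p.2 W ->
    volume (minkowski_sum C (hproj p.2 B)) - volume C <= g) -> A 0 ->
  (volume (minkowski_sum (minkowski_sum A B) (zono s)) - volume (minkowski_sum A B)) -
  (volume (minkowski_sum A (zono s)) - volume A) <= 2 * zlen s * g.
Proof.
move=> cA cB cW; elim: s => [_ _ _ _|p s IH wf AW H A0].
  by rewrite /zlen big_nil mulr0 mul0r /= !minkowski0 !subrr.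
have [p0 ps wfs] := zono_wf_cons wf.
have cZ : ccvx (minkowski_sum A (zono s)) by apply: ccvx_minkowski => //; exact: ccvx_zono.
have ZW : minkowski_sum A (zono s) `<=` W.
  apply: subset_trans AW => /=; rewrite minkowskiA; apply: sub_minkowski.
  exact: seg_sym0.
rewrite !volume_zono_cons//; last exact: ccvx_minkowski.
have E : minkowski_sum (minkowski_sum A B) (zono s) = minkowski_sum (minkowski_sum A (zono s)) B.
  by rewrite -!minkowskiA; congr minkowski_sum; exact: minkowskiC.
have := H p (hproj p.2 (minkowski_sum A (zono s))) (mem_head _ _) (ccvx_hproj _ cZ).
rewrite -hproj_minkowski -E => H1.
have {}H1 := H1 _ (hprojS ZW).
have {}IH := IH wfs ZW (fun q (C' : set 'rV[R]_m) qs => H q C' (@mem_behead _ (p :: s) q qs)) A0.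
have h0 : hproj p.2 (minkowski_sum A (zono s)) 0.
  exists 0; last by rewrite mul0mx.
  by exists 0 => //; exists 0; rewrite ?addr0//; exact: zono_wf0.
move: IH; rewrite /zlen big_cons; have := ler_wpM2l p0 (H1 h0); lra.
Qed.

End zonotope_volume.

(** * Volume of a zonotope and determinant *)

Section zonotope_det.
Context (R : realType).

Definition zmx n (s : seq (R * 'rV[R]_n)) : 'M[R]_n :=
  \sum_(p <- s) p.1 *: (p.2^T *m p.2).

Lemma hproj_zono m (xi : 'rV[R]_m.+1) s :
  hproj xi (zono s) = zono [seq (p.1, p.2 *m (frm xi)^T) | p <- s].
Proof.
elim: s => [|p s IH] /=.
  by apply/seteqP; split => [_ [_ -> <-]|_ ->]; [rewrite mul0mx|exists 0; rewrite ?mul0mx].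
rewrite hproj_minkowski IH; congr minkowski_sum.
apply/seteqP; split => [_ [_ [r hr <-] <-]|_ [r hr <-]].
  by exists r => //; rewrite scalemxAl.
by exists (r *: p.2); [exists r|rewrite scalemxAl].
Qed.

Lemma zmx_hproj m (xi : 'rV[R]_m.+1) s :
  zmx [seq (p.1, p.2 *m (frm xi)^T) | p <- s] = frm xi *m zmx s *m (frm xi)^T.
Proof.
rewrite /zmx big_map mulmx_sumr mulmx_suml; apply: eq_bigr => p _ /=.
by rewrite -scalemxAr -scalemxAl trmx_mul trmxK !mulmxA.
Qed.

Lemma volume_dim0 (A : set 'rV[R]_0) : A 0 -> volume A = 1.
Proof.
move=> A0; rewrite /volume (_ : lebesgue_rV A = @dirac _ _ (0 : 'rV[R]_0) R A); last by [].
by rewrite diracE mem_set.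
Qed.

(** Induction on the dimension, then on the number of segments. A segment with vector of norm $r$
    adds $ar^2$ times the determinant of the projected zonotope on the left and $2ar$ times its
    volume on the right, and $r\le1$. Projected vectors are no longer unit, hence the condition
    [enorm p.2 <= 1]. *)
Lemma volume_zono_det n (s : seq (R * 'rV[R]_n)) :
  (forall p, p \in s -> 0 <= p.1 /\ enorm p.2 <= 1) ->
  2 ^+ n * \det (zmx s) <= volume (zono s).
Proof.
elim: n s => [|m IHm] s.
  by move=> wf; rewrite det_mx00 expr0 mulr1 volume_dim0//; apply: zono0 => p /wf[].
elim: s => [|p s IHs] wf.
  by rewrite /zmx big_nil det0 mulr0 volume_ge0.
have [p0 ps] := wf p (mem_head _ _).
have wfs q : q \in s -> 0 <= q.1 /\ enorm q.2 <= 1.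
  by move=> qs; apply: wf; rewrite in_cons qs orbT.
have {}IHs := IHs wfs.
rewrite /zmx big_cons -/(zmx s) addrC.
have [pe|pe] := eqVneq p.2 0.
  rewrite pe mulmx0 scaler0 addr0; apply: (le_trans IHs) => /=.
  apply: volume_le; [by case: (ccvx_zono s)|by case: (ccvx_zono (p :: s))|].
  by apply: sub_minkowski; exact: seg_sym0.
have e0 := enorm_gt0 pe.
have [xi [xi1 pE]] : exists xi, sphere xi /\ p.2 = enorm p.2 *: xi.
  exists ((enorm p.2)^-1 *: p.2); split; first exact: sphere_normalize.
  by rewrite scalerA mulfV ?scale1r// gt_eqF.
set r := enorm p.2 in e0 pE ps.
have -> : p.1 *: (p.2^T *m p.2) = (p.1 * r ^+ 2) *: (xi^T *m xi).
  by rewrite pE; apply/matrixP => i j; rewrite !mxE !big_ord1 !mxE; ring.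
rewrite det_rank1_update// -zmx_hproj mulrDr.
have -> : volume (zono (p :: s)) = volume (zono s) + 2 * p.1 * r * volume (hproj xi (zono s)).
  rewrite /= (_ : seg _ _ _ = seg (- (p.1 * r)) (p.1 * r) xi).
    rewrite volume_segment//; last 2 first.
      exact: ccvx_zono.
      by have : 0 <= p.1 * r by [rewrite mulr_ge0// ltW]; lra.
    by congr (_ + _ * _); ring.
  apply/seteqP; split => _ [a ha <-].
    exists (a * r); last by rewrite [in RHS]pE scalerA.
    by move: ha; rewrite /= !in_itv/= -mulNr !ler_pM2r.
  exists (a / r); last by rewrite [in LHS]pE scalerA divfK// gt_eqF.
  by move: ha; rewrite /= !in_itv/= ler_pdivrMr// ler_pdivlMr// mulNr.
rewrite lerD// exprS.
have := IHm [seq (q.1, q.2 *m (frm xi)^T) | q <- s].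
rewrite -hproj_zono => {}IHm.
have {}IHm : 2 ^+ m * \det (zmx [seq (p0.1, p0.2 *m (frm xi)^T) | p0 <- s]) <= volume (hproj xi (zono s)).
  apply: IHm => _ /mapP[q /wfs[q0 q1] ->] /=; split => //.
  by apply: le_trans q1; exact: enorm_hproj.
set d := \det _ in IHm *; set v := volume _ in IHm *.
have v0 : 0 <= v by exact: volume_ge0.
have : 2 * p.1 * r ^+ 2 * (2 ^+ m * d) <= 2 * p.1 * r ^+ 2 * v.
  by rewrite ler_wpM2l// !mulr_ge0// ltW.
have rv : r * v <= v by rewrite ler_piMl.
have : 2 * p.1 * r * (r * v) <= 2 * p.1 * r * v.
  by apply: ler_wpM2l => //; rewrite !mulr_ge0// ltW.
by move=> h1 h2; apply: le_trans h1; apply: le_trans (le_trans h2 _); rewrite ?expr2; lra.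
Qed.

End zonotope_det.

(** * Projection bodies as limits of zonotopes *)

Section nearest.
Context (R : realType) (n : nat) (K : set 'rV[R]_n).
Hypothesis cK : ccvx K.
Hypothesis K0 : K !=set0.
Implicit Types x y z v : 'rV[R]_n.

Lemma nearest_ex x : exists p, K p /\ forall y, K y -> enorm (x - p) <= enorm (x - y).
Proof.
have cf : {within K, continuous (fun y => enorm (x - y))}.
  apply: continuous_subspaceT => y.
  apply: (@continuous_comp _ _ _ (fun y : 'rV[R]_n => x - y)); last exact: enorm_continuous.
  rewrite (_ : (fun y => x - y) = (fun y : 'rV[R]_n => y *m (-1)%:M + x)); last first.
    by apply/funext => z; rewrite mul_mx_scalar scaleN1r addrC.
  apply: (@continuous_comp _ _ _ (fun y : 'rV[R]_n => y *m (-1)%:M)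
      (fun z : 'rV[R]_n => z + x)); first exact: mulmx_continuous.
  exact: addr_continuous.
have [p] := compact_EVT_min K0 cK.1 cf; rewrite inE => Kp pmin.
by exists p; split => // y Ky; apply: pmin; rewrite inE.
Qed.

Definition nearest x := sval (cid (nearest_ex x)).

Lemma nearest_in x : K (nearest x).
Proof. by rewrite /nearest; case: cid => p []. Qed.

Lemma nearest_le x y : K y -> enorm (x - nearest x) <= enorm (x - y).
Proof. by move=> Ky; rewrite /nearest; case: cid => p [Kp] /= H; exact: H. Qed.

Lemma nearest_obtuse x y : K y -> dot (x - nearest x) (y - nearest x) <= 0.
Proof.
move=> Ky; rewrite leNgt; apply/negP.
set p := nearest x; set c := dot _ _ => c0.
set N := dot (y - p) (y - p); have N0 : 0 <= N by exact: dot_ge0.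
have cN : 0 < c + N by lra.
(* Moving from [p] towards [y] by the fraction [t] changes the squared distance by $t(tN-2c)$. This
   [t] is at most 1, makes sense also for $N=0$, and satisfies $tN<2c$: a point closer than [p]
   would result. *)
pose t := c / (c + N).
have t0 : 0 < t by rewrite divr_gt0.
have t1 : t <= 1 by rewrite ler_pdivrMr// mul1r; lra.
have := @nearest_le x _ (cK.2 y p t Ky (nearest_in x) (ltW t0) t1).
rewrite -/p -ler_sqr ?nnegrE ?enorm_ge0// !sqr_enorm.
have -> : x - (t *: y + (1 - t) *: p) = (x - p) - t *: (y - p).
  by apply/rowP => i; rewrite !mxE; ring.
have E a b : dot (a - t *: b) (a - t *: b) = dot a a - 2 * t * dot a b + t ^+ 2 * dot b b.
  by rewrite dotBl !dotBr !dotZl !dotZr (dotC b a); ring.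
rewrite E -/c -/N => H.
have : t * (2 * c) <= t * (t * N) by move: H; lra.
rewrite ler_pM2l// => H'.
have H2 : (c + N) * (2 * c) <= (c + N) * (t * N) by rewrite ler_pM2l.
have ct : (c + N) * t = c by rewrite mulrC divfK ?gt_eqF.
move: H2; rewrite [X in _ <= X]mulrA ct => H2.
by nra.
Qed.

(** Adding the two obtuse angle inequalities gives $|p-q|^2\le\langle x-y,p-q\rangle$; then
    Cauchy-Schwarz. *)
Lemma nearest_lip x y : enorm (nearest x - nearest y) <= enorm (x - y).
Proof.
set p := nearest x; set q := nearest y.
have h1 : dot (x - p) (q - p) <= 0 by apply: nearest_obtuse; exact: nearest_in.
have h2 : dot (y - q) (p - q) <= 0 by apply: nearest_obtuse; exact: nearest_in.
have h : enorm (p - q) ^+ 2 <= enorm (x - y) * enorm (p - q).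
  apply: le_trans (dot_le_enorm _ _); rewrite sqr_enorm.
  have -> : dot (p - q) (p - q) = dot (x - y) (p - q) - (dot (x - p) (p - q) - dot (y - q) (p - q)).
    by rewrite -!dotBl; congr dot; apply/rowP => i; rewrite !mxE; ring.
  by move: h1 h2; rewrite -[q - p]opprB dotNr; lra.
have [e0|e0] := eqVneq (enorm (p - q)) 0; first by rewrite e0 enorm_ge0.
have ep : 0 < enorm (p - q) by rewrite lt_neqAle eq_sym e0 enorm_ge0.
by rewrite -(ler_pM2r ep) -expr2.
Qed.

(** The normal is the direction from the nearest point of [K] to [x]; the obtuse angle inequality
    says that this point maximizes it on [K]. *)
Lemma separation x : ~ K x -> exists2 theta, sphere theta &
  exists2 p, K p & (forall y, K y -> dot y theta <= dot p theta) /\ dot p theta < dot x theta.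
Proof.
move=> Kx; set p := nearest x.
have xp : x - p != 0.
  by apply/eqP => /eqP; rewrite subr_eq0 => /eqP xp; apply: Kx; rewrite xp; exact: nearest_in.
have e0 := enorm_gt0 xp.
exists ((enorm (x - p))^-1 *: (x - p)); first exact: sphere_normalize.
exists p; first exact: nearest_in.
split.
  move=> y Ky; rewrite !dotZr ler_pM2l ?invr_gt0// -subr_le0 -dotBl dotC.
  exact: nearest_obtuse.
rewrite !dotZr ltr_pM2l ?invr_gt0// -subr_gt0 -dotBl -sqr_enorm.
by rewrite exprn_gt0.
Qed.

Definition dist2 x := dot (x - nearest x) (x - nearest x).

Lemma dist2_ge0 x : 0 <= dist2 x. Proof. exact: dot_ge0. Qed.

(** Upper bound: [p] is a competitor for the point [x + v]. Lower bound: [q] is a competitor for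
    [x], and going back from [q] to [p] costs $2\langle q-p,v\rangle\le2|v|^2$ because [nearest] is
    1-Lipschitz. *)
Lemma dist2_expand x v :
  `|dist2 (x + v) - dist2 x - 2 * dot (x - nearest x) v| <= enorm v ^+ 2.
Proof.
set p := nearest x; set q := nearest (x + v).
have h1 : dist2 (x + v) <= dot (x + v - p) (x + v - p).
  rewrite /dist2 -!sqr_enorm ler_sqr ?nnegrE ?enorm_ge0//.
  by apply: nearest_le; exact: nearest_in.
have h2 : dist2 x <= dot (x - q) (x - q).
  rewrite /dist2 -!sqr_enorm ler_sqr ?nnegrE ?enorm_ge0//.
  by apply: nearest_le; exact: nearest_in.
have h3 : dot (q - p) v <= enorm v ^+ 2.
  apply: (le_trans (dot_le_enorm _ _)).
  by rewrite expr2 ler_wpM2r ?enorm_ge0// (le_trans (nearest_lip _ _))// addrAC subrr add0r.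
have sq (a b : 'rV[R]_n) : dot (a + b) (a + b) = dot a a + 2 * dot a b + dot b b.
  by rewrite dotDl !dotDr (dotC b a); ring.
have e1 : dot (x + v - p) (x + v - p) = dist2 x + 2 * dot (x - p) v + enorm v ^+ 2.
  by rewrite addrAC sq sqr_enorm.
have e2 : dot (x - q) (x - q) = dist2 (x + v) - 2 * dot (x - p) v + 2 * dot (q - p) v - enorm v ^+ 2.
  have -> : x - q = (x + v - q) + - v by rewrite addrAC addrK.
  rewrite sq dotNr dotNl dotNr opprK -/(dist2 (x + v)) sqr_enorm.
  have -> : dot (x + v - q) v = dot (x - p) v - dot (q - p) v + dot v v.
    by rewrite -dotBl -dotDl; congr dot; apply/rowP => i; rewrite !mxE; ring.
  by ring.
rewrite ler_norml; apply/andP; split; lra.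
Qed.

Lemma nearest_continuous : continuous nearest.
Proof.
move=> x; apply/(@cvgrPdist_le _ _ _ (nbhs x)) => e e0.
have e0' : 0 < e / n.+1%:R by rewrite divr_gt0.
near=> y.
apply: (le_trans (norm_le_enorm _)); apply: (le_trans (nearest_lip _ _)).
apply: (le_trans (enorm_le_norm _)).
apply: (@le_trans _ _ (n.+1%:R * (e / n.+1%:R))); last by rewrite mulrC divfK.
by rewrite ler_pM ?ler0n// ?ler_nat//; near: y; apply: cvgr_dist_le.
Unshelve. all: by end_near. Qed.

Lemma dist2_le x (c : R) : 0 <= c -> dist2 x <= c ^+ 2 <-> minkowski_sum K (@cball R n c) x.
Proof.
move=> c0; rewrite /dist2 -sqr_enorm ler_sqr ?nnegrE ?enorm_ge0//; split.
  move=> h; exists (nearest x); first exact: nearest_in.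
  by exists (x - nearest x) => //; rewrite addrC subrK.
move=> [y Ky [z zc <-]]; apply: (le_trans (nearest_le _ Ky)).
by rewrite addrC addKr.
Qed.

End nearest.

(** * A smooth cut-off function of the distance to [K] *)

Section bump_fun.
Context (R : realType) (n : nat) (K : set 'rV[R]_n).
Hypothesis cK : ccvx K.
Hypothesis K0 : K !=set0.
Variable kap : R.
Hypothesis kap0 : 0 < kap.
Implicit Types x y z v : 'rV[R]_n.

Let d2 := dist2 cK K0.

(* The square of the distance to K has gradient 2 (x - nearest x) and is C^{1,1}
   with no regularity assumption on K, hence so is bump_fun. *)
Definition bump_a x : R := Num.max 0 (kap ^+ 2 - d2 x).

(** Squaring smooths the positive part where it vanishes, and [kap ^+ 4] normalizes the value on [K]
    to 1. The superlevel sets are the parallel bodies of [K]. *)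
Definition bump_fun x : R := bump_a x ^+ 2 / kap ^+ 4.

Definition bump_grad x : 'rV[R]_n :=
  (- (4 * bump_a x / kap ^+ 4)) *: (x - nearest cK K0 x).

Lemma bump_a_ge0 x : 0 <= bump_a x. Proof. by rewrite le_max lexx. Qed.

Lemma bump_a_le x : bump_a x <= kap ^+ 2.
Proof.
by rewrite ge_max sqr_ge0/=; have := dist2_ge0 cK K0 x; rewrite -/d2; lra.
Qed.

Lemma bump_ge0 x : 0 <= bump_fun x.
Proof. by rewrite divr_ge0// ?sqr_ge0// exprn_ge0// ltW. Qed.

Lemma bump_le1 x : bump_fun x <= 1.
Proof.
rewrite ler_pdivrMr ?exprn_gt0// mul1r (_ : kap ^+ 4 = (kap ^+ 2) ^+ 2); last by ring.
by rewrite ler_sqr ?nnegrE ?bump_a_ge0 ?sqr_ge0// bump_a_le.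
Qed.

Lemma bump_expand (r : R) : 0 < r -> exists2 C : R, 0 <= C &
  forall x v, d2 x <= r ^+ 2 -> enorm v <= 1 ->
  `|bump_fun (x + v) - bump_fun x - dot (bump_grad x) v| <= C * enorm v ^+ 2.
Proof.
(* The part $2\kappa^2$ bounds $2a|e|/|v|^2$, by $a\le\kappa^2$; the part $(2r+1)^2$ bounds
   $D^2/|v|^2$, by $|D|\le2r|v|+|v|^2$ and $|v|\le1$. *)
move=> r0; exists ((2 * kap ^+ 2 + (2 * r + 1) ^+ 2) / kap ^+ 4).
  apply: divr_ge0; last by rewrite exprn_ge0// ltW.
  apply: addr_ge0; last exact: sqr_ge0.
  by apply: mulr_ge0 => //; exact: sqr_ge0.
move=> x v xr v1.
have k40 : 0 < kap ^+ 4 by rewrite exprn_gt0.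
have := dist2_expand cK K0 x v; rewrite -/d2.
set e := (X in `|X|) => he.
set p := dot (x - nearest cK K0 x) v.
have hp : `|p| <= r * enorm v.
  apply: (le_trans (normr_dot_le _ _)); rewrite ler_wpM2r ?enorm_ge0//.
  by rewrite -ler_sqr ?nnegrE ?enorm_ge0 ?(ltW r0)// sqr_enorm.
pose a := bump_a x; pose a' := bump_a (x + v).
pose D := - 2 * p - e.
(* [D] is the exact increment of $\kappa^2-d^2$, with $d$ the distance to [K], and
   $b\mapsto\max(0,b)^2$ is convex with second derivative at most 2. *)
have h1 : 0 <= a' ^+ 2 - a ^+ 2 - 2 * a * D <= D ^+ 2.
  rewrite /a' /a /bump_a.
  have -> : kap ^+ 2 - d2 (x + v) = (kap ^+ 2 - d2 x) + D by rewrite /D /e /p; ring.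
  set b := kap ^+ 2 - d2 x.
  by case: (leP 0 b) => hb; case: (leP 0 (b + D)) => hbD; apply/andP; split; nra.
have a0 : 0 <= a := bump_a_ge0 x.
have ak : a <= kap ^+ 2 := bump_a_le x.
have E : bump_fun (x + v) - bump_fun x - dot (bump_grad x) v =
  ((a' ^+ 2 - a ^+ 2 - 2 * a * D) - 2 * a * e) / kap ^+ 4.
  rewrite /bump_fun /bump_grad dotZl -/a -/a' -/p /D; field; rewrite gt_eqF//.
rewrite E normrM [X in _ * X]gtr0_norm ?invr_gt0// [leRHS]mulrAC ler_pM2r ?invr_gt0//.
apply: (le_trans (ler_normB _ _)); rewrite [leRHS]mulrDl [leLHS]addrC lerD//.
  rewrite normrM ger0_norm ?mulr_ge0//.
  apply: (@le_trans _ _ (2 * a * enorm v ^+ 2)); first by rewrite ler_wpM2l ?mulr_ge0.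
  by rewrite ler_wpM2r ?sqr_ge0// ler_wpM2l.
rewrite ger0_norm; last by case/andP: h1.
apply: (@le_trans _ _ (D ^+ 2)); first by case/andP: h1.
rewrite -exprMn -[leLHS]ger0_norm ?sqr_ge0// normrX ler_sqr ?nnegrE ?normr_ge0//; last first.
  by rewrite mulr_ge0 ?enorm_ge0// ltW// addr_gt0// mulr_gt0.
apply: (le_trans (ler_normB _ _)); rewrite mulNr normrN normrM ger0_norm// [leRHS]mulrDl mul1r lerD//.
  by rewrite -mulrA ler_wpM2l.
apply: (le_trans he); rewrite expr2 -[leRHS]mul1r ler_wpM2r// enorm_ge0//.
Qed.

End bump_fun.

(** * A convex body and its translates *)

Section tshift.
Context (R : realType) (m : nat).
Implicit Types (xi : 'rV[R]_m.+1) (A B C M : set 'rV[R]_m.+1).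

Definition tshift (a : 'rV[R]_m.+1) A : set 'rV[R]_m.+1 := [set x | A (x + a)].

Lemma measurable_tshift a A : measurable A -> measurable (tshift a A).
Proof.
move=> mA; rewrite -[X in measurable X]setTI.
by apply: (continuous_measurable_rV_rV (@addr_continuous R _ a)).
Qed.

Lemma slice_tshift xi C t y : slice xi (tshift (t *: xi) C) y = [set s | slice xi C y (s + t)].
Proof.
by apply/seteqP; split => s; rewrite /slice /tshift/= scalerDl addrAC.
Qed.

Lemma lebesgue_le_slice xi C A (t : R) : sphere xi -> compact C -> measurable A -> 0 <= t ->
  (forall y, hproj xi C y -> (lebesgue_measure (slice xi A y) <= t%:E)%E) ->
  (forall y, ~ hproj xi C y -> slice xi A y = set0) ->
  (lebesgue_rV A <= (t * volume (hproj xi C))%:E)%E.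
Proof.
move=> xi1 cC mA t0 H1 H2.
have cP : compact (hproj xi C) by apply: compact_image cC; exact: mulmx_continuous.
have mP := compact_measurable_rV cP.
have [mS ->] := lebesgue_rV_slice xi1 mA.
apply: (@le_trans _ _ (\int[@lebesgue_rV R m]_y (t%:E * (\1_(hproj xi C) y)%:E))%E).
  apply: ge0_le_integral => //.
    by apply: measurable_funeM; apply/measurable_EFinP; exact: measurable_indic.
  move=> y _; rewrite indicE.
  have [yP|yP] := boolP (y \in _).
    by rewrite mule1; apply: H1; rewrite inE in yP.
  by rewrite mule0 H2 ?measure0//; move: yP; rewrite notin_setE.
rewrite ge0_integralZl//; last by apply/measurable_EFinP; exact: measurable_indic.
rewrite integral_indic// setIT EFinM /volume fineK//.
exact: compact_lebesgue_rV_fin.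
Qed.

Lemma lebesgue_ge_slice xi C A (t : R) : sphere xi -> compact C -> measurable A -> 0 <= t ->
  (forall y, hproj xi C y -> (t%:E <= lebesgue_measure (slice xi A y))%E) ->
  ((t * volume (hproj xi C))%:E <= lebesgue_rV A)%E.
Proof.
move=> xi1 cC mA t0 H1.
have cP : compact (hproj xi C) by apply: compact_image cC; exact: mulmx_continuous.
have mP := compact_measurable_rV cP.
have [mS ->] := lebesgue_rV_slice xi1 mA.
apply: (@le_trans _ _ (\int[@lebesgue_rV R m]_y (t%:E * (\1_(hproj xi C) y)%:E))%E); last first.
  apply: ge0_le_integral => //.
    by move=> y _; rewrite indicE mule_ge0// lee_fin.
    by apply: measurable_funeM; apply/measurable_EFinP; exact: measurable_indic.
  move=> y _; rewrite indicE.
  have [yP|yP] := boolP (y \in _); last by rewrite mule0.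
  by rewrite mule1; apply: H1; rewrite inE in yP.
rewrite ge0_integralZl//; last by apply/measurable_EFinP; exact: measurable_indic.
rewrite integral_indic// setIT EFinM /volume fineK//.
exact: compact_lebesgue_rV_fin.
Qed.

(** The translate has chord $[p-t,q-t]$ where [C] has $[p,q]$: what is lost lies in $[q-t,q]$ and
    what is gained in $[p-t,p]$. *)
Lemma lebesgue_tshift_diff_le xi C (t : R) : sphere xi -> ccvx C -> 0 <= t ->
  (lebesgue_rV (C `\` tshift (t *: xi) C) <= (t * volume (hproj xi C))%:E)%E /\
  (lebesgue_rV (tshift (t *: xi) C `\` C) <= (t * volume (hproj xi C))%:E)%E.
Proof.
move=> xi1 cC t0.
have mC := compact_measurable_rV cC.1.
have mS := measurable_tshift (t *: xi) mC.
have Sl A y : slice xi (A `\` tshift (t *: xi) C) y = slice xi A y `\` [set s | slice xi C y (s + t)].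
  by rewrite -slice_tshift.
split; apply: (lebesgue_le_slice xi1 cC.1) => //; first exact: measurableD.
- move=> y /(slice_itv xi1 cC)[p [q [pq E]]].
  rewrite Sl E; apply: (@le_trans _ _ (lebesgue_measure `[(q - t), q]%classic)).
    apply: le_outer_measure => s [/=]; rewrite !in_itv/= => /andP[h1 h2] h3.
    rewrite h2 andbT leNgt; apply/negP => h4; apply: h3.
    by apply/andP; split; lra.
  by rewrite lebesgue_measure_itv/=; case: ifPn => _; rewrite ?lee_fin//; lra.
- move=> y Py; apply/seteqP; split => // s [Cs _]; apply: Py.
  by apply/(hproj_slice _ _ xi1); exists s.
- exact: measurableD.
- move=> y /(slice_itv xi1 cC)[p [q [pq E]]].
  have -> : slice xi (tshift (t *: xi) C `\` C) y = [set s | slice xi C y (s + t)] `\` slice xi C y.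
    by rewrite -slice_tshift.
  rewrite E; apply: (@le_trans _ _ (lebesgue_measure `[(p - t), p]%classic)).
    apply: le_outer_measure => s [/=]; rewrite !in_itv/= => /andP[h1 h2] h3.
    apply/andP; split; first by lra.
    rewrite leNgt; apply/negP => h4; apply: h3.
    by apply/andP; split; lra.
  by rewrite lebesgue_measure_itv/=; case: ifPn => _; rewrite ?lee_fin//; lra.
- move=> y Py; apply/seteqP; split => // s [Cs _]; apply: Py.
  by apply/(hproj_slice _ _ xi1); exists (s + t); move: Cs; rewrite /slice /tshift/= scalerDl addrAC.
Qed.

Lemma slice_cball xi M (c s a : R) y : sphere xi -> slice xi M y s -> `|a| <= c ->
  slice xi (minkowski_sum M (cball c)) y (s + a).
Proof.
move=> xi1 Ms ac; exists (s *: xi + y *m frm xi) => //; exists (a *: xi).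
  by rewrite /cball/= enormZ xi1 mulr1.
by rewrite scalerDl addrAC.
Qed.

(** Over the projection of [M] the chords of [C] have length at least $2c\ge t$, so a shift by [t]
    loses a full interval of length [t] at one end and gains one at the other. *)
Lemma lebesgue_tshift_diff_ge xi M (c t : R) : sphere xi -> ccvx M -> 0 <= t -> t <= 2 * c ->
  let C := minkowski_sum M (cball c) in
  ((t * volume (hproj xi M))%:E <= lebesgue_rV (C `\` tshift (t *: xi) C))%E /\
  ((t * volume (hproj xi M))%:E <= lebesgue_rV (tshift (t *: xi) C `\` C))%E.
Proof.
move=> xi1 cM t0 tc C.
have c0 : 0 <= c by lra.
have cC : ccvx C by apply: ccvx_minkowski => //; exact: ccvx_cball.
have mC := compact_measurable_rV cC.1.
have mS := measurable_tshift (t *: xi) mC.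
have MC : M `<=` C by apply: sub_minkowski; exact: cball0.
have H y : hproj xi M y -> exists p q, t <= q - p /\ slice xi C y = `[p, q]%classic.
  move=> My; have [p [q [pq E]]] := slice_itv xi1 cC (hprojS MC My).
  exists p, q; split => //.
  have [s Ms] : slice xi M y !=set0 by apply/hproj_slice.
  have h1 : slice xi C y (s + c) by apply: slice_cball => //; rewrite ger0_norm.
  have h2 : slice xi C y (s + - c) by apply: slice_cball => //; rewrite normrN ger0_norm.
  by move: h1 h2; rewrite E/= !in_itv/= => /andP[h1 h2] /andP[h3 h4]; lra.
split; apply: (lebesgue_ge_slice xi1 cM.1) => //; first exact: measurableD.
- move=> y /H[p [q [pq E]]].
  have -> : slice xi (C `\` tshift (t *: xi) C) y = slice xi C y `\` [set s | slice xi C y (s + t)].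
    by rewrite -slice_tshift.
  rewrite E; apply: (@le_trans _ _ (lebesgue_measure `](q - t), q]%classic)).
    rewrite lebesgue_measure_itv/=; case: ifPn => h; last first.
      by rewrite lte_fin -leNgt in h; rewrite lee_fin; lra.
    by rewrite -EFinB lee_fin; lra.
  apply: le_outer_measure => s /=; rewrite !in_itv/= => /andP[h1 h2]; split.
    by apply/andP; split; lra.
  by move=> /andP[h3 h4]; lra.
- exact: measurableD.
- move=> y /H[p [q [pq E]]].
  have -> : slice xi (tshift (t *: xi) C `\` C) y = [set s | slice xi C y (s + t)] `\` slice xi C y.
    by rewrite -slice_tshift.
  rewrite E; apply: (@le_trans _ _ (lebesgue_measure `[(p - t), p[%classic)).
    rewrite lebesgue_measure_itv/=; case: ifPn => h; last first.
      by rewrite lte_fin -leNgt in h; rewrite lee_fin; lra.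
    by rewrite -EFinB lee_fin; lra.
  apply: le_outer_measure => s /=; rewrite !in_itv/= => /andP[h1 h2]; split.
    by apply/andP; split; lra.
  by move=> /andP[h3 h4]; lra.
Qed.

End tshift.

Section layer_cake.
Context (R : realType) (n : nat).
Variables (f g : 'rV[R]_n -> R).
Hypotheses (mf : measurable_fun setT (f : _ -> measurableTypeR R))
           (mg : measurable_fun setT (g : _ -> measurableTypeR R)).

(** The symmetric difference of the superlevel sets of [f] and [g] at level [l]. *)
Definition layer (l : R) : set 'rV[R]_n :=
  [set x | f x < l <= g x] `|` [set x | g x < l <= f x].

(** At a given [x] the levels between [f x] and [g x] form an interval of length [|f x - g x|];
    Tonelli's theorem exchanges points and levels. *)
Lemma layer_cake :
  measurable_fun [set: measurableTypeR R] (fun l => lebesgue_rV (layer l)) /\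
  (\int[@lebesgue_rV R n]_x (`|f x - g x|)%:E =
   \int[@lebesgue_measure R]_l lebesgue_rV (layer l))%E.
Proof.
have mlt (h : 'rV[R]_n -> R) : measurable_fun setT (h : _ -> measurableTypeR R) ->
    measurable [set p : 'rV[R]_n * measurableTypeR R | h p.1 < p.2].
  move=> mh; pose d := fun p : 'rV[R]_n * measurableTypeR R => (p.2 : R) - h p.1.
  have md : measurable_fun setT (d : _ -> measurableTypeR R).
    apply: measurable_funB; first exact: measurable_snd.
    exact: (measurableT_comp mh measurable_fst).
  rewrite (_ : mkset _ = setT `&` d @^-1` `]0, +oo[%classic); first exact: md.
  by rewrite setTI; apply/seteqP; split => p /=; rewrite /d in_itv/= andbT subr_gt0.
pose T : set ('rV[R]_n * measurableTypeR R) :=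
  [set p | f p.1 < p.2 <= g p.1] `|` [set p | g p.1 < p.2 <= f p.1].
have mT : measurable T.
  have H h k : measurable_fun setT (h : 'rV[R]_n -> measurableTypeR R) ->
     measurable_fun setT (k : 'rV[R]_n -> measurableTypeR R) ->
     measurable [set p : 'rV[R]_n * measurableTypeR R | (h p.1 : R) < p.2 <= k p.1].
    move=> mh mk; rewrite (_ : mkset _ = [set p | h p.1 < p.2] `&` ~` [set p | k p.1 < p.2]).
      by apply: measurableI; [exact: mlt|apply: measurableC; exact: mlt].
    apply/seteqP; split => p /=; first by move=> /andP[-> h2]; split => //; rewrite ltNge h2.
    by move=> [-> h2]; rewrite leNgt; apply/negP.
  by apply: measurableU; exact: H.
have E l : ysection T l = layer l.
  by apply/seteqP; split => x; rewrite /ysection /layer/= inE.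
have {}E : ysection T = layer by apply/funext.
have mY := measurable_fun_ysection (@lebesgue_rV R n) mT.
rewrite -E; split; first exact: mY.
have := indic_fubini_tonelli (@lebesgue_rV R n) (@lebesgue_measure R) mT.
rewrite indic_fubini_tonelli_FE// indic_fubini_tonelli_GE// => <-.
apply: eq_integral => x _ /=.
have [fg|gf] := leP (f x) (g x).
  have -> : `|f x - g x| = g x - f x by rewrite distrC ger0_norm ?subr_ge0.
  rewrite (_ : xsection T x = `]f x, g x]%classic).
    rewrite lebesgue_measure_itv/= lte_fin; case: ltP => h; rewrite -?EFinB; congr EFin; lra.
  apply/seteqP; split => l; rewrite /xsection/= inE in_itv/= /T/=.
    by move=> [//|/andP[h1 h2]]; lra.
  by left.
have -> : `|f x - g x| = f x - g x by rewrite gtr0_norm ?subr_gt0.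
rewrite (_ : xsection T x = `]g x, f x]%classic).
  rewrite lebesgue_measure_itv/= lte_fin gf -EFinB; congr EFin; lra.
apply/seteqP; split => l; rewrite /xsection/= inE in_itv/= /T/=.
  by move=> [/andP[h1 h2]|//]; lra.
by right.
Qed.

End layer_cake.

Section bump_integral.
Context (R : realType) (m : nat) (K : set 'rV[R]_m.+1).
Hypothesis cK : ccvx K.
Hypothesis K0 : K !=set0.
Variable kap : R.
Hypothesis kap0 : 0 < kap.
Implicit Types x y z v : 'rV[R]_m.+1.

Let F := bump_fun cK K0 kap.
Let w := bump_grad cK K0 kap.

(** The function decreases with the distance $c$ to [K] and takes the value $l$ when
    $(\kappa^2-c^2)^2=l\kappa^4$. *)
Lemma bump_level (l : R) : 0 < l -> l <= 1 -> exists c : R,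
  [/\ 0 <= c, c <= kap, c ^+ 2 = kap ^+ 2 * (1 - Num.sqrt l) &
   [set x | l <= F x] = minkowski_sum K (cball c)].
Proof.
move=> l0 l1.
have s1 : Num.sqrt l <= 1 by rewrite -sqrtr1 ler_wsqrtr.
have s0 : 0 < Num.sqrt l by rewrite sqrtr_gt0.
have k2 : 0 < kap ^+ 2 by rewrite exprn_gt0.
have q0 : 0 <= kap ^+ 2 * (1 - Num.sqrt l) by rewrite mulr_ge0 ?sqr_ge0// subr_ge0.
exists (Num.sqrt (kap ^+ 2 * (1 - Num.sqrt l))); split.
- exact: sqrtr_ge0.
- rewrite -[leRHS]gtr0_norm// -sqrtr_sqr ler_wsqrtr//.
  by rewrite -[leRHS]mulr1 ler_wpM2l ?sqr_ge0//; lra.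
- by rewrite sqr_sqrtr.
have E x : (l <= F x) = (dist2 cK K0 x <= kap ^+ 2 * (1 - Num.sqrt l)).
  rewrite /F /bump_fun ler_pdivlMr ?exprn_gt0//.
  rewrite (_ : l * kap ^+ 4 = (Num.sqrt l * kap ^+ 2) ^+ 2); last first.
    by rewrite exprMn sqr_sqrtr ?ltW//; ring.
  have h : 0 <= Num.sqrt l * kap ^+ 2 by rewrite mulr_ge0// ltW.
  rewrite ler_sqr ?nnegrE ?bump_a_ge0//.
  rewrite /bump_a le_max [_ * _ <= 0]leNgt mulr_gt0//=.
  by apply/idP/idP; lra.
apply/seteqP; split => x; rewrite /= E => h.
  by apply/(dist2_le cK K0) => //; rewrite ?sqr_sqrtr// sqrtr_ge0.
by have := (dist2_le cK K0 x (sqrtr_ge0 _)).2 h; rewrite sqr_sqrtr.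
Qed.

Lemma sub_nearest_continuous : continuous (fun x => x - nearest cK K0 x).
Proof.
apply: continuous_mxP => i j; under eq_fun do rewrite !mxE.
move=> x; apply: (@cvgB R R^o _ (nbhs x)); first exact: coord_continuous.
apply: (@continuous_comp _ _ _ (nearest cK K0) (fun y : 'rV[R]_m.+1 => y i j)).
  exact: nearest_continuous.
exact: coord_continuous.
Qed.

Lemma measurable_bump_a :
  measurable_fun setT (bump_a cK K0 kap : _ -> measurableTypeR R).
Proof.
apply: measurable_maxr => //; apply: measurable_funB => //.
rewrite (_ : dist2 cK K0 = (fun x => enorm (x - nearest cK K0 x) ^+ 2)); last first.
  by apply/funext => x; rewrite sqr_enorm.
apply: measurable_funX; apply: continuous_measurable_rV => x.
apply: (@continuous_comp _ _ _ (fun x => x - nearest cK K0 x) (@enorm R _)).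
  exact: sub_nearest_continuous.
exact: enorm_continuous.
Qed.

Lemma measurable_bump : measurable_fun setT (F : _ -> measurableTypeR R).
Proof. by apply: measurable_funM => //; apply: measurable_funX; exact: measurable_bump_a. Qed.

Lemma measurable_bump_grad_coord i :
  measurable_fun setT ((fun x => w x ord0 i) : _ -> measurableTypeR R).
Proof.
under eq_fun do rewrite mxE.
apply: measurable_funM.
  apply: measurable_funN; apply: measurable_funM => //.
  by apply: measurable_funM => //; exact: measurable_bump_a.
apply: continuous_measurable_rV => x.
apply: (@continuous_comp _ _ _ (fun x => x - nearest cK K0 x) (fun y => y ord0 i)).
  exact: sub_nearest_continuous.
exact: coord_continuous.
Qed.

Lemma measurable_dot_bump_grad theta :
  measurable_fun setT ((fun x => dot (w x) theta) : _ -> measurableTypeR R).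
Proof.
under eq_fun do rewrite dotE.
apply: measurable_sum => i; apply: measurable_funM => //.
exact: measurable_bump_grad_coord.
Qed.

Section variation.
Variables (theta : 'rV[R]_m.+1) (t : R).
Hypotheses (theta1 : sphere theta) (t0 : 0 < t).

Let Ft x := F (x + t *: theta).

Lemma measurable_bump_shift : measurable_fun setT (Ft : _ -> measurableTypeR R).
Proof.
apply: (measurableT_comp measurable_bump).
by apply: continuous_measurable_rV_rV; exact: addr_continuous.
Qed.

Lemma bump_layerE l : 0 < l -> l <= 1 -> exists2 c : R,
  [/\ 0 <= c, c <= kap & c ^+ 2 = kap ^+ 2 * (1 - Num.sqrt l)] &
  let C := minkowski_sum K (cball c) in
  lebesgue_rV (layer F Ft l) =
    (lebesgue_rV (tshift (t *: theta) C `\` C) + lebesgue_rV (C `\` tshift (t *: theta) C))%E.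
Proof.
move=> l0 l1; have [c [c0 ck c2 CE]] := bump_level l0 l1.
exists c => // C.
have cC : ccvx C by apply: ccvx_minkowski => //; exact: ccvx_cball.
have mC := compact_measurable_rV cC.1.
have mS := measurable_tshift (t *: theta) mC.
have Cx x : C x <-> l <= F x by rewrite /C -CE.
rewrite -measureU; [|exact: measurableD|exact: measurableD|]; last first.
  by apply/seteqP; split => // x [[h1 h2] [h3 h4]].
congr lebesgue_rV; apply/seteqP; split => x; rewrite /layer /tshift/=.
  move=> [/andP[h1 h2]|/andP[h1 h2]]; [left|right]; split; rewrite ?Cx//.
    by rewrite leNgt h1.
  by rewrite leNgt h1.
move=> [[/Cx h1 h2]|[/Cx h1 h2]]; [left|right]; apply/andP; split => //.
  by rewrite ltNge; apply/negP => /Cx.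
by rewrite ltNge; apply/negP => /Cx.
Qed.

Lemma bump_layer0 l : ~ (0 < l <= 1) -> layer F Ft l = set0.
Proof.
move=> l01; apply/seteqP; split => // x [|] /= /andP[h1 h2]; apply: l01; apply/andP; split.
- by apply: le_lt_trans h1; exact: bump_ge0.
- by apply: le_trans h2 _; exact: bump_le1.
- by apply: le_lt_trans h1; exact: bump_ge0.
- by apply: le_trans h2 _; exact: bump_le1.
Qed.

(** Only levels in $]0,1]$ count. Their superlevel sets are contained in $K+\kappa B$, and the shift
    changes each by at most [t] times its projection, once for the loss and once for the gain. *)
Lemma bump_variation_le :
  (\int[@lebesgue_rV R m.+1]_x (`|F x - Ft x|)%:E <=
   (2 * t * volume (hproj theta (minkowski_sum K (cball kap))))%:E)%E.
Proof.
have [mL ->] := layer_cake measurable_bump measurable_bump_shift.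
set V := volume _.
have V0 : 0 <= V by exact: volume_ge0.
apply: (@le_trans _ _ (\int[@lebesgue_measure R]_l ((2 * t * V)%:E * (\1_`]0, 1] l)%:E))%E).
  apply: ge0_le_integral => //.
    apply: measurable_funeM; apply/measurable_EFinP; exact: measurable_indic.
  move=> l _; rewrite indicE.
  have [l01|l01] := boolP (l \in _); last first.
    rewrite mule0 bump_layer0 ?measure0// => h; move/negP: l01; apply.
    by rewrite inE/= in_itv.
  move: l01; rewrite inE/= in_itv/= => /andP[l0 l1].
  rewrite mule1; have [c [c0 ck c2] E] := bump_layerE l0 l1.
  rewrite -[leLHS]/(lebesgue_rV (layer F Ft l)) E.
  have cC : ccvx (minkowski_sum K (@cball R m.+1 c)) by apply: ccvx_minkowski => //; exact: ccvx_cball.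
  have cCk : ccvx (minkowski_sum K (@cball R m.+1 kap)) by apply: ccvx_minkowski => //; exact: ccvx_cball.
  have [h1 h2] := lebesgue_tshift_diff_le theta1 cC (ltW t0).
  apply: (le_trans (leeD h2 h1)); rewrite -EFinD lee_fin.
  have : t * volume (hproj theta (minkowski_sum K (cball c))) <= t * V.
    apply: ler_wpM2l; first exact: ltW.
    apply: volume_hproj_le => //.
    by apply: minkowskiS => //; exact: cballS.
  lra.
rewrite ge0_integralZl//; last 2 first.
  by apply/measurable_EFinP; exact: measurable_indic.
  by rewrite lee_fin !mulr_ge0// ltW.
rewrite integral_indic// setIT [X in (_ * X)%E](_ : _ = 1%E) ?mule1//.
by apply: etrans (lebesgue_measure_itv `]0, 1]) _; rewrite /= lte_fin ltr01 oppr0 adde0.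
Qed.

Lemma bump_variation_ge : t <= 2 * kap ->
  ((2 * t * volume (hproj theta K) * (1 - t ^+ 2 / (4 * kap ^+ 2)) ^+ 2)%:E <=
   \int[@lebesgue_rV R m.+1]_x (`|F x - Ft x|)%:E)%E.
Proof.
move=> tk; have [mL ->] := layer_cake measurable_bump measurable_bump_shift.
set V := volume _.
have V0 : 0 <= V by exact: volume_ge0.
have k2 : 0 < 4 * kap ^+ 2 by rewrite mulr_gt0// exprn_gt0.
(* For $l\le(1-e)^2$ the parallel body at level $l$ has $c^2=\kappa^2(1-\sqrt l)\ge\kappa^2e=t^2/4$,
   so its chords over the projection of [K] are at least [t] long. Higher levels are bounded below
   by 0. *)
set e := t ^+ 2 / (4 * kap ^+ 2).
have e0 : 0 <= e by rewrite divr_ge0 ?sqr_ge0// ltW.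
have e1 : e <= 1.
  rewrite ler_pdivrMr// mul1r (_ : 4 * kap ^+ 2 = (2 * kap) ^+ 2); last by ring.
  by rewrite ler_sqr ?nnegrE// ?ltW// mulr_gt0.
have ee : e * (4 * kap ^+ 2) = t ^+ 2 by rewrite divfK// gt_eqF.
apply: (@le_trans _ _ (\int[@lebesgue_measure R]_l ((2 * t * V)%:E * (\1_`]0, ((1 - e) ^+ 2)] l)%:E))%E).
  rewrite ge0_integralZl//; last 2 first.
    by apply/measurable_EFinP; exact: measurable_indic.
    by rewrite lee_fin !mulr_ge0// ltW.
  rewrite integral_indic// setIT [X in (_ * X)%E](_ : _ = ((1 - e) ^+ 2)%:E) ?EFinM//.
  apply: etrans (lebesgue_measure_itv `]0, (1 - e) ^+ 2]) _; rewrite /= lte_fin.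
  case: ltP => h; first by rewrite oppr0 adde0.
  by congr EFin; apply/eqP; rewrite eq_le sqr_ge0.
apply: ge0_le_integral => //.
  by move=> l _; rewrite indicE mule_ge0// lee_fin !mulr_ge0// ltW.
  by apply: measurable_funeM; apply/measurable_EFinP; exact: measurable_indic.
move=> l _; rewrite indicE.
have [l01|l01] := boolP (l \in _); last by rewrite mule0.
move: l01; rewrite inE/= in_itv/= => /andP[l0 le].
have l1 : l <= 1 by apply: (le_trans le); rewrite expr_le1//; lra.
rewrite mule1; have [c [c0 ck c2] E] := bump_layerE l0 l1.
rewrite -[leRHS]/(lebesgue_rV (layer F Ft l)) E.
have sl : Num.sqrt l <= 1 - e.
  rewrite -[leRHS]ger0_norm; last by lra.
  by rewrite -sqrtr_sqr ler_wsqrtr.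
have tc : t <= 2 * c.
  have c20 : 0 <= 2 * c by rewrite mulr_ge0.
  rewrite -ler_sqr ?nnegrE ?(ltW t0)// exprMn c2 -ee.
  have : kap ^+ 2 * e <= kap ^+ 2 * (1 - Num.sqrt l) by rewrite ler_wpM2l ?sqr_ge0//; lra.
  lra.
have [h1 h2] := lebesgue_tshift_diff_ge theta1 cK (ltW t0) tc.
by apply: le_trans (leeD h2 h1); rewrite -EFinD lee_fin -/V; lra.
Qed.

End variation.

Lemma bump_outside x : ~ minkowski_sum K (cball kap) x -> F x = 0 /\ w x = 0.
Proof.
move=> Kx.
have d : kap ^+ 2 < dist2 cK K0 x.
  by rewrite ltNge; apply/negP => /(dist2_le cK K0 _ (ltW kap0)).
have a0 : bump_a cK K0 kap x = 0.
  by apply/max_idPl; rewrite subr_le0 ltW.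
by rewrite /F /bump_fun /w /bump_grad a0 expr0n mul0r mulr0 mul0r oppr0 scale0r.
Qed.

Lemma bump_linear : exists C (r : R), [/\ 0 <= C, 0 < r,
  minkowski_sum K (cball kap) `<=` cball r &
  forall theta t, sphere theta -> 0 < t -> t <= 1 -> forall x,
  `| `|F x - F (x + t *: theta)| - t * `|dot (w x) theta| | <=
    C * t ^+ 2 * (\1_(@cball R m.+1 r) x : R)].
Proof.
have cM : ccvx (minkowski_sum K (@cball R m.+1 kap)) by apply: ccvx_minkowski => //; exact: ccvx_cball.
have [r1 r10 Kr] := compact_enorm_bounded cM.1.
pose r := r1 + 1.
have r0 : 0 < r by rewrite /r; lra.
(* A point of the ball of radius [r] is at distance at most [r + r1 <= 2 * r] from [K]. *)
have [C C0 H] := bump_expand cK K0 kap0 (mulr_gt0 (ltr0Sn R 1) r0).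
exists C, r; split => //.
  by move=> x /Kr /=; rewrite /cball /r/=; lra.
move=> theta t th1 t0 t1 x; rewrite indicE.
have [xr|xr] := boolP (x \in _).
  rewrite inE in xr; rewrite mulr1.
  have d : dist2 cK K0 x <= (2 * r) ^+ 2.
    rewrite /dist2 -sqr_enorm ler_sqr ?nnegrE ?enorm_ge0//; last by lra.
    apply: (le_trans (enormD _ _)); rewrite enormN.
    have : enorm (nearest cK K0 x) <= r1.
      by apply: Kr; apply: sub_minkowski (nearest_in cK K0 x); exact/cball0/ltW.
    by move: xr; rewrite /cball/= /r; lra.
  have vt : enorm (t *: theta) = t by rewrite enormZ th1 mulr1 gtr0_norm.
  have := H x (t *: theta) d; rewrite vt => /(_ t1); rewrite dotZr -/F -/w.
  apply: le_trans; rewrite distrC.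
  rewrite -[t in X in `|X - _|]gtr0_norm// -normrM.
  by rewrite -[F x - _]opprB normrN; apply: (le_trans (ler_dist_dist _ _)); rewrite distrC.
have xK : ~ minkowski_sum K (cball kap) x.
  move=> /Kr /= xr'; move: xr; rewrite notin_setE; apply.
  by rewrite /cball/= /r; lra.
have xK' : ~ minkowski_sum K (cball kap) (x + t *: theta).
  move=> /Kr /= xr'; move: xr; rewrite notin_setE; apply.
  rewrite /cball/= /r -[x](addrK (t *: theta)); apply: (le_trans (enormD _ _)).
  by rewrite enormN enormZ th1 mulr1 gtr0_norm//; lra.
have [-> ->] := bump_outside xK; have [-> _] := bump_outside xK'.
by rewrite dot0l normr0 mulr0 subrr normr0 mulr0 subrr normr0.
Qed.

End bump_integral.

(** * Riemann sums as zonotopes *)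

Section discretize.
Context (R : realType) (n : nat).
Variables (w : 'rV[R]_n -> 'rV[R]_n) (Q : set 'rV[R]_n) (M : R).
Hypothesis mw : forall i, measurable_fun setT ((fun x => w x ord0 i) : _ -> measurableTypeR R).
Hypothesis wM : forall x i, `|w x ord0 i| <= M.
Hypothesis cQ : compact Q.
Hypothesis wQ : forall x, ~ Q x -> w x = 0.

Lemma integral_close (f g : 'rV[R]_n -> R) (C : R) : 0 <= C ->
  (forall x, 0 <= f x) -> (forall x, 0 <= g x) ->
  measurable_fun setT (f : _ -> measurableTypeR R) ->
  measurable_fun setT (g : _ -> measurableTypeR R) ->
  (forall x, `|f x - g x| <= C * (\1_Q x : R)) ->
  (\int[@lebesgue_rV R n]_x (f x)%:E <=
    \int[@lebesgue_rV R n]_x (g x)%:E + (C * volume Q)%:E)%E.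
Proof.
move=> C0 f0 g0 mf mg H; have mQ := compact_measurable_rV cQ.
have mI : measurable_fun [set: 'rV[R]_n] (fun x => (\1_Q x : R)%:E).
  by apply/measurable_EFinP; exact: measurable_indic.
apply: (@le_trans _ _ (\int[@lebesgue_rV R n]_x ((g x)%:E + C%:E * (\1_Q x : R)%:E))%E).
  apply: ge0_le_integral => //.
  - by move=> x _; rewrite lee_fin.
  - exact/measurable_EFinP.
  - by apply: emeasurable_funD; [exact/measurable_EFinP|exact: measurable_funeM].
  - move=> x _; rewrite -EFinM -EFinD lee_fin.
    by have := H x; rewrite ler_norml => /andP[h1 h2]; lra.
rewrite ge0_integralD//; last 4 first.
- by move=> x _; rewrite lee_fin.
- exact/measurable_EFinP.
- by move=> x _; apply: mule_ge0; rewrite lee_fin.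
- exact: measurable_funeM.
rewrite leeD2l// ge0_integralZl//.
rewrite integral_indic// setIT EFinM /volume fineK//.
exact: compact_lebesgue_rV_fin.
Qed.

(** The values of [w], shifted by [|M|] to be nonnegative, are sorted into cubes of side [d]. The
    cell [E j] gives one segment, parallel to the lower corner [c j] of its cube and weighted by the
    volume of the cell, with an error that is uniform in [theta]. *)
Lemma zonotope_discretize (del : R) : 0 < del -> exists s : seq (R * 'rV[R]_n),
  zono_wf s /\ forall theta, sphere theta ->
  ((\int[@lebesgue_rV R n]_x (`|dot (w x) theta|)%:E <= (2 * zsupp s theta + del)%:E) /\
   (2 * zsupp s theta)%:E <= \int[@lebesgue_rV R n]_x (`|dot (w x) theta|)%:E + del%:E)%E.
Proof.
move=> del0.
have mQ := compact_measurable_rV cQ.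
have V0 := volume_ge0 Q.
have nV0 : 0 <= n%:R * volume Q by rewrite mulr_ge0.
(* Replacing [w] by the corner of its cube costs at most [n * d] at each point of [Q]. The 1 in the
   denominator covers the case where [Q] is null. *)
pose d := del / (n%:R * volume Q + 1).
have d0 : 0 < d by rewrite divr_gt0//; lra.
have dV : n%:R * d * volume Q <= del.
  have dE : d * (n%:R * volume Q + 1) = del by rewrite divfK// gt_eqF//; lra.
  by rewrite -[leRHS]dE mulrDr mulr1 (mulrC _ d) -mulrA lerDl ltW.
have M0 : 0 <= `|M| by [].
pose N := (Num.truncn (2 * `|M| / d)).+1.
have HN : 2 * `|M| / d < N%:R.
  by rewrite /N; apply: truncnS_gt.
pose J := {ffun 'I_n -> 'I_N}.
pose c (j : J) : 'rV[R]_n := \row_i (d * (j i)%:R - `|M|).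
pose E (j : J) := Q `&` [set x | forall i, d * (j i)%:R <= w x ord0 i + `|M| < d * (j i).+1%:R].
have mE j : measurable (E j).
  apply: measurableI => //.
  rewrite (_ : mkset _ = \bigcap_(i in [set: 'I_n])
    ((fun x => w x ord0 i : measurableTypeR R) @^-1`
     `[(d * (j i)%:R - `|M|), (d * (j i).+1%:R - `|M|)[%classic)).
    apply: fin_bigcap_measurable => // i _.
    by rewrite -[X in measurable X]setTI; exact: mw.
  apply/seteqP; split => x /= H i.
    by move=> _ /=; rewrite in_itv/=; have /andP[h1 h2] := H i; apply/andP; split; lra.
  by have := H i I; rewrite /= in_itv/= => /andP[h1 h2]; apply/andP; split; lra.
have Ex x : Q x -> exists j, E j x.
  move=> Qx.
  have b i : 0 <= w x ord0 i + `|M| <= 2 * `|M|.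
    have := wM x i; rewrite ler_norml => /andP[h1 h2].
    by have := ler_norm M; move=> h; apply/andP; split; lra.
  have lt i : (Num.truncn ((w x ord0 i + `|M|) / d) < N)%N.
    rewrite -(ltr_nat R); apply: le_lt_trans HN.
    have /andP[b1 b2] := b i.
    have q0 : 0 <= (w x ord0 i + `|M|) / d by rewrite divr_ge0// ltW.
    have /andP[h _] := truncn_itv q0.
    by apply: (le_trans h); rewrite ler_pM2r ?invr_gt0.
  exists [ffun i => Ordinal (lt i)]; split => // i; rewrite ffunE /=.
  have /andP[b1 b2] := b i.
  have q0 : 0 <= (w x ord0 i + `|M|) / d by rewrite divr_ge0// ltW.
  have /andP[h1 h2] := truncn_itv q0; apply/andP; split.
    by rewrite mulrC -ler_pdivlMr.
  by rewrite mulrC -ltr_pdivrMr.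
have Eu x j k : E j x -> E k x -> j = k.
  move=> [_ Hj] [_ Hk]; apply/ffunP => i; apply/val_inj/eqP => /=.
  have /andP[j1 j2] := Hj i; have /andP[k1 k2] := Hk i.
  have jk : d * (j i)%:R < d * (k i).+1%:R by lra.
  have kj : d * (k i)%:R < d * (j i).+1%:R by lra.
  rewrite ltr_pM2l// ltr_nat ltnS in jk; rewrite ltr_pM2l// ltr_nat ltnS in kj.
  by rewrite eqn_leq jk kj.
have wc x j : E j x -> enorm (w x - c j) <= n%:R * d.
  move=> [_ H]; apply: (le_trans (enorm_le_norm _)); rewrite ler_wpM2l//.
  rewrite [leLHS]mx_normrE; apply/bigmax_leP; split; first exact: ltW.
  move=> [i0 i] _ /=; rewrite ord1 !mxE ler_norml; have /andP[h1 h2] := H i.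
  by rewrite -natr1 mulrDr mulr1 in h2; apply/andP; split; lra.
(* The half compensates the factor 2 in front of [zsupp]. Cells with [c j = 0] have no direction to
   normalize and contribute 0 to the sum. *)
pose s := [seq (volume (E j) * enorm (c j) / 2, (enorm (c j))^-1 *: c j) | j <- enum J & c j != 0].
exists s; split.
  move=> p /mapP[j]; rewrite mem_filter => /andP[cj _] -> /=; split.
    by rewrite divr_ge0// mulr_ge0 ?volume_ge0 ?enorm_ge0.
  exact: sphere_normalize.
move=> theta th1.
have zE : 2 * zsupp s theta = \sum_(j : J) volume (E j) * `|dot (c j) theta|.
  rewrite /zsupp big_map big_filter big_enum_cond/= mulr_sumr.
  rewrite big_mkcond/=; apply: eq_bigr => j _.
  case: ifPn => [cj|]; last by rewrite negbK => /eqP ->; rewrite dot0l normr0 mulr0.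
  rewrite dotZl normrM gtr0_norm ?invr_gt0 ?enorm_gt0//.
  by field; rewrite gt_eqF// enorm_gt0.
pose phi x : R := \sum_(j : J) `|dot (c j) theta| * (\1_(E j) x : R).
have phi_int : (\int[@lebesgue_rV R n]_x (phi x)%:E = (2 * zsupp s theta)%:E)%E.
  transitivity (\int[@lebesgue_rV R n]_x (\sum_(j : J) (`|dot (c j) theta|)%:E * (\1_(E j) x : R)%:E))%E.
    by apply: eq_integral => x _; rewrite -sumEFin; apply: eq_bigr => j _; rewrite EFinM.
  rewrite ge0_integral_sum//; last first.
  - by move=> j; apply: measurable_funeM; apply/measurable_EFinP; exact: measurable_indic.
  rewrite zE -sumEFin; apply: eq_bigr => j _.
  rewrite ge0_integralZl//; last by apply/measurable_EFinP; exact: measurable_indic.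
  rewrite integral_indic// setIT mulrC EFinM /volume fineK//.
  rewrite ge0_fin_numE//; apply: (@le_lt_trans _ _ (lebesgue_rV Q)).
    by apply: le_measure; rewrite ?inE//; apply: subIsetl.
  by rewrite -ge0_fin_numE//; exact: compact_lebesgue_rV_fin.
have phi0 x : 0 <= phi x.
  by apply: sumr_ge0 => j _; rewrite mulr_ge0// ler0n.
have mphi : measurable_fun setT (phi : _ -> measurableTypeR R).
  apply: measurable_sum => j; apply: measurable_funM => //; exact: measurable_indic.
have mdot : measurable_fun setT ((fun x => `|dot (w x) theta|) : _ -> measurableTypeR R).
  apply: (measurableT_comp (@normr_measurable R setT)).
  under eq_fun do rewrite dotE.
  apply: measurable_sum => i; apply: measurable_funM => //; exact: mw.
have close x : `| `|dot (w x) theta| - phi x | <= n%:R * d * (\1_Q x : R).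
  rewrite indicE; have [Qx|Qx] := boolP (x \in Q).
    rewrite inE in Qx; have [j Ejx] := Ex x Qx.
    have -> : phi x = `|dot (c j) theta|.
      rewrite /phi (bigD1 j)//= indicE mem_set// mulr1 big1 ?addr0// => k kj.
      rewrite indicE memNset ?mulr0// => Ekx.
      by move: kj; rewrite (Eu x k j Ekx Ejx) eqxx.
    rewrite mulr1; apply: (le_trans (ler_dist_dist _ _)); rewrite -dotBl.
    apply: (le_trans (normr_dot_le _ _)); rewrite th1 mulr1; exact: wc.
  rewrite notin_setE in Qx; rewrite wQ// dot0l normr0 sub0r normrN mulr0.
  rewrite /phi big1 ?normr0// => j _; rewrite indicE memNset ?mulr0// => -[Qx' _].
  exact: Qx.
have nd0 : 0 <= n%:R * d by rewrite mulr_ge0// ltW.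
split.
  apply: (@le_trans _ _ ((2 * zsupp s theta)%:E + (n%:R * d * volume Q)%:E)%E).
    rewrite -phi_int; apply: integral_close => //.
  by rewrite -EFinD lee_fin lerD2l.
rewrite -phi_int.
apply: (@le_trans _ _ (\int[@lebesgue_rV R n]_x (`|dot (w x) theta|)%:E + (n%:R * d * volume Q)%:E)%E).
  by apply: integral_close => // x; rewrite distrC.
by rewrite leeD2l// lee_fin.
Qed.

End discretize.

(** * Zonotopes close to a projection body *)

Section approx.
Context (R : realType) (m : nat).
Implicit Types (K D : set 'rV[R]_m.+1) (theta : 'rV[R]_m.+1).

Section total.
Variable K : set 'rV[R]_m.+1.
Hypotheses (cK : ccvx K) (K0 : K !=set0).
Variable kap : R.
Hypothesis kap0 : 0 < kap.

Let F := bump_fun cK K0 kap.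
Let w := bump_grad cK K0 kap.

Lemma bump_grad_norm x : enorm (w x) <= 4 / kap.
Proof.
have [Kx|Kx] := pselect (minkowski_sum K (cball kap) x); last first.
  by rewrite /w; have [_ ->] := bump_outside cK K0 kap0 Kx; rewrite enorm0 divr_ge0// ltW.
have : enorm (x - nearest cK K0 x) <= kap.
  have := (dist2_le cK K0 x (ltW kap0)).2 Kx.
  by rewrite /dist2 -sqr_enorm ler_sqr ?nnegrE ?enorm_ge0// ltW.
rewrite /w /bump_grad enormZ normrN.
have a0 := bump_a_ge0 cK K0 kap x; have ak := bump_a_le cK K0 kap x.
have k4 : 0 < kap ^+ 4 by rewrite exprn_gt0.
rewrite ger0_norm; last by rewrite divr_ge0 ?mulr_ge0// ltW.
move=> h; apply: (@le_trans _ _ (4 * kap ^+ 2 / kap ^+ 4 * kap)).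
  apply: ler_pM => //; [by rewrite divr_ge0 ?mulr_ge0// ltW|exact: enorm_ge0|].
  by rewrite ler_pM2r ?invr_gt0// ler_pM2l.
by rewrite (_ : 4 * kap ^+ 2 / kap ^+ 4 * kap = 4 / kap)//; field; rewrite gt_eqF.
Qed.

(** The variation of the cut-off function under a shift by $t\theta$ is [t] times this integral up
    to $O(t^2)$. Divide the two bounds on the variation by [t] and take [t] small. *)
Lemma bump_total theta : sphere theta ->
  ((2 * volume (hproj theta K))%:E <=
     \int[@lebesgue_rV R m.+1]_x (`|dot (w x) theta|)%:E)%E /\
  (\int[@lebesgue_rV R m.+1]_x (`|dot (w x) theta|)%:E <=
     (2 * volume (hproj theta (minkowski_sum K (cball kap))))%:E)%E.
Proof.
move=> th1.
have [C [r [C0 r0 Kr H]]] := bump_linear cK K0 kap0.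
set I := (\int[_]_x _)%E; set V := volume _; set V' := volume _.
have I0 : (0 <= I)%E by apply: integral_ge0 => x _; rewrite lee_fin.
have mB : measurable_fun setT ((fun x => `|dot (w x) theta|) : _ -> measurableTypeR R).
  apply: (measurableT_comp (@normr_measurable R setT)).
  exact: measurable_dot_bump_grad.
set v := volume (@cball R m.+1 r).
have v0 : 0 <= v by exact: volume_ge0.
have step t : 0 < t -> t <= 1 ->
   (\int[@lebesgue_rV R m.+1]_x (`|F x - F (x + t *: theta)|)%:E <= t%:E * I + (C * t ^+ 2 * v)%:E)%E /\
   (t%:E * I <= \int[@lebesgue_rV R m.+1]_x (`|F x - F (x + t *: theta)|)%:E + (C * t ^+ 2 * v)%:E)%E.
  move=> t0 t1.
  have IE : (t%:E * I = \int[@lebesgue_rV R m.+1]_x (t * `|dot (w x) theta|)%:E)%E.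
    under eq_integral do rewrite EFinM.
    rewrite ge0_integralZl//; last by rewrite lee_fin ltW.
    exact/measurable_EFinP.
  have mA : measurable_fun setT ((fun x => `|F x - F (x + t *: theta)|) : _ -> measurableTypeR R).
    apply: (measurableT_comp (@normr_measurable R setT)).
    apply: measurable_funB; first exact: measurable_bump.
    exact: measurable_bump_shift.
  have mC : measurable_fun setT ((fun x => t * `|dot (w x) theta|) : _ -> measurableTypeR R).
    exact: measurable_funM.
  have CC : 0 <= C * t ^+ 2 by rewrite mulr_ge0// sqr_ge0.
  have cB : compact (@cball R m.+1 r) by case: (@ccvx_cball R m.+1 r).
  rewrite IE; split; apply: integral_close => //.
  - by move=> x; rewrite mulr_ge0// ltW.
  - by move=> x; apply: H.
  - by move=> x; rewrite mulr_ge0// ltW.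
  - by move=> x; rewrite distrC; apply: H.
have CV0 : 0 <= C * v by rewrite mulr_ge0.
have upper : (I <= (2 * V')%:E)%E.
  apply/lee_addgt0Pr => e e0.
  pose t := Num.min 1 (e / (C * v + 1)).
  have t0 : 0 < t by rewrite lt_min ltr01 divr_gt0//; lra.
  have t1 : t <= 1 by rewrite ge_min lexx.
  have te : C * t * v <= e.
    have h : t * (C * v + 1) <= e.
      by rewrite -ler_pdivlMr; [rewrite ge_min lexx orbT|lra].
    by lra.
  have [_ h] := step t t0 t1.
  have h' := le_trans h (leeD2r _ (bump_variation_le cK K0 kap0 th1 t0)).
  rewrite -(@lee_pmul2l _ t%:E)// ?lte_fin//.
  apply: (le_trans h'); rewrite -!EFinD -EFinM lee_fin -/V'.
  have : t * (C * t * v) <= t * e by rewrite ler_pM2l.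
  by lra.
split => //.
have fI : I \is a fin_num by rewrite ge0_fin_numE//; apply: le_lt_trans upper _; rewrite ltry.
rewrite -(fineK fI) lee_fin; set i := fine I.
have V0 : 0 <= V by exact: volume_ge0.
have k2 : 0 < kap ^+ 2 by rewrite exprn_gt0.
apply/ler_addgt0Pr => e e0.
(* Collects the two errors of order [t]: the remainder of the expansion, and the levels lost in
   [bump_variation_ge]. *)
pose c := C * v + V / kap ^+ 2 + 1.
have Vk : 0 <= V / kap ^+ 2 by rewrite divr_ge0// ltW.
have c0 : 0 < c by rewrite /c; lra.
pose t := Num.min (Num.min 1 (2 * kap)) (e / c).
have t0 : 0 < t by rewrite !lt_min ltr01 mulr_gt0//= divr_gt0.
have t1 : t <= 1 by rewrite !ge_min lexx.
have tk : t <= 2 * kap by rewrite !ge_min lexx !orbT.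
have te : t * c <= e by rewrite -ler_pdivlMr// ge_min lexx !orbT.
have [h _] := step t t0 t1.
have := le_trans (bump_variation_ge cK K0 kap0 th1 t0 tk) h.
rewrite -(fineK fI) -EFinM -EFinD lee_fin -/V -/i => h'.
set q := t ^+ 2 / (4 * kap ^+ 2) in h'.
have q0 : 0 <= q by rewrite divr_ge0 ?sqr_ge0// mulr_ge0// ltW.
have qE : 4 * q = t * (t / kap ^+ 2) by rewrite /q; field; rewrite gt_eqF.
have h2 : 2 * V * (1 - q) ^+ 2 <= i + C * t * v.
  rewrite -(ler_pM2l t0); move: h'; lra.
have h3 : 2 * V - 4 * q * V <= 2 * V * (1 - q) ^+ 2.
  have : 0 <= V * q ^+ 2 by rewrite mulr_ge0// sqr_ge0.
  by lra.
have h4 : 4 * q * V <= t * (V / kap ^+ 2).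
  have -> : 4 * q * V = t * (t * (V / kap ^+ 2)) by rewrite qE; ring.
  by rewrite ler_pM2l// ler_piMl.
move: te; rewrite /c; lra.
Qed.

End total.

Lemma pow_near1 (k : nat) (e : R) : 0 < e -> exists2 x : R, 0 < x & (1 + x) ^+ k <= 1 + e.
Proof.
elim: k e => [|k IH] e e0; first by exists 1; rewrite ?expr0//; lra.
have [x x0 Hx] := IH (e / 2) (divr_gt0 e0 (ltr0Sn R 1)).
have c0 : 0 < (e / 2) / (1 + e / 2) by rewrite !divr_gt0//; lra.
exists (Num.min x ((e / 2) / (1 + e / 2))); first by rewrite lt_min x0.
set y := Num.min _ _.
have y0 : 0 < y by rewrite lt_min x0.
have yx : y <= x by rewrite ge_min lexx.
have ye : y * (1 + e / 2) <= e / 2.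
  by rewrite -ler_pdivlMr; [rewrite ge_min lexx orbT|lra].
have h : (1 + y) ^+ k <= 1 + e / 2.
  by apply: le_trans Hx; rewrite lerXn2r ?nnegrE; lra.
rewrite exprS; apply: (@le_trans _ _ ((1 + y) * (1 + e / 2))); last by lra.
by rewrite ler_wpM2l//; lra.
Qed.

Lemma zono_approx_proj K (r eta : R) : ccvx K -> 0 < r -> cball r `<=` K ->
  0 < eta -> exists s, zono_wf s /\ forall theta, sphere theta ->
    (1 - eta) * volume (hproj theta K) <= zsupp s theta <=
    (1 + eta) * volume (hproj theta K).
Proof.
move=> cK r0 rK eta0.
have K0 : K !=set0 by exists 0; apply: rK; rewrite /cball/= enorm0 ltW.
have [x x0 Hx] := pow_near1 m (divr_gt0 eta0 (ltr0Sn R 1)).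
(* As $rB\subseteq K$, the body $K+\kappa B$ lies in $(1+x)K$, whose projections are larger by
   $(1+x)^m\le1+\eta/2$. *)
pose kap := x * r.
have kap0 : 0 < kap by rewrite mulr_gt0.
pose v0 := volume (@cball R m r).
have v00 : 0 < v0 by exact: volume_cball_gt0.
have cB : ccvx (@cball R m.+1 r) by exact: ccvx_cball.
have Vlow theta : sphere theta -> v0 <= volume (hproj theta K).
  by move=> th1; rewrite /v0 -(hproj_cball r th1); apply: volume_hproj_le.
have cKk : ccvx (minkowski_sum K (@cball R m.+1 kap)).
  by apply: ccvx_minkowski => //; exact: ccvx_cball.
have Vup theta : sphere theta ->
    volume (hproj theta (minkowski_sum K (cball kap))) <= (1 + eta / 2) * volume (hproj theta K).
  move=> th1; have x1 : 0 < 1 + x by lra.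
  apply: (@le_trans _ _ ((1 + x) ^+ m * volume (hproj theta K))); last first.
    by rewrite ler_wpM2r// volume_ge0.
  rewrite -volume_dilate//; last by case: (ccvx_hproj theta cK).
  rewrite -hproj_dilate; apply: volume_hproj_le => //; first exact: ccvx_dilate.
  rewrite -minkowski_dilate//; last by case: cK.
  rewrite dilate1; apply: minkowskiS => //.
  by rewrite /kap -dilate_cball//; exact: dilateS.
(* Every projection of [K] contains an [m]-ball of volume [v0], so this additive error is a relative
   one and uses the rest of [eta]. *)
pose del := eta * v0 / 2.
have del0 : 0 < del by rewrite divr_gt0// mulr_gt0.
have [C [rr [C0 rr0 Krr _]]] := bump_linear cK K0 kap0.
have cBr : compact (@cball R m.+1 rr) by case: (@ccvx_cball R m.+1 rr).
have [|||s [wf Hs]] := @zonotope_discretize R m.+1 (bump_grad cK K0 kap) (cball rr) (4 / kap) _ _ cBr _ del del0.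
- exact: measurable_bump_grad_coord.
- move=> y i; apply: (le_trans (norm_coord _ _)); apply: (le_trans (norm_le_enorm _)).
  exact: bump_grad_norm.
- move=> y yr; have [|//] := bump_outside cK K0 kap0 (x := y).
  by move=> /Krr.
exists s; split => // theta th1.
have [h1 h2] := Hs _ th1; have [h3 h4] := bump_total cK K0 kap0 th1.
have := le_trans h3 h1; rewrite lee_fin => h5.
have := le_trans h2 (leeD2r _ h4); rewrite -EFinD lee_fin => h6.
have h7 := Vup _ th1; have h8 := Vlow _ th1.
have h9 : eta * v0 <= eta * volume (hproj theta K) by rewrite ler_pM2l.
have h10 : 0 <= eta * volume (hproj theta K) by rewrite mulr_ge0 ?volume_ge0// ltW.
by move: h5 h6; rewrite /del => h5 h6; apply/andP; split; lra.
Qed.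

(** By separation, a point outside a compact convex set violates the support inequality in some unit
    direction; hence the estimates on support functions become inclusions. *)
Lemma zono_approx K D (r eta : R) : ccvx K -> 0 < r -> cball r `<=` K ->
  ccvx D -> D !=set0 ->
  (forall theta, sphere theta -> support_function D theta = volume (hproj theta K)) ->
  0 < eta -> eta < 1 -> exists s, [/\ zono_wf s, dilate (1 - eta) D `<=` zono s &
    zono s `<=` dilate (1 + eta) D].
Proof.
move=> cK r0 rK cD D0 DK eta0 eta1.
have [s [wf Hs]] := zono_approx_proj cK r0 rK eta0.
have wf0 p : p \in s -> 0 <= p.1 by move=> /wf[].
have supD theta p : D p -> (forall y, D y -> dot y theta <= dot p theta) ->
    support_function D theta = dot p theta.
  move=> Dp pmax; apply/eqP; rewrite eq_le; apply/andP; split.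
    apply: ge_sup; first by exists (dot theta p); exists p.
    by move=> _ [y Dy <-]; rewrite dotC; exact: pmax.
  apply: ub_le_sup; last by exists p => //; rewrite dotC.
  by exists (dot p theta) => _ [y Dy <-]; rewrite dotC; exact: pmax.
have Dle theta y : D y -> dot y theta <= support_function D theta.
  move=> Dy; have cf : {within D, continuous (fun z => dot z theta)}.
    by apply: continuous_subspaceT; exact: dot_continuous.
  have [p] := compact_EVT_max D0 cD.1 cf; rewrite inE => Dp pmax.
  have pm z : D z -> dot z theta <= dot p theta by move=> Dz; apply: pmax; rewrite inE.
  by rewrite (supD _ p)//; exact: pm.
exists s; split => //.
  move=> _ [x Dx <-]; apply: contrapT => Zx.
  have [theta th1 [p Zp [pmax pl]]] := separation (ccvx_zono s) (ex_intro _ _ (zono_wf0 wf)) Zx.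
  have [z Zz zE] := zono_supp_attained theta wf0.
  have h1 := pmax _ Zz; rewrite zE in h1.
  have := Hs _ th1; rewrite -DK// => /andP[h2 _].
  have : (1 - eta) * dot x theta <= (1 - eta) * support_function D theta.
    by rewrite ler_wpM2l ?subr_ge0 ?(ltW eta1)//; exact: Dle.
  by rewrite dotZl in pl; lra.
move=> x Zx; apply: contrapT => Dx.
have cD' : ccvx (dilate (1 + eta) D) by exact: ccvx_dilate.
have D0' : dilate (1 + eta) D !=set0.
  by have [d Dd] := D0; exists ((1 + eta) *: d); exists d.
have [theta th1 [_ [p Dp <-] [pmax pl]]] := separation cD' D0' Dx.
have e0 : 0 < 1 + eta by lra.
have pm z : D z -> dot z theta <= dot p theta.
  move=> Dz; have := pmax ((1 + eta) *: z); rewrite !dotZl ler_pM2l//; apply.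
  by exists z.
have := Hs _ th1; rewrite -DK// (supD _ p)// => /andP[_ h].
have := zono_le_supp theta wf0 Zx; rewrite dotZl in pl; lra.
Qed.

(* The projection body of the unit ball is a ball. *)
Lemma zono_approx_ball (eta : R) : 0 < eta -> eta < 1 ->
  exists s, [/\ zono_wf s, @cball R m.+1 (1 - eta) `<=` zono s &
    zono s `<=` @cball R m.+1 (1 + eta)].
Proof.
move=> eta0 eta1; pose k := volume (@cball R m 1).
have k0 : 0 < k by exact: volume_cball_gt0.
have e1 : 0 < 1 - eta by lra.
have e2 : 0 < 1 + eta by lra.
have cB : ccvx (@cball R m.+1 1) by exact: ccvx_cball.
have cD : ccvx (@cball R m.+1 k) by exact: ccvx_cball.
have D0 : @cball R m.+1 k !=set0 by exists 0; rewrite /cball/= enorm0 ltW.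
have [|s [wf s1 s2]] := zono_approx cB ltr01 (@subset_refl _ _) cD D0 _ eta0 eta1.
  move=> theta th1; rewrite hproj_cball//.
  apply/eqP; rewrite eq_le; apply/andP; split.
    apply: ge_sup; first by exists (dot theta 0); exists 0; rewrite ?/cball/= ?enorm0// ltW.
    move=> _ [y yk <-]; apply: (le_trans (dot_le_enorm _ _)).
    by rewrite th1 mul1r.
  apply: ub_le_sup.
    exists k => _ [y yk <-]; apply: (le_trans (dot_le_enorm _ _)).
    by rewrite th1 mul1r.
  exists (k *: theta); first by rewrite /cball/= enormZ th1 mulr1 gtr0_norm.
  by rewrite dotZr dot_sphere// mulr1.
have kE (a : R) : 0 < a -> dilate k^-1 (dilate a (@cball R m.+1 k)) = cball a.
  move=> a0; rewrite !dilate_cball//; last by rewrite invr_gt0.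
  by rewrite mulrCA mulVf ?mulr1// gt_eqF.
exists (zscale k^-1 s); rewrite -!dilate_zono ?invr_gt0//; split.
- by apply: zscale_wf => //; rewrite invr_ge0 ltW.
- by rewrite -kE//; exact: dilateS.
- by rewrite -[cball _]kE//; exact: dilateS.
Qed.

End approx.

(** * Surface area *)

Section poly_limit.
Context (R : realType).

Lemma horner_continuous (p : {poly R}) : continuous (fun x : R => p.[x]).
Proof.
elim/poly_ind: p => [|p c IH].
  by rewrite (_ : (fun x => _) = cst 0); [move=> x; exact: cvg_cst|apply/funext => x; rewrite horner0].
rewrite (_ : (fun x => _) = (fun x => p.[x] * x + c)).
  move=> x; apply: cvgD; last exact: cvg_cst.
  by apply: cvgM; [exact: IH|exact: cvg_id].
by apply/funext => x; rewrite hornerMXaddC.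
Qed.

(** The approximation arguments below end in inequalities between polynomials in the precision,
    valid for small positive values; this lets the precision tend to 0. *)
Lemma poly_right_limit_ge0 (p : {poly R}) (c : R) : 0 < c ->
  (forall x, 0 < x -> x < c -> 0 <= p.[x]) -> 0 <= p.[0].
Proof.
move=> c0 H; rewrite leNgt; apply/negP => p0.
have /cvgr_lt/(_ 0 p0) : p.[x] @[x --> (0 : R)] --> p.[0] by exact: horner_continuous.
move=> /nbhs_ballP[e /= e0 He].
pose x := Num.min e c / 2.
have x0 : 0 < x by rewrite divr_gt0// lt_min e0.
have xe : x < e.
  by rewrite ltr_pdivrMr//; apply: le_lt_trans (_ : e < _); rewrite ?ge_min ?lexx//; lra.
have xc : x < c.
  by rewrite ltr_pdivrMr//; apply: le_lt_trans (_ : c < _); rewrite ?ge_min ?lexx ?orbT//; lra.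
have /He : ball (0 : R) e x by rewrite /ball/= sub0r normrN gtr0_norm.
by rewrite ltNge H.
Qed.

End poly_limit.

(** * The volume of [A + t B] and the surface area *)

Section ball_sum.
Context (R : realType) (m : nat).
Implicit Types (A B : set 'rV[R]_m.+1) (t u : R).

Definition vball A t := volume (minkowski_sum A (cball t)).

Lemma ccvx_ball_sum A t : ccvx A -> ccvx (minkowski_sum A (cball t)).
Proof. by move=> cA; apply: ccvx_minkowski => //; exact: ccvx_cball. Qed.

Lemma vball_ge A t : ccvx A -> 0 <= t -> volume A <= vball A t.
Proof.
move=> cA t0; apply: volume_le; [by case: cA|by case: (ccvx_ball_sum t cA)|].
by apply: sub_minkowski; exact: cball0.
Qed.

(** Since [A] contains the origin, $(1-\eta)A\subseteq A\subseteq(1+\eta)A$, so $A+tZ$ lies between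
    two dilates of $A+tB$. *)
Lemma zono_ball_sandwich A t (eta : R) s : ccvx A -> A 0 -> 0 < t ->
  0 < eta -> eta < 1 -> zono_wf s ->
  @cball R m.+1 (1 - eta) `<=` zono s -> zono s `<=` @cball R m.+1 (1 + eta) ->
  (1 - eta) ^+ m.+1 * vball A t <= volume (minkowski_sum A (zono (zscale t s))) /\
  volume (minkowski_sum A (zono (zscale t s))) <= (1 + eta) ^+ m.+1 * vball A t.
Proof.
move=> cA A0 t0 eta0 eta1 wf s1 s2.
have e1 : 0 < 1 - eta by lra.
have e2 : 0 < 1 + eta by lra.
have [cAt _] := ccvx_ball_sum t cA.
have cAz : compact (minkowski_sum A (zono (zscale t s))).
  by apply: compact_minkowski; [case: cA|case: (ccvx_zono (zscale t s))].
rewrite -!volume_dilate// !dilate_minkowski !dilate_cball// -dilate_zono//; split.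
  apply: volume_le.
  - by apply: compact_minkowski; [apply: compact_dilate; case: cA|case: (@ccvx_cball R m.+1 ((1 - eta) * t))].
  - by rewrite dilate_zono.
  apply: minkowskiS.
    by rewrite -[X in _ `<=` X]dilate1; apply: dilate_le => //; [case: cA|lra|lra].
  by rewrite mulrC -dilate_cball//; exact: dilateS.
apply: volume_le.
- by rewrite dilate_zono.
- by apply: compact_minkowski; [apply: compact_dilate; case: cA|case: (@ccvx_cball R m.+1 ((1 + eta) * t))].
apply: minkowskiS.
  by rewrite -[X in X `<=` _]dilate1; apply: dilate_le => //; [case: cA|lra].
by rewrite [X in cball X]mulrC -[X in _ `<=` X]dilate_cball//; exact: dilateS.
Qed.

Lemma sandwich_limit (a b c d : R) (k : nat) :
  (forall eta, 0 < eta -> eta < 1 -> (1 - eta) ^+ k * a + b <= (1 + eta) ^+ k * c + d) ->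
  a + b <= c + d.
Proof.
move=> H; pose p : {poly R} := (1 + 'X) ^+ k * c%:P + d%:P - (1 - 'X) ^+ k * a%:P - b%:P.
have pE x : p.[x] = (1 + x) ^+ k * c + d - (1 - x) ^+ k * a - b.
  by rewrite /p !hornerE.
have := @poly_right_limit_ge0 R p 1 ltr01; rewrite !pE addr0 subr0 !expr1n !mul1r => h.
suff : 0 <= c + d - a - b by lra.
by apply: h => x x0 x1; rewrite pE; have := H x x0 x1; lra.
Qed.

(** [volume_zono_mono] for zonotopes close to the ball, with the factors of [zono_ball_sandwich]
    removed in the limit. [vball_quot] follows from [volume_zono_quot] in the same way. *)
Lemma vball_mono A A' t : ccvx A -> ccvx A' -> A 0 -> A `<=` A' -> 0 < t ->
  vball A t - volume A <= vball A' t - volume A'.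
Proof.
move=> cA cA' A0 AA t0.
apply: (@sandwich_limit _ _ _ _ m.+1) => eta eta0 eta1.
have [s [wf s1 s2]] := @zono_approx_ball R m _ eta0 eta1.
have [h1 _] := zono_ball_sandwich cA A0 t0 eta0 eta1 wf s1 s2.
have [_ h2] := zono_ball_sandwich cA' (AA _ A0) t0 eta0 eta1 wf s1 s2.
have := volume_zono_mono cA cA' AA (zscale_wf (ltW t0) wf); lra.
Qed.

Lemma vball_quot A t u : ccvx A -> A 0 -> 0 < t -> t <= u ->
  u * (vball A t - volume A) <= t * (vball A u - volume A).
Proof.
move=> cA A0 t0 tu; have u0 : 0 < u by lra.
rewrite !mulrBr; apply: (@sandwich_limit _ _ _ _ m.+1) => eta eta0 eta1.
have [s [wf s1 s2]] := @zono_approx_ball R m _ eta0 eta1.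
have [h1 _] := zono_ball_sandwich cA A0 t0 eta0 eta1 wf s1 s2.
have [_ h2] := zono_ball_sandwich cA A0 u0 eta0 eta1 wf s1 s2.
have := volume_zono_quot cA wf t0 tu.
rewrite -(ler_pM2l u0) in h1; rewrite -(ler_pM2l t0) in h2; lra.
Qed.

Lemma dilate_unit_ball t : 0 < t -> dilate t (@unit_ball R m.+1) = cball t.
Proof. by move=> t0; rewrite (_ : @unit_ball R m.+1 = cball 1)// dilate_cball// mulr1. Qed.

Definition quot A t := (vball A t - volume A) / t.

Lemma quot_ge0 A t : ccvx A -> 0 < t -> 0 <= quot A t.
Proof.
by move=> cA t0; rewrite divr_ge0 ?subr_ge0 ?vball_ge// ltW.
Qed.

Lemma quot_nondecreasing A t u : ccvx A -> A 0 -> 0 < t -> t <= u -> quot A t <= quot A u.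
Proof.
move=> cA A0 t0 tu; have u0 : 0 < u by lra.
rewrite /quot ler_pdivrMr// mulrAC ler_pdivlMr// mulrC [leRHS]mulrC.
exact: vball_quot.
Qed.

(** The quotient is nondecreasing in [t] and nonnegative, so the [lim] in the definition is a
    genuine limit, equal to the infimum. *)
Lemma surface_area_inf A : ccvx A -> A 0 ->
  surface_area A = inf [set quot A t | t in [set t | 0 < t]].
Proof.
move=> cA A0.
pose f (t : R) := (volume (minkowski_sum A (dilate t (@unit_ball R m.+1))) - volume A) / t.
have fE t : 0 < t -> f t = quot A t by move=> t0; rewrite /f dilate_unit_ball.
have S : [set quot A t | t in [set t | 0 < t]] =
    [set f x | x in [set` Interval (BRight 0) (BInfty R false)]].
  apply/seteqP; split => _ [t /= t0 <-].
    by exists t; [rewrite /= in_itv/= t0|rewrite fE].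
  by rewrite in_itv/= andbT in t0; rewrite fE//; exists t.
rewrite S /surface_area -/f; apply/cvg_lim => //.
apply: nondecreasing_at_right_cvgr => //.
- move=> t u; rewrite !in_itv/= !andbT => t0 u0 tu.
  by rewrite -!/(f _) !fE//; exact: quot_nondecreasing.
- exists 0 => _ [t + <-]; rewrite /= in_itv/= andbT => t0.
  by rewrite -!/(f _) fE//; exact: quot_ge0.
Qed.

Lemma surface_area_le A t : ccvx A -> A 0 -> 0 < t -> surface_area A <= quot A t.
Proof.
move=> cA A0 t0; rewrite surface_area_inf//; apply: ge_inf; last by exists t.
by exists 0 => _ [u u0 <-]; exact: quot_ge0.
Qed.

Lemma surface_area_ge A (c : R) : ccvx A -> A 0 ->
  (forall t, 0 < t -> c <= quot A t) -> c <= surface_area A.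
Proof.
move=> cA A0 H; rewrite surface_area_inf//; apply: lb_le_inf.
  by exists (quot A 1); exists 1; [exact: ltr01|].
by move=> _ [t t0 <-]; exact: H.
Qed.

Lemma surface_area_ge0 A : ccvx A -> A 0 -> 0 <= surface_area A.
Proof. by move=> cA A0; apply: surface_area_ge => // t; exact: quot_ge0. Qed.

Lemma ball_sum_dilate A r t : ccvx A -> 0 < r -> cball r `<=` A -> 0 < t ->
  minkowski_sum A (cball t) `<=` dilate (1 + t / r) A.
Proof.
move=> cA r0 rA t0; rewrite -minkowski_dilate ?divr_gt0//; last by case: cA.
rewrite dilate1; apply: minkowskiS => //.
rewrite [X in cball X](_ : t = t / r * r); last by rewrite divfK// gt_eqF.
by rewrite -dilate_cball ?divr_gt0//; exact: dilateS.
Qed.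

Lemma vball_dilate A (l t : R) : ccvx A -> 0 < l -> 0 < t ->
  vball (dilate l A) t = l ^+ m.+1 * vball A (t / l).
Proof.
move=> cA l0 t0; rewrite /vball -volume_dilate//; last by case: (ccvx_ball_sum (t / l) cA).
by rewrite dilate_minkowski dilate_cball// mulrC divfK// gt_eqF.
Qed.

Lemma quot_dilate A (l t : R) : ccvx A -> 0 < l -> 0 < t ->
  quot (dilate l A) t = l ^+ m * quot A (t / l).
Proof.
move=> cA l0 t0; rewrite /quot vball_dilate// volume_dilate//; last by case: cA.
by rewrite exprS; field; rewrite !gt_eqF.
Qed.

(* A + x B is contained in the dilate (1 + e / r) A, and increments are monotone. *)
Lemma vball_step A r (e x d : R) : ccvx A -> 0 < r -> cball r `<=` A ->
  0 < d -> 0 <= x -> x <= e ->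
  vball A (x + d) - vball A x <= (1 + e / r) ^+ m * (vball A d - volume A).
Proof.
move=> cA r0 rA d0 x0 xe.
have A0 : A 0 by apply: rA; rewrite /cball/= enorm0 ltW.
have er : 0 <= e / r by rewrite divr_ge0 ?(ltW r0)//; lra.
pose l := 1 + e / r.
have l1 : 1 <= l by rewrite /l; lra.
have l0 : 0 < l by lra.
have cAx := ccvx_ball_sum x cA.
have Al : A `<=` dilate l A.
  by rewrite -[X in X `<=` _]dilate1; apply: dilate_le => //; case: cA.
have Axl : minkowski_sum A (cball x) `<=` dilate l A.
  have [->|x00] := eqVneq x 0.
    apply: subset_trans Al => _ [a Aa [b b0 <-]].
    have -> : b = 0 by apply: enorm_eq0; apply/eqP; rewrite eq_le enorm_ge0 andbT.
    by rewrite addr0.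
  have xp : 0 < x by rewrite lt_neqAle eq_sym x00.
  apply: (subset_trans (ball_sum_dilate cA r0 rA xp)).
  apply: dilate_le => //; first by case: cA.
    by rewrite addr_ge0// divr_ge0// ltW.
  by rewrite lerD2l ler_pM2r// invr_gt0.
have E : minkowski_sum (minkowski_sum A (@cball R m.+1 x)) (cball d) = minkowski_sum A (cball (x + d)).
  rewrite -minkowskiA; congr minkowski_sum.
  have [->|x00] := eqVneq x 0; last by rewrite minkowski_cball// lt_neqAle eq_sym x00.
  rewrite add0r minkowskiC (_ : cball 0 = [set 0]) ?minkowski0//.
  apply/seteqP; split => [b b0|_ ->]; last exact: cball0.
  by apply: enorm_eq0; apply/eqP; rewrite eq_le enorm_ge0 andbT.
have Ax0 : minkowski_sum A (cball x) 0.
  by exists 0 => //; exists 0; rewrite ?addr0//; exact: cball0.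
have := vball_mono cAx (ccvx_dilate l cA) Ax0 Axl d0.
rewrite /vball E -/(vball _ _) -/(vball (dilate l A) d) => h; apply: (le_trans h).
rewrite vball_dilate// volume_dilate//; last by case: cA.
rewrite -mulrBr exprS (mulrC l) -mulrA ler_wpM2l ?exprn_ge0 ?(ltW l0)//.
(* Dilation by [l] gives the factor $l^{m+1}$ and the radius [d / l]; one [l] is recovered because
   the quotient at [d / l] is at most the quotient at [d]. *)
have dl : d / l <= d by rewrite ler_pdivrMr// ler_peMr// ltW.
have := vball_quot cA A0 (divr_gt0 d0 l0) dl.
rewrite -mulrA ler_pM2l// => h2.
by rewrite [leLHS]mulrC -ler_pdivlMr// [leRHS]mulrC.
Qed.

(** The converse of [surface_area_le] up to a factor. The radius [e] is reached in equal steps [d],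
    arbitrarily short; by [vball_step] each adds at most $(1+e/r)^m$ times the first increment, so
    the quotient at [e] is bounded by those near 0. *)
Lemma quot_le_surface_area A r (e : R) : ccvx A -> 0 < r -> cball r `<=` A -> 0 < e ->
  quot A e <= (1 + e / r) ^+ m * surface_area A.
Proof.
move=> cA r0 rA e0.
have A0 : A 0 by apply: rA; rewrite /cball/= enorm0 ltW.
have L0 : 0 < (1 + e / r) ^+ m by rewrite exprn_gt0// addr_gt0// divr_gt0.
rewrite mulrC -ler_pdivrMr//; apply: surface_area_ge => // t t0.
have [k ke] : exists k, e / k.+1%:R <= t.
  exists (Num.truncn (e / t)).
  by rewrite ler_pdivrMr// mulrC -ler_pdivrMr// ltW// truncnS_gt.
pose d := e / k.+1%:R.
have d0 : 0 < d by rewrite divr_gt0.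
apply: (@le_trans _ _ (quot A d)); last exact: quot_nondecreasing.
rewrite ler_pdivrMr//.
have H j : (j <= k.+1)%N -> vball A (j%:R * d) - volume A <= j%:R * ((1 + e / r) ^+ m * (vball A d - volume A)).
  elim: j => [_|j IH jk].
    rewrite !mul0r /vball (_ : cball 0 = [set 0]) ?minkowski0 ?subrr//.
    apply/seteqP; split => [b b0|_ ->]; last exact: cball0.
    by apply: enorm_eq0; apply/eqP; rewrite eq_le enorm_ge0 andbT.
  have {}IH := IH (ltnW jk).
  have := vball_step (e := e) cA r0 rA d0 (x := j%:R * d).
  have jd0 : 0 <= j%:R * d by rewrite mulr_ge0// ltW.
  have jde : j%:R * d <= e.
    by rewrite /d mulrCA ler_piMr ?(ltW e0)// ler_pdivrMr// mul1r ler_nat ltnW.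
  move=> /(_ jd0 jde).
  rewrite -natr1 !mulrDl !mul1r; lra.
have := H k.+1 (leqnn _); rewrite {1}/d mulrC divfK ?gt_eqF// => h.
rewrite /quot ler_pdivrMr//; apply: (le_trans h).
rewrite le_eqVlt; apply/orP; left; apply/eqP.
rewrite /d; field; rewrite !gt_eqF//.
Qed.

End ball_sum.

Section hsurface.
Context (R : realType) (m : nat).

(** Projection commutes with Minkowski sums and sends the unit ball onto that of the hyperplane, so
    both sides are the limit of one and the same function. *)
Lemma hsurface_areaE (xi : 'rV[R]_m.+1) (D : set 'rV[R]_m.+1) : sphere xi ->
  hsurface_area xi (proj_hyperplane xi D) = surface_area (hproj xi D).
Proof.
move=> xi1.
have hB : hproj xi (@unit_ball R m.+1) = @unit_ball R m by exact: (hproj_cball 1 xi1).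
have E (e : R) : minkowski_sum (proj_hyperplane xi D) (dilate e (hunit_ball xi)) =
    proj_hyperplane xi (minkowski_sum D (dilate e (@unit_ball R m.+1))).
  apply/seteqP; split.
    move=> _ [_ [x Dx <-] [_ [y [y0 y1] <-] <-]].
    exists (x + e *: y); first by exists x => //; exists (e *: y) => //; exists y.
    have y0' : dot y xi = 0 by [].
    by rewrite dotDl dotZl y0' mulr0 addr0 addrAC.
  move=> _ [_ [x Dx [_ [y y1 <-] <-]] <-].
  exists (x - dot x xi *: xi); first by exists x.
  exists (e *: (y - dot y xi *: xi)).
    exists (y - dot y xi *: xi) => //; split.
      by rewrite /hyperplane/= dotBl dotZl dot_sphere// mulr1 subrr.
    rewrite /unit_ball/= {1}(frame_decomp y xi1) addrAC subrr add0r.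
    rewrite enorm_mulmx; last exact: frm_mul.
    by apply: (le_trans (enorm_hproj _ xi1)); exact: y1.
  by rewrite dotDl dotZl; apply/rowP => i; rewrite !mxE; ring.
rewrite /hsurface_area /surface_area.
have -> : (fun e => (hvolume xi (minkowski_sum (proj_hyperplane xi D) (dilate e (hunit_ball xi))) -
    hvolume xi (proj_hyperplane xi D)) / e) =
  (fun e => (volume (minkowski_sum (hproj xi D) (dilate e (@unit_ball R m))) -
    volume (hproj xi D)) / e); last by [].
apply/funext => e.
by rewrite E !volume_hproj// hproj_minkowski hproj_dilate hB.
Qed.

End hsurface.

(** * Isotropic projection bodies *)

Section psd.
Context (R : realType).

Definition psd n (P : 'M[R]_n) := P^T = P /\ forall x : 'rV[R]_n, 0 <= dot (x *m P) x.

Lemma dot_row_mx p q (a c : 'rV[R]_p) (b d : 'rV[R]_q) :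
  dot (row_mx a b) (row_mx c d) = dot a c + dot b d.
Proof. by rewrite /dot tr_row_mx mul_row_col mxE. Qed.

Lemma dot1 (a b : 'rV[R]_1) : dot a b = a ord0 ord0 * b ord0 ord0.
Proof. by rewrite dotE big_ord1. Qed.

(** Hadamard's inequality, by Schur complements: $\det P=\alpha\det S$, where $\alpha$ is the first
    diagonal entry, [S] is again positive semidefinite, and its diagonal is bounded by that of
    [P]. *)
Lemma psd_det n (P : 'M[R]_n) : psd P ->
  0 <= \det P <= \prod_i P i i /\ forall i, 0 <= P i i.
Proof.
elim: n P => [|m IH] P [sP pP].
  by rewrite det_mx00 big_ord0 lexx ler01; split => // -[].
have diag i : 0 <= P i i.
  have := pP (delta_mx ord0 i).
  by rewrite -rowE dotE (bigD1 i)//= !mxE !eqxx mulr1 big1 ?addr0// => j ji;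
     rewrite !mxE eqxx (negbTE ji) mulr0.
split => //.
pose a := ulsubmx (P : 'M[R]_(1 + m)); pose b := ursubmx (P : 'M[R]_(1 + m)).
pose c := dlsubmx (P : 'M[R]_(1 + m)); pose P' := drsubmx (P : 'M[R]_(1 + m)).
have PE : P = block_mx a b c P' by rewrite submxK.
have cb : c = b^T.
  have : (block_mx a b c P')^T = block_mx a b c P' by rewrite -PE.
  by rewrite tr_block_mx => /eq_block_mx[].
have sP' : P'^T = P'.
  have : (block_mx a b c P')^T = block_mx a b c P' by rewrite -PE.
  by rewrite tr_block_mx => /eq_block_mx[].
pose al := a ord0 ord0.
have aE : a = al%:M by rewrite [LHS]mx11_scalar.
have alE : al = P ord0 ord0.
  by rewrite /al /a !mxE; congr (P _ _); apply/val_inj.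
have P'E i : P' i i = P (lift ord0 i) (lift ord0 i).
  by rewrite /P' !mxE; congr (P _ _); apply/val_inj.
have al0 : 0 <= al by rewrite alE.
have form (t : R) (y : 'rV[R]_m) :
    0 <= t ^+ 2 * al + 2 * t * dot b y + dot (y *m P') y.
  have pP' (x : 'rV[R]_(1 + m)) : 0 <= dot (x *m block_mx a b c P') x.
    by rewrite -PE; exact: pP.
  have := pP' (row_mx t%:M y).
  rewrite cb mul_row_block dot_row_mx dot1 aE -!scalar_mxM.
  rewrite mul_scalar_mx dotDl dotZl !mxE !mulr1n.
  have -> : \sum_j y ord0 j * b^T j ord0 = dot b y.
    by rewrite dotC dotE; apply: eq_bigr => j _; rewrite mxE.
  by congr (0 <= _); ring.
rewrite big_ord_recl -alE.
under eq_bigr do rewrite -P'E.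
have [al00|aln0] := eqVneq al 0.
  have b0 : b = 0.
    apply: dot_eq0; apply/eqP; rewrite eq_le dot_ge0 andbT.
    rewrite leNgt; apply/negP => bb.
    (* With $\alpha=0$ the form is affine in [t]; if [b] were nonzero, this [t] would give it the
       value $-1$. *)
    have := form (- (dot (b *m P') b + 1) / (2 * dot b b)) b.
    rewrite al00 mulr0 add0r.
    rewrite (_ : 2 * _ * dot b b = - (dot (b *m P') b + 1)); last by field; rewrite gt_eqF.
    by lra.
  have d0 : \det (block_mx a b c P') = 0.
    by rewrite cb b0 trmx0 aE al00 det_ublock det_scalar expr1 mul0r.
  by rewrite -PE in d0; rewrite d0 al00 mul0r lexx.
have alp : 0 < al by rewrite lt_neqAle eq_sym aln0.
pose S := P' - al^-1 *: (b^T *m b).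
have PS : \det P = al * \det S.
  have E : block_mx a b c P' = block_mx (1%:M : 'M[R]_1) 0 (al^-1 *: b^T) 1%:M *m block_mx a b 0 S.
    rewrite mulmx_block cb aE !mul1mx !mul0mx !addr0 ?mulmx0 ?addr0.
    congr block_mx.
      by rewrite mul_mx_scalar scalerA mulfV ?scale1r// gt_eqF.
    by rewrite -scalemxAl /S addrC subrK.
  have : \det (block_mx a b c P') = al * \det S.
    by rewrite E det_mulmx det_lblock !det1 !mul1r det_ublock aE det_scalar expr1.
  by rewrite -PE.
have pS : psd S.
  split.
    by rewrite /S linearB/= linearZ/= trmx_mul trmxK sP'.
  (* This [t] minimizes the form for fixed [y]; the minimum is the form of the Schur complement. *)
  move=> y; have := form (- (dot b y / al)) y.
  rewrite /S mulmxBr dotBl -scalemxAr dotZl mulmxA.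
  have -> : dot (y *m b^T *m b) y = dot b y ^+ 2.
    rewrite [y *m b^T]mx11_scalar -/(dot y b) mul_scalar_mx dotZl (dotC y b).
    by rewrite expr2.
  by congr (0 <= _); field; rewrite gt_eqF.
have [/andP[d0 dS] Sd] := IH S pS.
rewrite PS mulr_ge0//= ler_wpM2l//; apply: (le_trans dS).
apply: ler_prod => i _; rewrite Sd/=.
rewrite /S !mxE lerBlDr lerDl mulr_ge0// ?invr_ge0//.
by rewrite big_ord1 !mxE -expr2 sqr_ge0.
Qed.

(** Hadamard's inequality bounds the determinant by the product of the diagonal, and the inequality
    of arithmetic and geometric means bounds this product by $(\mathrm{tr}P/n)^n$. *)
Lemma psd_trace_ge n (P : 'M[R]_n) : psd P -> 1 <= \det P -> n%:R <= \tr P.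
Proof.
case: n P => [|m] P pP d1.
  by rewrite /mxtrace big_ord0.
have [/andP[_ dP] Pd] := psd_det pP.
have := @leif_AGM R 'I_m.+1 predT (fun i => P i i).
rewrite card_ord => /(_ (fun i _ => Pd i)) [+ _] => h.
have h1 : 1 <= (\tr P / m.+1%:R) ^+ m.+1 by apply: (le_trans d1); apply: (le_trans dP).
have t0 : 0 <= \tr P / m.+1%:R by rewrite divr_ge0// sumr_ge0.
rewrite -[leLHS]mul1r -ler_pdivlMr//.
by move: h1; rewrite -[X in X <= _ -> _](expr1n _ m.+1) ler_pXn2r// nnegrE.
Qed.

End psd.

Section bernoulli.
Context (R : realType).

Lemma bernoulli_sub (k : nat) (x : R) : 0 <= x -> x <= 1 -> 1 - k%:R * x <= (1 - x) ^+ k.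
Proof.
move=> x0 x1; elim: k => [|k IH]; first by rewrite mul0r subr0 expr0.
rewrite exprS; apply: (@le_trans _ _ ((1 - x) * (1 - k%:R * x))).
  rewrite -natr1; have : 0 <= k%:R * (x * x) by rewrite mulr_ge0// mulr_ge0.
  by lra.
by rewrite ler_wpM2l// subr_ge0.
Qed.

Lemma bernoulli_add (k : nat) (x : R) : 0 <= x -> 1 + k%:R * x <= (1 + x) ^+ k.
Proof.
move=> x0; elim: k => [|k IH]; first by rewrite mul0r addr0 expr0.
rewrite exprS; apply: (@le_trans _ _ ((1 + x) * (1 + k%:R * x))).
  rewrite -natr1; have : 0 <= k%:R * (x * x) by rewrite mulr_ge0// mulr_ge0.
  by lra.
by rewrite ler_wpM2l// addr_ge0.
Qed.

End bernoulli.

(** * The total length of the segments in isotropic position *)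

Section isotropic.
Context (R : realType) (m : nat) (D : set 'rV[R]_m.+1) (L : R).
Hypotheses (cD : ccvx D) (vD : volume D = 1) (L0 : 0 < L).
Hypothesis iso : forall xi, sphere xi ->
  (\int[@lebesgue_rV R m.+1]_(x in D) ((dot x xi ^+ 2)%:E) = (L ^+ 2)%:E)%E.

Let mD : measurable D := compact_measurable_rV cD.1.

Lemma measurable_dot_sqr (v : 'rV[R]_m.+1) (E : set 'rV[R]_m.+1) : measurable E ->
  measurable_fun E (fun x => (dot x v ^+ 2)%:E).
Proof.
move=> mE; apply/measurable_EFinP; apply: measurable_funX.
apply: (measurable_funS measurableT) => //.
by apply: continuous_measurable_rV; exact: dot_continuous.
Qed.

Lemma isotropic_hproj_ge xi : sphere xi -> 3 / (16 * L) <= volume (hproj xi D).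
Proof.
(* Half-width [2 * L]: at most a quarter of the volume lies outside the slab, and the remaining 3/4
   are at most [4 * L] times the projection, whence 3 / (16 L). *)
move=> xi1; pose S := D `&` [set x | `|dot x xi| <= 2 * L].
have L20 : 0 <= 2 * L by rewrite mulr_ge0// ltW.
have mS : measurable S.
  apply: measurableI => //; apply: closed_measurable_rV.
  apply: (@closed_preimage _ _ (fun x => `|dot x xi|) [set y | y <= 2 * L]).
    move=> x; apply: (@continuous_comp _ _ _ (fun x => dot x xi)).
      exact: dot_continuous.
    exact: norm_continuous.
  exact: closed_le.
have mDS : measurable (D `\` S) by exact: measurableD.
have lD : lebesgue_rV D = 1%E.
  by rewrite -[LHS]fineK ?compact_lebesgue_rV_fin//; [rewrite -/(volume D) vD|case: cD].
have fS (E : set 'rV[R]_m.+1) : measurable E -> E `<=` D -> lebesgue_rV E \is a fin_num.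
  move=> mE ED; rewrite ge0_fin_numE//; apply: (@le_lt_trans _ _ (lebesgue_rV D)).
    by apply: le_measure; rewrite ?inE.
  by rewrite lD ltry.
have fS1 := fS _ mS (@subIsetl _ _ _).
have fDS := fS _ mDS (@subDsetl _ _ _).
have split1 : volume S + fine (lebesgue_rV (D `\` S)) = 1.
  rewrite /volume -fineD// -measureU//; last by rewrite setDE setICA setICr setI0.
  by rewrite setDUK ?lD//; exact: subIsetl.
have cheb : fine (lebesgue_rV (D `\` S)) <= 1 / 4.
  have : ((4 * L ^+ 2)%:E * lebesgue_rV (D `\` S) <= (L ^+ 2)%:E)%E.
    rewrite -(iso xi1) -integral_cst//.
    have f0 x : D x -> (0%R <= (dot x xi ^+ 2)%:E)%E by move=> _; rewrite lee_fin sqr_ge0.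
    apply: le_trans (@ge0_subset_integral _ _ _ (@lebesgue_rV R m.+1) _ _ mDS mD _ (measurable_dot_sqr xi mD) f0 (@subDsetl _ _ _)).
    apply: ge0_le_integral => //.
    - by move=> x _; rewrite lee_fin; apply: mulr_ge0 => //; exact: sqr_ge0.
    - exact: measurable_dot_sqr.
    - move=> x [Dx Sx]; rewrite lee_fin.
      have h : 2 * L < `|dot x xi|.
        by rewrite ltNge; apply/negP => h; apply: Sx.
      rewrite (_ : 4 * L ^+ 2 = (2 * L) ^+ 2); last by ring.
      rewrite -[leRHS]ger0_norm ?sqr_ge0// normrX ler_sqr ?nnegrE//.
      exact: ltW.
  rewrite -(fineK fDS) -EFinM lee_fin => h.
  have L2 : 0 < L ^+ 2 by rewrite exprn_gt0.
  by rewrite -(ler_pM2l L2); lra.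
have := volume_slab xi1 cD L20; rewrite -/S => h.
rewrite ler_pdivrMr; last by rewrite mulr_gt0.
by lra.
Qed.

(** By homogeneity, isotropy yields $\int_D\langle x,v\rangle^2dx=L^2|v|^2$ for every vector $v$.
    With [M] the inverse of [zmx s] the integrand becomes $\langle x,A^{-1}x\rangle$. *)
Lemma isotropic_sum (s : seq (R * 'rV[R]_m.+1)) (M : 'M[R]_m.+1) :
  (forall p, p \in s -> 0 <= p.1) ->
  (\int[@lebesgue_rV R m.+1]_(x in D)
     (\sum_(p <- s) p.1 * dot x (p.2 *m M) ^+ 2)%:E =
   (L ^+ 2 * \sum_(p <- s) p.1 * enorm (p.2 *m M) ^+ 2)%:E)%E.
Proof.
elim: s => [_|p s IH wf].
  under eq_integral do rewrite big_nil.
  by rewrite big_nil mulr0 integral0.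
have p0 := wf p (mem_head _ _).
have wfs q : q \in s -> 0 <= q.1 by move=> qs; apply: wf; rewrite in_cons qs orbT.
under eq_integral do rewrite big_cons EFinD EFinM.
rewrite ge0_integralD//; last 4 first.
- by move=> x _; apply: mule_ge0; rewrite lee_fin// sqr_ge0.
- by apply: measurable_funeM; exact: measurable_dot_sqr.
- by move=> x _; rewrite lee_fin big_seq sumr_ge0// => q qs; rewrite mulr_ge0 ?sqr_ge0// wfs.
- under eq_fun do rewrite -sumEFin; apply: emeasurable_sum => q.
  by under eq_fun do rewrite EFinM; apply: measurable_funeM; exact: measurable_dot_sqr.
rewrite IH// ge0_integralZl//; last 2 first.
- exact: measurable_dot_sqr.
- by move=> x _; rewrite lee_fin sqr_ge0.
rewrite big_cons mulrDr [in RHS]EFinD; congr (_ + _)%E.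
set v := p.2 *m M.
suff -> : (\int[@lebesgue_rV R m.+1]_(x in D) (dot x v ^+ 2)%:E = (L ^+ 2 * enorm v ^+ 2)%:E)%E.
  by rewrite -EFinM; congr EFin; ring.
have [->|v0] := eqVneq v 0.
  under eq_integral do rewrite dot0r expr0n.
  by rewrite integral0 enorm0 expr0n mulr0.
have e0 := enorm_gt0 v0.
pose u := (enorm v)^-1 *: v.
have vE x : dot x v = enorm v * dot x u.
  by rewrite dotZr mulrA mulfV ?mul1r// gt_eqF.
under eq_integral do rewrite vE exprMn EFinM.
rewrite ge0_integralZl//; last 3 first.
- exact: measurable_dot_sqr.
- by move=> x _; rewrite lee_fin sqr_ge0.
- by rewrite lee_fin sqr_ge0.
by have := iso (sphere_normalize v0); rewrite -/u => ->; rewrite -EFinM mulrC.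
Qed.

(** The conditions on powers of [eta] keep the volumes of $(1\pm\eta)D$ within a factor 2 of
    $|D|=1$. *)
Variables (s : seq (R * 'rV[R]_m.+1)) (eta r : R).
Hypotheses (eta0 : 0 < eta) (eta2 : eta <= 1 / 2)
  (etaU : (1 + eta) ^+ m.+1 <= 2) (etaL : 1 / 2 <= (1 - eta) ^+ m.+1).
Hypotheses (wf : zono_wf s) (sL : dilate (1 - eta) D `<=` zono s)
  (sU : zono s `<=` dilate (1 + eta) D).
Hypotheses (r0 : 0 < r) (rD : cball r `<=` D).

Let n : R := m.+1%:R.

Lemma volume_zono_le2 : volume (zono s) <= 2.
Proof.
have e1 : 0 < 1 + eta by have := eta0; lra.
have vE : volume (dilate (1 + eta) D) = (1 + eta) ^+ m.+1.
  by rewrite volume_dilate ?vD ?mulr1//; case: cD.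
apply: le_trans etaU; rewrite -vE.
by apply: volume_le => //; [case: (ccvx_zono s)|apply: compact_dilate; case: cD].
Qed.

Lemma zlen_le_proj (c : R) : 0 < c ->
  (forall xi, sphere xi -> c <= volume (hproj xi D)) -> zlen s * c <= 8 * n.
Proof.
move=> c0 Hc.
have n1 : 1 <= n by rewrite ler1n.
have n0 : 0 < n by lra.
(* The weight is $1/(2n)$ so that Bernoulli's inequality leaves $u^m\ge1-m/(2n)\ge1/2$. *)
have [z [zE v0 v1]] : exists z : R, [/\ z * (2 * n) = 1, 0 < z & z <= 1 / 2].
  have n20 : 0 < 2 * n by rewrite mulr_gt0.
  exists (2 * n)^-1; split; rewrite ?mulVf ?gt_eqF ?invr_gt0//.
  by rewrite div1r lef_pV2 ?posrE//; lra.
pose u := 1 - z.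
have u0 : 0 < u by rewrite /u; lra.
have e1 : 0 < 1 - eta by have := eta2; lra.
have Zu : ccvx (dilate u (zono s)) by apply: ccvx_dilate; exact: ccvx_zono.
have uv : 0 < 1 - u by rewrite /u; lra.
have := volume_zono_lower Zu (zscale_wf (ltW uv) wf).
rewrite -dilate_zono// minkowski_dilate//; last by case: (ccvx_zono s).
rewrite (_ : u + (1 - u) = 1) ?dilate1 ?big_map; last by ring.
rewrite /= => h1.
have um : 1 / 2 <= u ^+ m.
  apply: le_trans (_ : 1 - m%:R * z <= _); last first.
    by apply: bernoulli_sub; [exact: ltW|lra].
  have mn : m%:R <= n by rewrite ler_nat.
  have : m%:R * z <= n * z by rewrite ler_pM2r.
  by move: zE; lra.
have e2 : 1 / 2 <= (1 - eta) ^+ m.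
  apply: (le_trans etaL); rewrite exprS ler_piMl// ?exprn_ge0 ?ltW//.
  by have := eta0; lra.
(* The factor 1/4 is a bound for $u^m(1-\eta)^m$: the projection of $uZ$ contains that of
   $u(1-\eta)D$. *)
have P p : p \in s -> 2 * ((1 - u) * p.1) * (1 / 4 * c) <=
    2 * ((1 - u) * p.1) * volume (hproj p.2 (dilate u (zono s))).
  move=> ps; have [p0 p1] := wf ps.
  apply: ler_wpM2l; first by rewrite !mulr_ge0// ltW.
  rewrite hproj_dilate volume_dilate//; last by case: (ccvx_hproj p.2 (ccvx_zono s)).
  have h2 : (1 - eta) ^+ m * volume (hproj p.2 D) <= volume (hproj p.2 (zono s)).
    rewrite -volume_dilate//; last by case: (ccvx_hproj p.2 cD).
    rewrite -hproj_dilate; apply: volume_hproj_le => //; first exact: ccvx_dilate.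
    exact: ccvx_zono.
  have h3 : 1 / 2 * c <= volume (hproj p.2 (zono s)).
    apply: le_trans h2; apply: ler_pM; [lra|exact: ltW|exact: e2|exact: Hc].
  rewrite (_ : 1 / 4 * c = 1 / 2 * (1 / 2 * c)); last by field.
  apply: ler_pM; [lra| |exact: um|exact: h3].
  by have := c0; lra.
have h4 : 2 * (1 - u) * (1 / 4 * c) * zlen s <= 2.
  rewrite /zlen mulr_sumr.
  apply: (@le_trans _ _ (\sum_(p <- s) 2 * ((1 - u) * p.1) * (1 / 4 * c))).
    by apply: ler_sum => p _; rewrite le_eqVlt; apply/orP; left; apply/eqP; ring.
  apply: (@le_trans _ _ (\sum_(p <- s) 2 * ((1 - u) * p.1) * volume (hproj p.2 (dilate u (zono s))))).
    by rewrite big_seq [leRHS]big_seq; apply: ler_sum => p ps; exact: P.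
  apply: (le_trans h1); have := volume_zono_le2; have := volume_ge0 (dilate u (zono s)); lra.
have E : 2 * (1 - u) * (1 / 4 * c) * zlen s = zlen s * c / (4 * n).
  rewrite /u opprB addrC subrK; apply: (@mulIf _ (4 * n)).
    by rewrite gt_eqF// mulr_gt0.
  rewrite divfK ?gt_eqF ?mulr_gt0//.
  rewrite (_ : _ * (4 * n) = zlen s * c * (z * (2 * n))); last by field.
  by rewrite zE mulr1.
by move: h4; rewrite E ler_pdivrMr ?mulr_gt0//; lra.
Qed.

Lemma zmx_sym : (zmx s)^T = zmx s.
Proof.
rewrite /zmx raddf_sum/=; apply: eq_bigr => p _.
by rewrite linearZ/= trmx_mul trmxK.
Qed.

Lemma zmx_form x : dot (x *m zmx s) x = \sum_(p <- s) p.1 * dot x p.2 ^+ 2.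
Proof.
rewrite /zmx mulmx_sumr dot_suml; apply: eq_bigr => p _.
rewrite -scalemxAr dotZl mulmxA [x *m _]mx11_scalar -/(dot x p.2) mul_scalar_mx dotZl.
by rewrite (dotC p.2) expr2.
Qed.

(** A kernel vector would be orthogonal to all segments of positive length, so [zono s] would have
    width 0 in its direction; but [zono s] contains a ball. *)
Lemma zmx_unit : zmx s \in unitmx.
Proof.
rewrite -row_free_unit -kermx_eq0; apply/negPn/negP => k0.
have [x xker x0] : exists2 x : 'rV[R]_m.+1, x *m zmx s = 0 & x != 0.
  exists (nz_row (kermx (zmx s))); last by rewrite nz_row_eq0.
  by apply/sub_kermxP; exact: nz_row_sub.
have : dot (x *m zmx s) x = 0 by rewrite xker dot0l.
rewrite zmx_form => H0.
have supp0 : zsupp s x = 0.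
  have H p : p \in s -> p.1 * dot x p.2 ^+ 2 = 0.
    move=> ps; apply/eqP; move: H0 => /eqP; rewrite big_seq psumr_eq0; last first.
      by move=> q /wf[q0 _]; rewrite mulr_ge0// sqr_ge0.
    by move=> /allP/(_ p ps); rewrite ps.
  rewrite /zsupp big_seq big1// => p ps.
  have /eqP := H p ps; rewrite mulf_eq0 expf_eq0/= => /orP[/eqP ->|/eqP h].
    by rewrite mul0r.
  by rewrite dotC h normr0 mulr0.
have e0 := enorm_gt0 x0.
have e1 : 0 < 1 - eta by have := eta2; lra.
pose y := (1 - eta) *: ((r / enorm x) *: x).
have Zy : zono s y.
  apply: sL; exists ((r / enorm x) *: x) => //; apply: rD.
  by rewrite /cball/= enormZ gtr0_norm ?divr_gt0// divfK// gt_eqF.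
have wf0 p : p \in s -> 0 <= p.1 by move=> /wf[].
have := zono_le_supp x wf0 Zy; rewrite supp0 /y !dotZl -sqr_enorm => h.
have : 0 < (1 - eta) * (r / enorm x * enorm x ^+ 2).
  by rewrite !mulr_gt0// ?divr_gt0// ?exprn_gt0 ?invr_gt0.
by lra.
Qed.

Let B := invmx (zmx s).

Lemma zmx_inv_sym : B^T = B.
Proof. by rewrite /B trmx_inv zmx_sym. Qed.

(** The sum is $Q=\langle A^{-1}x,x\rangle$. As $x\in Z$, it is at most the support function at
    $A^{-1}x$, that is $\sum_ja_j|\langle A^{-1}x,v_j\rangle|\le(Q+l)/2$. *)
Lemma zmx_inv_form_le x : zono s x -> \sum_(p <- s) p.1 * dot x (p.2 *m B) ^+ 2 <= zlen s.
Proof.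
move=> Zx.
have E p : dot x (p.2 *m B) = dot (x *m B) p.2 by rewrite [RHS]dot_mulmxl zmx_inv_sym.
set Q := \sum_(p <- s) _.
have QE : Q = dot (x *m B) x.
  rewrite /Q; under eq_bigr do rewrite E.
  by rewrite -zmx_form -mulmxA mulVmx ?zmx_unit// mulmx1 dotC.
have wf0 p : p \in s -> 0 <= p.1 by move=> /wf[].
have h1 : Q <= zsupp s (x *m B).
  by rewrite QE dotC; exact: zono_le_supp.
(* |a| <= (a^2 + 1) / 2 *)
have h2 : zsupp s (x *m B) <= (Q + zlen s) / 2.
  rewrite /zsupp /Q /zlen -big_split/= mulr_suml big_seq [leRHS]big_seq.
  apply: ler_sum => p /wf0 p0; rewrite E (dotC p.2).
  set a := dot (x *m B) p.2.
  have na : `|a| ^+ 2 = a ^+ 2 by rewrite real_normK// num_real.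
  by have := mulr_ge0 p0 (sqr_ge0 (`|a| - 1)); rewrite -na; lra.
by lra.
Qed.

(** Expand the middle factor of $A^{-1}=A^{-1}AA^{-1}$ as a sum over the segments. *)
Lemma zmx_inv_trace : \sum_(p <- s) p.1 * enorm (p.2 *m B) ^+ 2 = \tr B.
Proof.
have -> : \tr B = \tr (B *m zmx s *m B) by rewrite mulVmx ?zmx_unit// mul1mx.
rewrite /zmx mulmx_sumr mulmx_suml raddf_sum/=; apply: eq_bigr => p _.
rewrite -scalemxAr -scalemxAl linearZ/=; congr (_ * _).
have -> : B *m (p.2^T *m p.2) *m B = (B *m p.2^T) *m (p.2 *m B) by rewrite !mulmxA.
by rewrite mxtrace_mulC trace_mx11 sqr_enorm /dot trmx_mul zmx_inv_sym.
Qed.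

Lemma zmx_inv_trace_ge : n <= \tr B.
Proof.
have wf0 p : p \in s -> 0 <= p.1 by move=> /wf[].
have pA : psd (zmx s).
  split; first exact: zmx_sym.
  move=> x; rewrite zmx_form big_seq sumr_ge0// => p /wf0 p0.
  by rewrite mulr_ge0// sqr_ge0.
have pB : psd B.
  split; first exact: zmx_inv_sym.
  move=> x; have := pA.2 (x *m B).
  by rewrite -mulmxA mulVmx ?zmx_unit// mulmx1 dotC.
apply: psd_trace_ge => //.
have [/andP[dA0 _] _] := psd_det pA.
have dAn : \det (zmx s) != 0 by have := zmx_unit; rewrite unitmxE unitfE.
have dAp : 0 < \det (zmx s) by rewrite lt_neqAle eq_sym dAn.
rewrite /B det_inv -[1]invr1 lef_pV2 ?posrE//.
have := volume_zono_det (s := s) _; have h : forall p, p \in s -> 0 <= p.1 /\ enorm p.2 <= 1.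
  by move=> p /wf[p0 p1]; split => //; rewrite p1.
move=> /(_ h) h1; have h2 := le_trans h1 volume_zono_le2.
have p2 : 2 <= (2 : R) ^+ m.+1.
  by rewrite -[X in X <= _]expr1 ler_weXn2l// ler1n.
have : 2 * \det (zmx s) <= 2 ^+ m.+1 * \det (zmx s) by rewrite ler_pM2r.
by lra.
Qed.

(** The factor 4 in $nL^2\le4l$ is paid because only $(1-\eta)x$, with $1-\eta\ge1/2$, is known to
    lie in $Z$. With $l\le8n\cdot16L/3$ this gives $L\le512/3$, and then the constant. *)
Lemma isotropic_zlen_le : zlen s <= (256 / 3) ^+ 2 * n.
Proof.
have n1 : 1 <= n by rewrite ler1n.
have n0 : 0 < n by lra.
have e1 : 0 < 1 - eta by have := eta2; lra.
have c0 : 0 < 3 / (16 * L) by rewrite divr_gt0// mulr_gt0.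
have h1 := zlen_le_proj c0 isotropic_hproj_ge.
have {}h1 : zlen s <= 8 * n * (16 * L / 3).
  rewrite -(ler_pM2r c0); apply: (le_trans h1).
  by rewrite le_eqVlt; apply/orP; left; apply/eqP; field; rewrite gt_eqF.
have wf0 p : p \in s -> 0 <= p.1 by move=> /wf[].
have zl0 : 0 <= zlen s by rewrite /zlen big_seq sumr_ge0// => p /wf0.
have h2 : L ^+ 2 * n <= 4 * zlen s.
  have : (\int[@lebesgue_rV R m.+1]_(x in D)
     (\sum_(p <- s) p.1 * dot x (p.2 *m B) ^+ 2)%:E <= (4 * zlen s)%:E)%E.
    apply: (@le_trans _ _ (\int[@lebesgue_rV R m.+1]_(x in D) (cst (4 * zlen s)%:E x))%E).
      apply: ge0_le_integral => //.
      - by move=> x _; rewrite lee_fin big_seq sumr_ge0// => q qs; rewrite mulr_ge0 ?sqr_ge0// wf0.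
      - under eq_fun do rewrite -sumEFin; apply: emeasurable_sum => q.
        by under eq_fun do rewrite EFinM; apply: measurable_funeM; exact: measurable_dot_sqr.
      move=> x Dx; rewrite lee_fin.
      have Zx : zono s ((1 - eta) *: x) by apply: sL; exists x.
      have := zmx_inv_form_le Zx.
      under eq_bigr do rewrite dotZl exprMn mulrCA.
      rewrite -mulr_sumr; set Q := \sum_(p <- s) _ => h.
      have Q0 : 0 <= Q by rewrite /Q big_seq sumr_ge0// => q qs; rewrite mulr_ge0 ?sqr_ge0// wf0.
      have : 1 / 4 * Q <= (1 - eta) ^+ 2 * Q.
        by rewrite ler_wpM2r//; have := eta2; nra.
      by lra.
    rewrite integral_cst// [X in (_ * X <= _)%E](_ : _ = 1%E) ?mule1//.
    by rewrite -[LHS]fineK ?compact_lebesgue_rV_fin//; [rewrite -/(volume D) vD|case: cD].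
  rewrite isotropic_sum// lee_fin zmx_inv_trace; apply: le_trans.
  by rewrite ler_wpM2l ?sqr_ge0//; exact: zmx_inv_trace_ge.
have h3 : L * n * L <= L * n * (4 * 8 * (16 / 3)).
  by move: h2 h1; lra.
rewrite ler_pM2l in h3; last by rewrite mulr_gt0.
have : n * L <= n * (4 * 8 * (16 / 3)) by rewrite ler_pM2l.
by lra.
Qed.

End isotropic.

(** * The surface area inequality *)

Section main.
Context (R : realType) (k : nat).
Let m := k.+1.
Variables (D : set 'rV[R]_m.+1) (r : R).
Hypotheses (cD : ccvx D) (r0 : 0 < r) (rD : cball r `<=` D).

Let D0 : D 0.
Proof. by apply: rD; rewrite /cball/= enorm0 ltW. Qed.

(** [volume_zono_diff] for $A=uZ$ with $u=1-1/n$ and the ball of radius [eta], divided by [eta].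
    Monotonicity of increments replaces $Z$ by $(1-\eta)D$ in the lower bound and $uZ$ by
    $u(1+\eta)D$ in the upper bound. *)
Lemma surface_area_step (s : seq (R * 'rV[R]_m.+1)) (eta Sstar len : R) :
  0 < eta -> eta < 1 -> zono_wf s ->
  dilate (1 - eta) D `<=` zono s -> zono s `<=` dilate (1 + eta) D ->
  zlen s <= len -> 0 <= Sstar ->
  (forall xi, sphere xi -> surface_area (hproj xi D) <= Sstar) ->
  (1 - eta) ^+ m * surface_area D -
    (m%:R / m.+1%:R * (1 + eta)) ^+ m * ((1 + 2 * eta / r) ^+ m * surface_area D) <=
  2 / m.+1%:R * len * ((1 + eta) ^+ k * ((1 + eta / r) ^+ k * Sstar)).
Proof.
move=> eta0 eta1 wf sL sU slen S0 HS.
have [u uE] : exists u : R, u = m%:R / m.+1%:R by eexists.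
rewrite -uE.
have n0 : 0 < m.+1%:R :> R by rewrite ltr0n.
have u0 : 0 < u by rewrite uE divr_gt0// ltr0n.
have u1 : 1 - u = 1 / m.+1%:R by rewrite uE -natr1; field; rewrite natr1 gt_eqF.
have u2 : 1 / 2 <= u.
  have h : 2 <= m.+1%:R :> R by rewrite ler_nat.
  have : 1 - u <= 1 / 2 by rewrite u1 !div1r lef_pV2 ?posrE.
  by lra.
have uv : 0 < 1 - u by rewrite u1 divr_gt0.
have e1 : 0 < 1 - eta by lra.
have e2 : 0 < 1 + eta by lra.
have ue : 0 < u * (1 + eta) by rewrite mulr_gt0.
(* The radius that [quot_dilate] produces for the dilate $u(1+\eta)D$; it is harmless because
   $u\ge1/2$. *)
have ee2 : eta / (u * (1 + eta)) <= 2 * eta.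
  have h1 : 1 / 2 <= u * (1 + eta).
    by have := mulr_gt0 u0 eta0; rewrite mulrDr mulr1; lra.
  rewrite ler_pdivrMr//.
  have : 2 * eta * (1 / 2) <= 2 * eta * (u * (1 + eta)) by rewrite ler_pM2l// mulr_gt0.
  by lra.
have ee1 : eta / (1 + eta) <= eta by rewrite ler_pdivrMr// ler_peMr ?(ltW eta0)//; lra.
have cZ := ccvx_zono s.
have Z0 := zono_wf0 wf.
have cuZ : ccvx (dilate u (zono s)) by exact: ccvx_dilate.
have uZ0 : dilate u (zono s) 0 by exists 0; rewrite ?scaler0.
have uZE : minkowski_sum (dilate u (zono s)) (zono (zscale (1 - u) s)) = zono s.
  rewrite -dilate_zono// minkowski_dilate//; last by case: cZ.
  by rewrite (_ : u + (1 - u) = 1) ?dilate1//; ring.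
(* Bounds the increment due to the ball of radius [eta] for every convex set that contains the
   origin and lies in a projection of $(1+\eta)D$. *)
pose g := eta * ((1 + eta) ^+ k * ((1 + eta / r) ^+ k * Sstar)).
have g0 : 0 <= g.
  rewrite /g; apply: mulr_ge0; first exact: ltW.
  apply: mulr_ge0; first by rewrite exprn_ge0// ltW.
  apply: mulr_ge0 => //; rewrite exprn_ge0// addr_ge0// divr_ge0// ltW//.
have Hg p (C : set 'rV[R]_m) : p \in zscale (1 - u) s -> ccvx C -> C 0 ->
    C `<=` hproj p.2 (zono s) ->
    volume (minkowski_sum C (hproj p.2 (cball eta))) - volume C <= g.
  move=> /mapP[q /wf[_ q1] ->] /= cC C0 Cs.
  rewrite hproj_cball//.
  have cP : ccvx (hproj q.2 D) by exact: ccvx_hproj.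
  have rP : cball r `<=` hproj q.2 D by rewrite -(hproj_cball r q1); exact: hprojS.
  have P0 : hproj q.2 D 0 by apply: rP; rewrite /cball/= enorm0 ltW.
  have CP : C `<=` dilate (1 + eta) (hproj q.2 D).
    by apply: (subset_trans Cs); rewrite -hproj_dilate; exact: hprojS.
  apply: (le_trans (vball_mono cC (ccvx_dilate _ cP) C0 CP eta0)).
  have -> : vball (dilate (1 + eta) (hproj q.2 D)) eta - volume (dilate (1 + eta) (hproj q.2 D)) =
     eta * quot (dilate (1 + eta) (hproj q.2 D)) eta.
    by rewrite [RHS]mulrC divfK// gt_eqF.
  rewrite quot_dilate// /g ler_pM2l// ler_wpM2l ?exprn_ge0 ?(ltW e2)//.
  apply: (le_trans (quot_nondecreasing cP P0 _ ee1)); first by rewrite divr_gt0.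
  apply: (le_trans (quot_le_surface_area cP r0 rP eta0)).
  by rewrite ler_wpM2l ?HS// exprn_ge0// addr_ge0// divr_ge0// ltW.
have := @volume_zono_diff R m (dilate u (zono s)) (cball eta) (zono s) (zscale (1 - u) s) g
  cuZ (ccvx_cball _ _) cZ (zscale_wf (ltW uv) wf).
rewrite uZE => /(_ (@subset_refl _ _) Hg uZ0).
have -> : minkowski_sum (minkowski_sum (dilate u (zono s)) (cball eta)) (zono (zscale (1 - u) s)) =
    minkowski_sum (zono s) (@cball R m.+1 eta).
  by rewrite -minkowskiA (minkowskiC (cball eta)) minkowskiA uZE.
rewrite zlen_scale u1 -/(vball (zono s) eta) -/(vball (dilate u (zono s)) eta) => H.
have H1 : eta * ((1 - eta) ^+ m * surface_area D) <= vball (zono s) eta - volume (zono s).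
  have d0 : dilate (1 - eta) D 0 by exists 0; rewrite ?scaler0.
  apply: le_trans (vball_mono (ccvx_dilate _ cD) cZ d0 sL eta0).
  have -> : vball (dilate (1 - eta) D) eta - volume (dilate (1 - eta) D) =
     eta * quot (dilate (1 - eta) D) eta by rewrite [RHS]mulrC divfK// gt_eqF.
  rewrite quot_dilate// ler_pM2l// ler_wpM2l ?exprn_ge0 ?(ltW e1)//.
  by apply: surface_area_le => //; rewrite divr_gt0.
have H2 : vball (dilate u (zono s)) eta - volume (dilate u (zono s)) <=
    eta * ((u * (1 + eta)) ^+ m * ((1 + 2 * eta / r) ^+ m * surface_area D)).
  have UD : dilate u (zono s) `<=` dilate (u * (1 + eta)) D.
    by rewrite -dilate_dilate; exact: dilateS.
  apply: (le_trans (vball_mono cuZ (ccvx_dilate _ cD) uZ0 UD eta0)).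
  have -> : vball (dilate (u * (1 + eta)) D) eta - volume (dilate (u * (1 + eta)) D) =
     eta * quot (dilate (u * (1 + eta)) D) eta by rewrite [RHS]mulrC divfK// gt_eqF.
  rewrite quot_dilate// ler_pM2l// ler_wpM2l ?exprn_ge0 ?(ltW ue)//.
  apply: (le_trans (quot_nondecreasing cD D0 _ ee2)); first by rewrite divr_gt0.
  by apply: quot_le_surface_area => //; rewrite mulr_gt0.
rewrite -(ler_pM2l eta0).
have H3 : 2 * (1 / m.+1%:R * zlen s) * g <= 2 * (1 / m.+1%:R * len) * g.
  rewrite ler_wpM2r// ler_pM2l// ler_pM2l// divr_gt0//.
apply: (@le_trans _ _ (2 * (1 / m.+1%:R * len) * g)).
  apply: le_trans H3; apply: le_trans H; rewrite mulrBr.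
  move: H1 H2; generalize (vball (zono s) eta) (volume (zono s))
    (vball (dilate u (zono s)) eta) (volume (dilate u (zono s))) => a b c d H1 H2.
  apply: (le_trans (lerB H1 H2)); rewrite le_eqVlt; apply/orP; left; apply/eqP.
  by ring.
rewrite /g le_eqVlt; apply/orP; left; apply/eqP; ring.
Qed.

Lemma surface_area_bound (Sstar len c : R) :
  0 < c -> c <= 1 -> 0 <= Sstar ->
  (forall eta, 0 < eta -> eta < c -> exists s, [/\ zono_wf s,
     dilate (1 - eta) D `<=` zono s, zono s `<=` dilate (1 + eta) D & zlen s <= len]) ->
  (forall xi, sphere xi -> surface_area (hproj xi D) <= Sstar) ->
  surface_area D <= 4 / m.+1%:R * len * Sstar.
Proof.
move=> c0 c1 S0 Hs HS; pose u : R := m%:R / m.+1%:R; pose S := surface_area D.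
have SD0 : 0 <= S by exact: surface_area_ge0.
have n0 : 0 < m.+1%:R :> R by rewrite ltr0n.
(* The right side minus the left side of [surface_area_step], as a polynomial in [eta]. *)
pose p : {poly R} := (2 / m.+1%:R * len)%:P *
    ((1 + 'X) ^+ k * ((1 + (r^-1)%:P * 'X) ^+ k * Sstar%:P))
  - (1 - 'X) ^+ m * S%:P
  + (u%:P * (1 + 'X)) ^+ m * ((1 + (2 * r^-1)%:P * 'X) ^+ m * S%:P).
have pE x : p.[x] = 2 / m.+1%:R * len * ((1 + x) ^+ k * ((1 + r^-1 * x) ^+ k * Sstar))
   - (1 - x) ^+ m * S + (u * (1 + x)) ^+ m * ((1 + 2 * r^-1 * x) ^+ m * S).
  by rewrite /p !hornerE.
have : 0 <= p.[0].
  apply: (@poly_right_limit_ge0 R p c) => // x x0 xc.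
  have [s [wf sL sU sl]] := Hs x x0 xc.
  have := surface_area_step x0 (lt_le_trans xc c1) wf sL sU sl S0 HS.
  rewrite -subr_ge0 => h; apply: (le_trans h); rewrite pE -/S -/u.
  have -> : r^-1 * x = x / r by rewrite mulrC.
  have -> : 2 * r^-1 * x = 2 * x / r by rewrite mulrAC.
  by rewrite opprB addrA addrAC lexx.
rewrite pE !mulr0 !addr0 subr0 !expr1n !mul1r mulr1.
(* Here $1/u=1+1/m$, and $(1+1/m)^m\ge2$ by Bernoulli's inequality. *)
have um : u ^+ m <= 1 / 2.
  have := bernoulli_add m (_ : 0 <= m%:R^-1 :> R); rewrite invr_ge0 ler0n => /(_ isT).
  rewrite mulfV ?pnatr_eq0// => h.
  have uE : u = (1 + m%:R^-1)^-1.
    by rewrite /u -natr1; field; rewrite natr1 !pnatr_eq0.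
  rewrite uE exprVn div1r lef_pV2 ?posrE// ?exprn_gt0//.
have : u ^+ m * S <= 1 / 2 * S by rewrite ler_wpM2r.
rewrite -/S (_ : 4 / m.+1%:R * len * Sstar = 2 * (2 / m.+1%:R * len * Sstar)); last by ring.
by move: (u ^+ m * S) (2 / m.+1%:R * len * Sstar) (S) => a b d; lra.
Qed.

End main.

(** * Convex bodies and balls inside them *)

Section bodies.
Context (R : realType) (n : nat).

Lemma convex_body_ccvx (K : set 'rV[R]_n) : convex_body K -> ccvx K.
Proof.
move=> [cK vK _]; split => // x y t Kx Ky t0 t1.
have Kx' : (x : convex_lmodType 'rV[R]_n) \in (K : set (convex_lmodType 'rV[R]_n)) by apply/mem_set.
have Ky' : (y : convex_lmodType 'rV[R]_n) \in (K : set (convex_lmodType 'rV[R]_n)) by apply/mem_set.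
exact: (set_mem (vK x y (Itv01 t0 t1) Kx' Ky')).
Qed.

Lemma interior_cball (K : set 'rV[R]_n) x : interior K x ->
  exists2 r, 0 < r & forall y, enorm y <= r -> K (y + x).
Proof.
move=> /nbhs_ballP[e /= e0 He]; exists (e / 2); first by rewrite divr_gt0.
move=> y ye; apply: He; rewrite mx_norm_ball /ball_/= opprD addrCA subrr addr0 normrN.
by apply: (le_lt_trans (norm_le_enorm _)); apply: (le_lt_trans ye); lra.
Qed.

(** A ball around an interior point [x] and its mirror image around [- x] both lie in [D]; their
    midpoints fill a ball around the origin. *)
Lemma symmetric_cball (D : set 'rV[R]_n) : ccvx D -> origin_symmetric D ->
  interior D !=set0 -> exists2 r, 0 < r & cball r `<=` D.
Proof.
move=> [_ vD] sD [x /interior_cball[r r0 H]]; exists r => // y yr.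
have h1 : D (y + x) by exact: H.
have h2 : D (y - x).
  rewrite sD; exists (- y + x); last by rewrite opprD opprK.
  by apply: H; rewrite enormN.
have p1 : 0 <= 1 / 2 :> R by lra.
have p2 : 1 / 2 <= 1 :> R by lra.
rewrite (_ : y = (1 / 2) *: (y + x) + (1 - 1 / 2) *: (y - x)); first exact: vD.
by apply/rowP => i; rewrite !mxE; field.
Qed.

End bodies.

Section final.
Context (R : realType).

Lemma pow_near1_both (n : nat) : exists2 c : R, 0 < c & c <= 1 / 2 /\
  forall eta, 0 < eta -> eta < c ->
    (1 + eta) ^+ n <= 2 /\ 1 / 2 <= (1 - eta) ^+ n.
Proof.
have [x x0 Hx] := pow_near1 n (@ltr01 R).
have n0 : 0 < (2 * n.+1%:R)^-1 :> R by rewrite invr_gt0 mulr_gt0.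
exists (Num.min x (2 * n.+1%:R)^-1); first by rewrite lt_min x0.
have n1 : (2 * n.+1%:R)^-1 <= 1 / 2 :> R.
  by rewrite div1r lef_pV2 ?posrE ?mulr_gt0// ler_peMr// ler1n.
split; first by rewrite ge_min n1 orbT.
move=> eta eta0; rewrite lt_min => /andP[h1 h2]; split.
  apply: (le_trans (_ : _ <= (1 + x) ^+ n)); last first.
    by apply: (le_trans Hx); rewrite -natr1 mulr1n.
  by rewrite lerXn2r ?nnegrE; lra.
have eh : eta <= 1 / 2 := ltW (lt_le_trans h2 n1).
apply: (le_trans _ (bernoulli_sub n (ltW eta0) _)); last by lra.
have h3 : eta * (2 * n.+1%:R) <= 1.
  by rewrite -ler_pdivlMr ?mulr_gt0// div1r ltW.
have h4 : n%:R * eta <= n.+1%:R * eta by rewrite ler_pM2r// ler_nat.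
by lra.
Qed.

Lemma isotropic_volume n (D : set 'rV[R]_n.+1) (t : R) : 0 < t -> compact D ->
  volume (dilate t D) = 1 -> volume D `^ n.+1%:R^-1 = t^-1.
Proof.
move=> t0 cD; rewrite volume_dilate// => h.
have -> : volume D = (t^-1) ^+ n.+1.
  have tn : t ^+ n.+1 != 0 by rewrite gt_eqF// exprn_gt0.
  by apply: (mulfI tn); rewrite h exprVn mulfV.
rewrite -powR_mulrn ?invr_ge0 ?(ltW t0)// -powRrM mulfV ?pnatr_eq0// powRr1//.
by rewrite invr_ge0 ltW.
Qed.

Lemma sphere_nonempty n : exists x : 'rV[R]_n.+1, sphere x.
Proof.
exists (delta_mx ord0 ord0); rewrite /sphere/= /enorm (_ : dot _ _ = 1) ?sqrtr1//.
by rewrite dotE (bigD1 ord0)//= !mxE !eqxx mulr1 big1 ?addr0// => i i0;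
   rewrite !mxE (negbTE i0) mulr0.
Qed.

Lemma translate_ccvx n (x : 'rV[R]_n) K : ccvx K -> ccvx [set y + x | y in K].
Proof.
move=> [cK vK]; split; first by apply: compact_image cK; exact: addr_continuous.
move=> _ _ t [a Ka <-] [b Kb <-] t0 t1.
exists (t *: a + (1 - t) *: b); first exact: vK.
by apply/rowP => i; rewrite !mxE; ring.
Qed.

(** [0 <= Sstar] is part of the conclusion because the bound is later enlarged by the factor
    $\ln^2n/\ln^22\ge1$. *)
Lemma projection_body_surface_area (C : R) k (D : set 'rV[R]_k.+2) :
  (256 / 3) ^+ 2 <= C ->
  is_projection_body D -> isotropic_up_to_dilation D ->
  let Sstar := sup [set hsurface_area xi (proj_hyperplane xi D) | xi in @sphere R k.+2] in
  0 <= Sstar /\ surface_area D <= 4 * C * Sstar * volume D `^ k.+2%:R^-1.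
Proof.
move=> HC [K bK [bD sD DK]] [t t0 [vD [L L0 iso]]].
have cK := convex_body_ccvx bK; have cD := convex_body_ccvx bD.
have [r r0 rD] : exists2 r, 0 < r & cball r `<=` D.
  by apply: symmetric_cball => //; case: bD.
have D0 : D !=set0 by exists 0; apply: rD; rewrite /cball/= enorm0 ltW.
have [_ _ [x0 /interior_cball[r1 r10 Hr1]]] := bK.
(* [K] may miss the origin. A translate contains a ball around it, and the volumes of the
   projections are unchanged. *)
pose K' := [set y + - x0 | y in K].
have cK' : ccvx K' by exact: translate_ccvx.
have rK' : cball r1 `<=` K'.
  by move=> y yr; exists (y + x0); [exact: Hr1|rewrite addrK].
have DK' theta : sphere theta -> support_function D theta = volume (hproj theta K').
  move=> th1; rewrite DK// volume_hproj// hproj_translate volume_translate//.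
  by case: (ccvx_hproj theta cK).
rewrite (isotropic_volume t0 cD.1 vD) => Sstar.
have hE xi : sphere xi ->
    hsurface_area xi (proj_hyperplane xi D) = surface_area (hproj xi D).
  exact: hsurface_areaE.
have cP xi : ccvx (hproj xi D) by exact: ccvx_hproj.
have rP xi : sphere xi -> cball r `<=` hproj xi D.
  by move=> xi1; rewrite -(hproj_cball r xi1); exact: hprojS.
have P0 xi : sphere xi -> hproj xi D 0.
  by move=> xi1; apply: rP => //; rewrite /cball/= enorm0 ltW.
have [M M0 DM] := compact_enorm_bounded cD.1.
have HS xi : sphere xi -> surface_area (hproj xi D) <= Sstar.
  move=> xi1; apply: ub_le_sup; last by exists xi; [exact: xi1|exact: hE].
  (* [sup] is meaningful only for a set bounded above: [D] lies in a ball of radius [M], and a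
     surface area is at most the quotient with radius 1. *)
  exists (volume (@cball R k.+1 (M + 1))) => _ [xi' xi'1 <-].
  rewrite hE//; apply: (le_trans (surface_area_le (cP xi') (P0 _ xi'1) ltr01)).
  rewrite /quot divr1; apply: (@le_trans _ _ (vball (hproj xi' D) 1)).
    by have := volume_ge0 (hproj xi' D); lra.
  apply: volume_le.
  - by case: (ccvx_ball_sum 1 (cP xi')).
  - by case: (@ccvx_cball R k.+1 (M + 1)).
  rewrite -minkowski_cball//; apply: minkowskiS => //.
  by rewrite -(hproj_cball M xi'1); exact: hprojS.
have S0 : 0 <= Sstar.
  have [xi xi1] := sphere_nonempty k.+1.
  by apply: le_trans (HS _ xi1); apply: surface_area_ge0 => //; exact: P0.
split=> //.
have [c c0 [c2 Hc]] := pow_near1_both k.+2.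
have tn0 : 0 < t^-1 by rewrite invr_gt0.
(* Prepares [len] equal to $Cn/t$: the zonotopes approximate [D], and their dilates by [t], which
   approximate the isotropic body $tD$, are the ones of length at most $Cn$. *)
have -> : 4 * C * Sstar * t^-1 = 4 / k.+2%:R * (C * k.+2%:R * t^-1) * Sstar.
  by field; rewrite gt_eqF//= -natr1 -natr1; lra.
apply: (@surface_area_bound R k D r cD r0 rD Sstar _ c) => //; first by lra.
move=> eta eta0 etac; have [eU eL] := Hc _ eta0 etac.
have eta1 : eta < 1 by lra.
have [s [wf sL sU]] := zono_approx cK' r10 rK' cD D0 DK' eta0 eta1.
exists s; split => //.
have zl : zlen (zscale t s) <= C * k.+2%:R.
  apply: le_trans (ler_wpM2r (ler0n _ _) HC).
  apply: (@isotropic_zlen_le R k.+1 (dilate t D) L (ccvx_dilate t cD) vD L0 iso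
     (zscale t s) eta (t * r)) => //.
  - by lra.
  - exact: zscale_wf (ltW t0) wf.
  - by rewrite -dilate_zono// dilate_dilate mulrC -dilate_dilate; exact: dilateS.
  - by rewrite -dilate_zono// dilate_dilate mulrC -dilate_dilate; exact: dilateS.
  - by rewrite mulr_gt0.
  - by rewrite -dilate_cball//; exact: dilateS.
by rewrite ler_pdivlMr// mulrC -zlen_scale.
Qed.

End final.

Theorem theorem2 (R : realType) :
  exists2 C : R, 0 < C &
    forall (n : nat) (D : set 'rV[R]_n),
      (2 <= n)%N ->
      is_projection_body D ->
      isotropic_up_to_dilation D ->
      surface_area D <=
        C * ln n%:R ^+ 2
          * sup [set hsurface_area xi (proj_hyperplane xi D)
                | xi in @sphere R n]
          * volume D `^ n%:R^-1.
Proof.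
have l2 : 0 < ln (2 : R) by rewrite ln_gt0// ltr1n.
have [C HC C0] : exists2 C : R, (256 / 3) ^+ 2 <= C & 0 < C.
  by exists ((256 / 3) ^+ 2); [exact: lexx|apply: exprn_gt0; apply: divr_gt0; rewrite ltr0n].
exists (4 * C / ln 2 ^+ 2); first by rewrite divr_gt0 ?exprn_gt0 ?mulr_gt0.
move=> [|[|k]]// D _ pD iD.
have [S0 h] := projection_body_surface_area HC pD iD; apply: (le_trans h).
rewrite ler_wpM2r ?powR_ge0// ler_wpM2r// -mulrA ler_peMr ?mulr_ge0 ?(ltW C0)// mulrC.
rewrite ler_pdivlMr ?exprn_gt0// mul1r ler_pXn2r ?nnegrE ?(ltW l2)//.
  by rewrite ler_ln ?posrE// ler_nat.
by rewrite ln_ge0// ler1n.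
Qed.
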